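(* For every finitely presented group $G$ there exists a finite subset $X\subseteq\mathbb{R}^4$ such that $\pi_1(\mathcal{R}(X))\cong G$.
   Context: For a subset $X\subseteq\mathbb{R}^n$ (with the Euclidean metric), the Rips complex $\mathcal{R}(X)$ (at distance scale $1$) is the abstract simplicial complex with vertex set $X$ in which a finite nonempty set $Y\subseteq X$ is a face if and only if its Euclidean diameter is less than $1$. An abstract simplicial complex is identified with its geometric realization. The basepoint-free notation $\pi_1(\mathcal{R}(X))$ presupposes that $\mathcal{R}(X)$ is nonempty and path-connected. *)

(* Defs.v *)
From HB Require Import structures.
From mathcomp Require Import all_boot all_order all_algebra finmap.
From mathcomp Require Import generic_quotient lra.
From mathcomp Require Import all_classical all_reals all_analysis homotopy.
Set Implicit Arguments.
Unset Strict Implicit.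
Unset Printing Implicit Defensive.
Import Order.TTheory GRing.Theory Num.Theory.
Import numFieldNormedType.Exports.
Local Open Scope classical_set_scope.
Local Open Scope ring_scope.

Definition group_iso (G H : groupType) : Prop :=
  exists f : {multiplicative G -> H}, bijective f.

(* The letter (i, true) stands for the i-th generator, (i, false) for its
   formal inverse. *)
Notation word n := (seq ('I_n * bool)).

Definition inv_letter n (a : 'I_n * bool) : 'I_n * bool := (a.1, ~~ a.2).

Definition inv_word n (w : word n) : word n := rev (map (@inv_letter n) w).

Section PresentedGroup.
Variables (n : nat) (rels : seq (word n)).

(* The least congruence on words (for concatenation) that makes each letter
   cancel its inverse and each relator trivial. *)
Inductive word_cong : word n -> word n -> Prop :=
| word_cong_refl w : word_cong w w
| word_cong_sym w1 w2 : word_cong w1 w2 -> word_cong w2 w1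
| word_cong_trans w1 w2 w3 :
    word_cong w1 w2 -> word_cong w2 w3 -> word_cong w1 w3
| word_cong_cat w1 w2 w1' w2' :
    word_cong w1 w1' -> word_cong w2 w2' ->
    word_cong (w1 ++ w2) (w1' ++ w2')
| word_cong_cancel a : word_cong [:: a; inv_letter a] [::]
| word_cong_rel r : r \in rels -> word_cong r [::].

Definition word_congb (w1 w2 : word n) : bool := `[< word_cong w1 w2 >].

Lemma word_congb_refl : reflexive word_congb.
Proof. by move=> w; apply/asboolP; exact: word_cong_refl. Qed.

Lemma word_congb_sym : symmetric word_congb.
Proof. by move=> v w; apply/asboolP/asboolP; exact: word_cong_sym. Qed.

Lemma word_congb_trans : transitive word_congb.
Proof.
by move=> v u w /asboolP uv /asboolP vw; apply/asboolP; exact: word_cong_trans vw.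
Qed.

Canonical word_cong_equiv :=
  EquivRel word_congb word_congb_refl word_congb_sym word_congb_trans.

(* The group < x_0, ..., x_(n-1) | rels >. *)
Definition presented_group : Type := {eq_quot word_cong_equiv}%qT.

HB.instance Definition _ := Choice.on presented_group.
HB.instance Definition _ := EqQuotient.on presented_group.

Definition word_class (w : word n) : presented_group :=
  (\pi_presented_group w)%qT.

Lemma word_classP (v w : word n) : word_class v = word_class w <-> word_cong v w.
Proof. by split=> [/eqquotP/asboolP //|vw]; apply/eqquotP/asboolP. Qed.

Lemma word_class_ind (P : presented_group -> Prop) :
  (forall w, P (word_class w)) -> forall x, P x.
Proof. by move=> Pw x; rewrite -[x]reprK; exact: Pw. Qed.

Lemma word_cong_invl (u : word n) : word_cong (inv_word u ++ u) [::].
Proof.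
elim: u => [|a u IH]; first exact: word_cong_refl.
have -> : inv_word (a :: u) ++ a :: u =
    inv_word u ++ [:: inv_letter a; inv_letter (inv_letter a)] ++ u.
  rewrite /inv_word /= rev_cons cat_rcons.
  by case: a => i b; rewrite /inv_letter /= negbK.
apply: word_cong_trans IH; apply: word_cong_cat; first exact: word_cong_refl.
rewrite -[X in word_cong _ X]cat0s.
by apply: word_cong_cat; [exact: word_cong_cancel|exact: word_cong_refl].
Qed.

Lemma inv_wordK : involutive (@inv_word n).
Proof.
move=> w; rewrite /inv_word map_rev revK -map_comp map_id_in// => -[i b] _.
by rewrite /= /inv_letter negbK.
Qed.

Lemma word_cong_invr (u : word n) : word_cong (u ++ inv_word u) [::].
Proof. by rewrite -{1}(inv_wordK u); exact: word_cong_invl. Qed.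

Lemma word_cong_inv (v w : word n) :
  word_cong v w -> word_cong (inv_word v) (inv_word w).
Proof.
move=> vw; apply: (@word_cong_trans _ (inv_word v ++ w ++ inv_word w)).
  rewrite -[X in word_cong X _]cats0; apply: word_cong_cat.
    exact: word_cong_refl.
  exact/word_cong_sym/word_cong_invr.
rewrite catA -[X in word_cong _ X]cat0s.
apply: word_cong_cat; last exact: word_cong_refl.
apply: word_cong_trans (word_cong_invl v).
by apply: word_cong_cat; [exact: word_cong_refl|exact: word_cong_sym].
Qed.

Definition pres_one : presented_group := word_class [::].
Definition pres_mul (x y : presented_group) : presented_group :=
  word_class (repr x ++ repr y).
Definition pres_inv (x : presented_group) : presented_group :=
  word_class (inv_word (repr x)).

Lemma repr_word_class (w : word n) : word_cong (repr (word_class w)) w.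
Proof. by apply/word_classP; exact: reprK. Qed.

Lemma pres_mulE (v w : word n) :
  pres_mul (word_class v) (word_class w) = word_class (v ++ w).
Proof. by apply/word_classP/word_cong_cat; exact: repr_word_class. Qed.

Lemma pres_invE (w : word n) : pres_inv (word_class w) = word_class (inv_word w).
Proof. by apply/word_classP/word_cong_inv; exact: repr_word_class. Qed.

Lemma pres_mulA : associative pres_mul.
Proof.
elim/word_class_ind => u; elim/word_class_ind => v; elim/word_class_ind => w.
by rewrite !pres_mulE catA.
Qed.

Lemma pres_mul1 : left_id pres_one pres_mul.
Proof. by elim/word_class_ind => u; rewrite pres_mulE. Qed.

Lemma pres_mulr1 : right_id pres_one pres_mul.
Proof. by elim/word_class_ind => u; rewrite pres_mulE cats0. Qed.

Lemma pres_mulV : left_inverse pres_one pres_inv pres_mul.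
Proof.
elim/word_class_ind => u; rewrite pres_invE pres_mulE.
exact/word_classP/word_cong_invl.
Qed.

Lemma pres_mulrV : right_inverse pres_one pres_inv pres_mul.
Proof.
elim/word_class_ind => u; rewrite pres_invE pres_mulE.
exact/word_classP/word_cong_invr.
Qed.

HB.instance Definition _ := isGroup.Build presented_group
  pres_mulA pres_mul1 pres_mulr1 pres_mulV pres_mulrV.

End PresentedGroup.

Definition finitely_presented (G : groupType) : Prop :=
  exists (n : nat) (rels : seq (word n)), group_iso G (presented_group rels).

Section UnitInterval.
Variable R : realType.

Definition unit_itv : Type := [set` `[0 : R, 1]%R].

HB.instance Definition _ := Choice.on unit_itv.
HB.instance Definition _ := Topological.on unit_itv.

Definition itv_val (t : unit_itv) : R := \val t.

Lemma itv_proj_subproof (t : R) :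
  Order.max 0 (Order.min 1 t) \in [set` `[0 : R, 1]%R].
Proof.
apply/mem_set; rewrite /= in_itv /=.
by rewrite le_max lexx /= ge_max ler01 /= ge_min lexx.
Qed.

Definition itv_proj (t : R) : unit_itv :=
  exist _ (Order.max 0 (Order.min 1 t)) (itv_proj_subproof t).

Lemma itv_val_ge0 (t : unit_itv) : 0 <= itv_val t.
Proof. by case: t => t tI; have := set_mem tI; rewrite /= in_itv => /andP[]. Qed.

Lemma itv_val_le1 (t : unit_itv) : itv_val t <= 1.
Proof. by case: t => t tI; have := set_mem tI; rewrite /= in_itv => /andP[]. Qed.

Lemma itv_val_inj : injective itv_val.
Proof. exact: val_inj. Qed.

Lemma itv_valK : cancel itv_val itv_proj.
Proof.
move=> t; apply: itv_val_inj; rewrite {1}/itv_val /=.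
by rewrite min_r ?itv_val_le1// max_r// itv_val_ge0.
Qed.

Lemma itv_projK (t : R) : 0 <= t <= 1 -> itv_val (itv_proj t) = t.
Proof. by case/andP=> t0 t1; rewrite /itv_val /= min_r// max_r. Qed.

Lemma itv_proj_le0 (t : R) : t <= 0 -> itv_proj t = itv_proj 0.
Proof.
move=> t0; apply: itv_val_inj; rewrite /itv_val /=.
by rewrite !min_r ?max_l ?(le_trans t0).
Qed.

Lemma itv_proj_ge1 (t : R) : 1 <= t -> itv_proj t = itv_proj 1.
Proof. by move=> t1; apply: itv_val_inj; rewrite /itv_val /= !min_l. Qed.

Lemma itv_zero_neq_one : itv_proj 0 != itv_proj 1.
Proof.
apply/eqP => /(congr1 itv_val); rewrite !itv_projK ?lexx ?ler01//.
by move/eqP; rewrite eq_sym oner_eq0.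
Qed.

HB.instance Definition _ := @isBiPointed.Build unit_itv
  (itv_proj 0) (itv_proj 1) itv_zero_neq_one.

Lemma itv_val0 : itv_val zero = 0.
Proof. by apply: itv_projK; rewrite lexx ler01. Qed.

Lemma itv_val1 : itv_val one = 1.
Proof. by apply: itv_projK; rewrite lexx ler01. Qed.

Lemma itv_proj0 : itv_proj 0 = zero. Proof. by []. Qed.
Lemma itv_proj1 : itv_proj 1 = one. Proof. by []. Qed.

Lemma itv_val_continuous : continuous itv_val.
Proof. exact: initial_continuous. Qed.

Lemma itv_proj_continuous : continuous itv_proj.
Proof.
apply: continuous_comp_initial => t; apply: continuous_max.
  exact: cst_continuous.
by apply: continuous_min; [exact: cst_continuous|exact: id].
Qed.

End UnitInterval.

Section Gluing.
Variables (R : realType) (Z T : topologicalType).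

Lemma continuous_glue (c : Z -> R) (f g : Z -> T) :
  continuous c -> continuous f -> continuous g ->
  (forall z, c z = 2^-1 -> f z = g z) ->
  continuous (fun z => if c z <= 2^-1 then f z else g z).
Proof.
move=> cc cf cg fg; set h := (X in continuous X).
pose A := [set z | c z <= 2^-1]; pose B := [set z | 2^-1 <= c z].
have cA : closed A.
  by apply: (@closed_comp _ _ c [set x | x <= 2^-1]) => //; exact: closed_le.
have cB : closed B.
  by apply: (@closed_comp _ _ c [set x | 2^-1 <= x]) => //; exact: closed_ge.
have AB : A `|` B = setT.
  by apply/seteqP; split=> // z _; case: (leP (c z) 2^-1) => [|/ltW]; [left|right].
apply/continuous_subspace_setT; rewrite -AB; apply: withinU_continuous => //.
  apply: (@subspace_eq_continuous _ A _ (f : subspace A -> T)).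
    by move=> z zA; rewrite /from_subspace /h (set_mem zA : c z <= 2^-1).
  exact: continuous_subspaceT.
apply: (@subspace_eq_continuous _ B _ (g : subspace B -> T)).
  move=> z zB'; have zB : 2^-1 <= c z := set_mem zB'.
  rewrite /from_subspace /h; case: ifP => // zA.
  by apply/esym/fg/eqP; rewrite eq_le zA.
exact: continuous_subspaceT.
Qed.

End Gluing.

Section ContinuousReal.
Variables (R : realType) (Z : topologicalType) (u v : Z -> R).
Hypotheses (cu : continuous u) (cv : continuous v).

Lemma scale_continuous (a : R) : continuous (fun z => a * u z).
Proof. by move=> z; apply: cvgM; [exact: cvg_cst|exact: cu]. Qed.

Lemma affine_continuous (a b : R) : continuous (fun z => a * u z + b).
Proof. by move=> z; apply: cvgD; [exact: scale_continuous|exact: cvg_cst]. Qed.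

Lemma onem_continuous : continuous (fun z => 1 - u z).
Proof. by move=> z; apply: cvgB; [exact: cvg_cst|exact: cu]. Qed.

Lemma minr_continuous : continuous (fun z => Order.min (u z) (v z)).
Proof. by move=> z; apply: (@continuous_min _ _ u v z); [exact: cu|exact: cv]. Qed.

Lemma maxr_continuous : continuous (fun z => Order.max (u z) (v z)).
Proof. by move=> z; apply: (@continuous_max _ _ u v z); [exact: cu|exact: cv]. Qed.

Lemma mix_continuous (w : Z -> R) : continuous w ->
  continuous (fun z => (1 - w z) * u z + w z * v z).
Proof.
move=> cw z; apply: cvgD; apply: cvgM.
- by apply: cvgB; [exact: cvg_cst|exact: cw].
- exact: cu.
- exact: cw.
- exact: cv.
Qed.

End ContinuousReal.

Section Homotopy.
Variables (R : realType) (T : topologicalType).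
Local Notation I := (unit_itv R).
Local Notation "x ~~> y" := ({path I from x to y in T}) (at level 70).

(* Homotopy relative to the endpoints. *)
Definition path_homotopic (x y : T) (p q : x ~~> y) : Prop :=
  exists H : I * I -> T,
    [/\ continuous H,
        forall t, H (zero, t) = p t,
        forall t, H (one, t) = q t,
        forall s, H (s, zero) = x &
        forall s, H (s, one) = y].

(* [itv_proj] only serves to give 2 t and 2 t - 1 the type of the interval. *)
Definition concat_fun (p q : I -> T) (t : I) : T :=
  if itv_val t <= 2^-1 then p (itv_proj (2 * itv_val t))
  else q (itv_proj (2 * itv_val t - 1)).

Definition reverse_fun (p : I -> T) (t : I) : T := p (itv_proj (1 - itv_val t)).

Lemma proj_continuous (Z : topologicalType) (p : I -> T) (u : Z -> R) :
  continuous p -> continuous u -> continuous (fun z => p (itv_proj (u z))).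
Proof.
move=> cp cu z; apply: (@continuous_comp _ _ _ (fun z => itv_proj (u z)) p).
  by apply: (@continuous_comp _ _ _ u (@itv_proj R)); [exact: cu|exact: itv_proj_continuous].
exact: cp.
Qed.

Lemma continuous_comp_pair (A B C Z : topologicalType) (h : A * B -> C)
    (f : Z -> A) (g : Z -> B) :
  continuous h -> continuous f -> continuous g ->
  continuous (fun z => h (f z, g z)).
Proof.
move=> ch cf cg z; apply: (@continuous_comp _ _ _ (fun z => (f z, g z)) h).
  exact: cvg_pair (cf z) (cg z).
exact: ch.
Qed.

Lemma itv_proj_comp_continuous (Z : topologicalType) (u : Z -> R) :
  continuous u -> continuous (fun z => itv_proj (u z)).
Proof.
move=> cu z; apply: (@continuous_comp _ _ _ u (@itv_proj R)); first exact: cu.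
exact: itv_proj_continuous.
Qed.

Lemma fst_val_continuous : continuous (fun z : I * I => itv_val z.1).
Proof.
by move=> z; apply: continuous_comp; [exact: cvg_fst|exact: itv_val_continuous].
Qed.

Lemma snd_val_continuous : continuous (fun z : I * I => itv_val z.2).
Proof.
by move=> z; apply: continuous_comp; [exact: cvg_snd|exact: itv_val_continuous].
Qed.

Lemma concat_fun_continuous (x y z : T) (p : x ~~> y) (q : y ~~> z) :
  continuous (concat_fun p q).
Proof.
apply: (@continuous_glue R); first exact: itv_val_continuous.
- apply: proj_continuous; first exact: cts_fun.
  exact/scale_continuous/itv_val_continuous.
- apply: proj_continuous; first exact: cts_fun.
  exact/affine_continuous/itv_val_continuous.
- move=> t ->; rewrite divff// subrr itv_proj0 itv_proj1.
  by rewrite path_one path_zero.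
Qed.

Lemma concat_fun0 (x y z : T) (p : x ~~> y) (q : y ~~> z) :
  concat_fun p q zero = x.
Proof.
by rewrite /concat_fun itv_val0 invr_ge0 ler0n mulr0 itv_proj0 path_zero.
Qed.

Lemma concat_fun1 (x y z : T) (p : x ~~> y) (q : y ~~> z) :
  concat_fun p q one = z.
Proof.
rewrite /concat_fun itv_val1 ifF; last by lra.
by rewrite (_ : 2 * 1 - 1 = 1 :> R) ?itv_proj1 ?path_one//; lra.
Qed.

Definition concat (x y z : T) (p : x ~~> y) (q : y ~~> z) : x ~~> z :=
  mk_path (@concat_fun_continuous _ _ _ p q) (concat_fun0 p q) (concat_fun1 p q).

Lemma reverse_fun_continuous (x y : T) (p : x ~~> y) :
  continuous (reverse_fun p).
Proof.
apply: proj_continuous; first exact: cts_fun.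
exact/onem_continuous/itv_val_continuous.
Qed.

Lemma reverse_fun0 (x y : T) (p : x ~~> y) : reverse_fun p zero = y.
Proof. by rewrite /reverse_fun itv_val0 subr0 itv_proj1 path_one. Qed.

Lemma reverse_fun1 (x y : T) (p : x ~~> y) : reverse_fun p one = x.
Proof. by rewrite /reverse_fun itv_val1 subrr itv_proj0 path_zero. Qed.

Definition reverse (x y : T) (p : x ~~> y) : y ~~> x :=
  mk_path (@reverse_fun_continuous _ _ p) (reverse_fun0 p) (reverse_fun1 p).

Lemma path_homotopic_refl (x y : T) (p : x ~~> y) : path_homotopic p p.
Proof.
exists (p \o snd); split=> [z|//|//|s|s] /=; last 2 first.
- exact: path_zero.
- exact: path_one.
by apply: continuous_comp; [exact: cvg_snd|exact: cts_fun].
Qed.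

Lemma path_homotopic_sym (x y : T) (p q : x ~~> y) :
  path_homotopic p q -> path_homotopic q p.
Proof.
case=> H [cH H0 H1 Hx Hy].
exists (fun z => H (itv_proj (1 - itv_val z.1), z.2)); split=> [|t|t|s|s] //=.
- apply: continuous_comp_pair => //; last by move=> z; exact: cvg_snd.
  exact/itv_proj_comp_continuous/onem_continuous/fst_val_continuous.
- by rewrite itv_val0 subr0 itv_proj1.
- by rewrite itv_val1 subrr itv_proj0.
Qed.

Lemma path_homotopic_trans (x y : T) (q p r : x ~~> y) :
  path_homotopic p q -> path_homotopic q r -> path_homotopic p r.
Proof.
case=> H [cH H0 H1 Hx Hy] [K [cK K0 K1 Kx Ky]].
exists (fun z => if itv_val z.1 <= 2^-1
  then H (itv_proj (2 * itv_val z.1), z.2)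
  else K (itv_proj (2 * itv_val z.1 - 1), z.2)); split=> [|t|t|s|s] /=.
- apply: continuous_glue.
  + exact: fst_val_continuous.
  + apply: continuous_comp_pair => //; last by move=> z; exact: cvg_snd.
    exact/itv_proj_comp_continuous/scale_continuous/fst_val_continuous.
  + apply: continuous_comp_pair => //; last by move=> z; exact: cvg_snd.
    exact/itv_proj_comp_continuous/affine_continuous/fst_val_continuous.
  + by move=> z ->; rewrite divff// subrr itv_proj0 itv_proj1 H1 K0.
- by rewrite itv_val0 invr_ge0 ler0n mulr0 itv_proj0 H0.
- rewrite itv_val1 ifF; last by lra.
  by rewrite (_ : 2 * 1 - 1 = 1 :> R) ?itv_proj1 ?K1//; lra.
- by rewrite Hx Kx if_same.
- by rewrite Hy Ky if_same.
Qed.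

Lemma path_homotopic_concat (x y z : T) (p p' : x ~~> y) (q q' : y ~~> z) :
  path_homotopic p p' -> path_homotopic q q' ->
  path_homotopic (concat p q) (concat p' q').
Proof.
case=> H [cH H0 H1 Hx Hy] [K [cK K0 K1 Kx Ky]].
exists (fun z => if itv_val z.2 <= 2^-1
  then H (z.1, itv_proj (2 * itv_val z.2))
  else K (z.1, itv_proj (2 * itv_val z.2 - 1))); split=> [|t|t|s|s] /=.
- apply: continuous_glue.
  + exact: snd_val_continuous.
  + apply: continuous_comp_pair => //; first by move=> w; exact: cvg_fst.
    exact/itv_proj_comp_continuous/scale_continuous/snd_val_continuous.
  + apply: continuous_comp_pair => //; first by move=> w; exact: cvg_fst.
    exact/itv_proj_comp_continuous/affine_continuous/snd_val_continuous.
  + by move=> w ->; rewrite divff// subrr itv_proj0 itv_proj1 Hy Kx.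
- by rewrite H0 K0.
- by rewrite H1 K1.
- by rewrite itv_val0 invr_ge0 ler0n mulr0 itv_proj0 Hx.
- rewrite itv_val1 ifF; last by lra.
  by rewrite (_ : 2 * 1 - 1 = 1 :> R) ?itv_proj1 ?Ky//; lra.
Qed.

Lemma path_homotopic_reparam (x y : T) (p q : x ~~> y) (f : I -> T) (u v : R -> R) :
  continuous f -> continuous u -> continuous v -> u 0 = v 0 -> u 1 = v 1 ->
  (forall t, p t = f (itv_proj (u (itv_val t)))) ->
  (forall t, q t = f (itv_proj (v (itv_val t)))) ->
  path_homotopic p q.
Proof.
move=> cf cu cv uv0 uv1 pu qv.
exists (fun z => f (itv_proj
  ((1 - itv_val z.1) * u (itv_val z.2) + itv_val z.1 * v (itv_val z.2)))).
split=> [|t|t|s|s] /=.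
- apply: proj_continuous => //; apply: mix_continuous => [z|z|].
  + by apply: (@continuous_comp _ _ _ (fun z : I * I => itv_val z.2) u); [exact: snd_val_continuous|exact: cu].
  + by apply: (@continuous_comp _ _ _ (fun z : I * I => itv_val z.2) v); [exact: snd_val_continuous|exact: cv].
  + exact: fst_val_continuous.
- by rewrite itv_val0 subr0 mul1r mul0r addr0 pu.
- by rewrite itv_val1 subrr mul1r mul0r add0r qv.
- rewrite itv_val0 uv0 -mulrDl subrK mul1r.
  by rewrite -{1}itv_val0 -qv path_zero.
- rewrite itv_val1 uv1 -mulrDl subrK mul1r.
  by rewrite -{1}itv_val1 -qv path_one.
Qed.

End Homotopy.

Section GroupLaws.
Variables (R : realType) (T : topologicalType).
Local Notation I := (unit_itv R).
Local Notation "x ~~> y" := ({path I from x to y in T}) (at level 70).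

Lemma concatE (x y z : T) (p : x ~~> y) (q : y ~~> z) (t : I) :
  concat p q t = if itv_val t <= 2^-1 then p (itv_proj (2 * itv_val t))
                 else q (itv_proj (2 * itv_val t - 1)).
Proof. by []. Qed.

Lemma path_le0 (x y : T) (p : x ~~> y) (t : R) : t <= 0 -> p (itv_proj t) = x.
Proof. by move=> /itv_proj_le0 ->; exact: path_zero. Qed.

Lemma path_ge1 (x y : T) (p : x ~~> y) (t : R) : 1 <= t -> p (itv_proj t) = y.
Proof. by move=> /itv_proj_ge1 ->; exact: path_one. Qed.

Lemma concat_projE (x y z : T) (p : x ~~> y) (q : y ~~> z) (t : R) :
  concat p q (itv_proj t) =
  if t <= 2^-1 then p (itv_proj (2 * t)) else q (itv_proj (2 * t - 1)).
Proof.
rewrite concatE; have [t0|t0] := leP t 0.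
  rewrite (itv_proj_le0 t0) itv_val0 ifT ?invr_ge0// ifT; last by lra.
  by rewrite !path_le0//; lra.
have [t1|t1] := leP 1 t.
  rewrite (itv_proj_ge1 t1) itv_val1 ifF; last by lra.
  rewrite ifF; last by lra.
  by rewrite !path_ge1//; lra.
by rewrite itv_projK// !ltW.
Qed.

Lemma min_lin_continuous (a b c d : R) :
  continuous (fun t : R => Order.min (a * t + b) (c * t + d)).
Proof.
by apply: minr_continuous; apply: affine_continuous => w; exact: cvg_id.
Qed.

Lemma concatA (x y z w : T) (p : x ~~> y) (q : y ~~> z) (r : z ~~> w) :
  path_homotopic (concat (concat p q) r) (concat p (concat q r)).
Proof.
pose u (t : R) := Order.min (2 * t) (Order.min (1 * t + 4^-1) (2^-1 * t + 2^-1)).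
apply: (@path_homotopic_reparam _ _ _ _ _ _ (concat p (concat q r)) u id).
- exact: cts_fun.
- apply: minr_continuous; last exact: min_lin_continuous.
  by apply: scale_continuous => v; exact: cvg_id.
- by move=> t; exact: cvg_id.
- rewrite /u /= !mulr0 !add0r min_l// le_min; lra.
- rewrite /u /= !mulr1 [X in Order.min _ X]min_r; last by lra.
  by rewrite min_r; lra.
- move=> t; rewrite concatE [RHS]concat_projE.
  set s := itv_val t; rewrite /u; have [s1|s1] := leP s 2^-1; last first.
    rewrite [X in Order.min _ X]min_r; last by lra.
    rewrite min_r; last by lra.
    rewrite ifF; last by lra.
    rewrite concat_projE ifF; last by lra.
    by congr (r (itv_proj _)); lra.
  rewrite concat_projE [X in Order.min _ X]min_l; last by lra.
  have [s2|s2] := leP (2 * s) 2^-1.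
    by rewrite min_l; [rewrite ifT//; lra|lra].
  rewrite min_r; last by lra.
  rewrite ifF; last by lra.
  rewrite concat_projE ifT; last by lra.
  by congr (q (itv_proj _)); lra.
- by move=> t; rewrite itv_valK.
Qed.

Definition const_path (x : T) : x ~~> x := cst x.

Lemma concat_constl (x y : T) (p : x ~~> y) :
  path_homotopic (concat (const_path x) p) p.
Proof.
apply: (@path_homotopic_reparam _ _ _ _ _ _ p
  (fun t => Order.max 0 (2 * t - 1)) id).
- exact: cts_fun.
- apply: maxr_continuous; first exact: cst_continuous.
  by apply: affine_continuous => v; exact: cvg_id.
- by move=> t; exact: cvg_id.
- by rewrite max_l//; lra.
- by rewrite max_r; lra.
- move=> t; rewrite concatE; case: ifP => t1.
    by rewrite max_l; [rewrite itv_proj0 path_zero|lra].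
  by rewrite max_r//; lra.
- by move=> t; rewrite itv_valK.
Qed.

Lemma concat_constr (x y : T) (p : x ~~> y) :
  path_homotopic (concat p (const_path y)) p.
Proof.
apply: (@path_homotopic_reparam _ _ _ _ _ _ p
  (fun t => Order.min (2 * t) 1) id).
- exact: cts_fun.
- apply: minr_continuous; last exact: cst_continuous.
  by apply: scale_continuous => v; exact: cvg_id.
- by move=> t; exact: cvg_id.
- by rewrite min_l//; lra.
- by rewrite min_r; lra.
- move=> t; rewrite concatE; case: ifP => t1.
    by rewrite min_l//; lra.
  by rewrite min_r; [rewrite itv_proj1 path_one|lra].
- by move=> t; rewrite itv_valK.
Qed.

Lemma reverse_projE (x y : T) (p : x ~~> y) (t : R) :
  reverse p (itv_proj t) = p (itv_proj (1 - t)).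
Proof.
rewrite [LHS]/(reverse_fun p (itv_proj t)) /reverse_fun.
have [t0|t0] := leP t 0.
  by rewrite (itv_proj_le0 t0) itv_val0 !path_ge1//; lra.
have [t1|t1] := leP 1 t; last by rewrite itv_projK// !ltW.
by rewrite (itv_proj_ge1 t1) itv_val1 !path_le0//; lra.
Qed.

Lemma concat_reverser (x y : T) (p : x ~~> y) :
  path_homotopic (concat p (reverse p)) (const_path x).
Proof.
apply: (@path_homotopic_reparam _ _ _ _ _ _ p
  (fun t => Order.min (2 * t + 0) ((- 2) * t + 2)) (fun=> 0)).
- exact: cts_fun.
- exact: min_lin_continuous.
- by move=> t; exact: cvg_cst.
- by rewrite min_l; lra.
- by rewrite min_r; lra.
- move=> t; rewrite concatE; case: ifP => t1.
    by rewrite min_l; [rewrite addr0|lra].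
  by rewrite reverse_projE min_r; [congr (p (itv_proj _)); lra|lra].
- by move=> t; rewrite itv_proj0 path_zero.
Qed.

Lemma concat_reversel (x y : T) (p : x ~~> y) :
  path_homotopic (concat (reverse p) p) (const_path y).
Proof.
apply: (@path_homotopic_reparam _ _ _ _ _ _ p
  (fun t => Order.max ((- 2) * t + 1) (2 * t - 1)) (fun=> 1)).
- exact: cts_fun.
- apply: maxr_continuous;
    by apply: affine_continuous => v; exact: cvg_id.
- by move=> t; exact: cvg_cst.
- by rewrite max_l; lra.
- by rewrite max_r; lra.
- move=> t; rewrite concatE; case: ifP => t1.
    by rewrite reverse_projE max_l; [congr (p (itv_proj _)); lra|lra].
  by rewrite max_r//; lra.
- by move=> t; rewrite itv_proj1 path_one.
Qed.

Lemma path_homotopic_reverse (x y : T) (p q : x ~~> y) :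
  path_homotopic p q -> path_homotopic (reverse p) (reverse q).
Proof.
case=> H [cH H0 H1 Hx Hy].
exists (fun z => H (z.1, itv_proj (1 - itv_val z.2))); split=> [|t|t|s|s] /=.
- apply: continuous_comp_pair => //; first by move=> z; exact: cvg_fst.
  exact/itv_proj_comp_continuous/onem_continuous/snd_val_continuous.
- by rewrite H0.
- by rewrite H1.
- by rewrite itv_val0 subr0 itv_proj1 Hy.
- by rewrite itv_val1 subrr itv_proj0 Hx.
Qed.

End GroupLaws.

Section FundamentalGroup.
Variables (R : realType) (T : topologicalType) (x0 : T).
Local Notation I := (unit_itv R).
Local Notation loop := ({path I from x0 to x0 in T}).

Definition loop_homotopicb (p q : loop) : bool := `[< path_homotopic p q >].

Lemma loop_homotopicb_refl : reflexive loop_homotopicb.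
Proof. by move=> p; apply/asboolP; exact: path_homotopic_refl. Qed.

Lemma loop_homotopicb_sym : symmetric loop_homotopicb.
Proof. by move=> p q; apply/asboolP/asboolP; exact: path_homotopic_sym. Qed.

Lemma loop_homotopicb_trans : transitive loop_homotopicb.
Proof.
move=> q p r /asboolP pq /asboolP qr; apply/asboolP.
exact: path_homotopic_trans qr.
Qed.

Canonical loop_homotopic_equiv := EquivRel loop_homotopicb
  loop_homotopicb_refl loop_homotopicb_sym loop_homotopicb_trans.

Definition pi1 : Type := {eq_quot loop_homotopic_equiv}%qT.

HB.instance Definition _ := Choice.on pi1.
HB.instance Definition _ := EqQuotient.on pi1.

Definition loop_class (p : loop) : pi1 := (\pi_pi1 p)%qT.

Lemma loop_classP (p q : loop) :
  loop_class p = loop_class q <-> path_homotopic p q.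
Proof. by split=> [/eqquotP/asboolP //|pq]; apply/eqquotP/asboolP. Qed.

Lemma loop_class_ind (P : pi1 -> Prop) :
  (forall p, P (loop_class p)) -> forall a, P a.
Proof. by move=> Pp a; rewrite -[a]reprK; exact: Pp. Qed.

Definition pi1_one : pi1 := loop_class (const_path R x0).
Definition pi1_mul (a b : pi1) : pi1 := loop_class (concat (repr a) (repr b)).
Definition pi1_inv (a : pi1) : pi1 := loop_class (reverse (repr a)).

Lemma repr_loop_class (p : loop) : path_homotopic (repr (loop_class p)) p.
Proof. by apply/loop_classP; exact: reprK. Qed.

Lemma pi1_mulE (p q : loop) :
  pi1_mul (loop_class p) (loop_class q) = loop_class (concat p q).
Proof. by apply/loop_classP/path_homotopic_concat; exact: repr_loop_class. Qed.

Lemma pi1_invE (p : loop) : pi1_inv (loop_class p) = loop_class (reverse p).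
Proof. by apply/loop_classP/path_homotopic_reverse; exact: repr_loop_class. Qed.

Lemma pi1_mulA : associative pi1_mul.
Proof.
elim/loop_class_ind => p; elim/loop_class_ind => q; elim/loop_class_ind => r.
rewrite !pi1_mulE; apply/loop_classP/path_homotopic_sym; exact: concatA.
Qed.

Lemma pi1_mul1 : left_id pi1_one pi1_mul.
Proof.
by elim/loop_class_ind => p; rewrite pi1_mulE; apply/loop_classP/concat_constl.
Qed.

Lemma pi1_mulr1 : right_id pi1_one pi1_mul.
Proof.
by elim/loop_class_ind => p; rewrite pi1_mulE; apply/loop_classP/concat_constr.
Qed.

Lemma pi1_mulV : left_inverse pi1_one pi1_inv pi1_mul.
Proof.
elim/loop_class_ind => p; rewrite pi1_invE pi1_mulE.
exact/loop_classP/concat_reversel.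
Qed.

Lemma pi1_mulrV : right_inverse pi1_one pi1_inv pi1_mul.
Proof.
elim/loop_class_ind => p; rewrite pi1_invE pi1_mulE.
exact/loop_classP/concat_reverser.
Qed.

HB.instance Definition _ := isGroup.Build pi1
  pi1_mulA pi1_mul1 pi1_mulr1 pi1_mulV pi1_mulrV.

End FundamentalGroup.

Arguments pi1 R {T} x0.

Definition path_connected (R : realType) (T : topologicalType) : Prop :=
  forall x y : T, inhabited {path (unit_itv R) from x to y in T}.

Record simplicial_complex (V : finType) : Type := SimplicialComplex {
  face : {set V} -> bool;
  face_neq0 : forall s, face s -> s != finset.set0;
  face_sub : forall s s' : {set V},
    face s -> s' \subset s -> s' != finset.set0 -> face s';
  face_vertex : forall v : V, face (finset.set1 v)
}.

Section Realization.
Variables (R : realType) (V : finType) (K : simplicial_complex V).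

Definition barycentric_coordinates : set {ptws V -> R} :=
  [set t | [/\ forall v, 0 <= t v, \sum_v t v = 1 &
               face K (finset (fun v => t v != 0))]].

(* As the vertex set is finite, the topology of the geometric realization is
   induced by the product topology on R^V. *)
Definition realization : Type := barycentric_coordinates.

HB.instance Definition _ := Choice.on realization.
HB.instance Definition _ := Topological.on realization.

End Realization.

Arguments realization R {V} K.

Section Rips.
Variables (R : realType) (n : nat).

(* The library's norm on row vectors is the sup norm. *)
Definition euclidean_dist (x y : 'rV[R]_n) : R :=
  Num.sqrt (\sum_(i < n) (x ord0 i - y ord0 i) ^+ 2).

(* Meaningful only for nonempty bounded sets. *)
Definition diameter (Y : set 'rV[R]_n) : R :=
  sup [set euclidean_dist y.1 y.2 | y in Y `*` Y].

Variable X : {fset 'rV[R]_n}.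

Definition points (s : {set X}) : set 'rV[R]_n := [set \val x | x in [set` s]].

Definition rips_face (s : {set X}) : bool :=
  (s != finset.set0) && (diameter (points s) < 1).

Lemma has_ubound_dist (s : {set X}) :
  has_ubound [set euclidean_dist y.1 y.2 | y in points s `*` points s].
Proof.
exists (\sum_(x : X) \sum_(y : X) euclidean_dist (\val x) (\val y)).
move=> _ [[_ _] [[x _ <-] [y _ <-]] <-] /=.
rewrite (bigD1 x)//= (bigD1 y)//= -addrA lerDl addr_ge0//.
  by apply: sumr_ge0 => z _; exact: sqrtr_ge0.
by apply: sumr_ge0 => z _; apply: sumr_ge0 => w _; exact: sqrtr_ge0.
Qed.

Lemma rips_face_neq0 (s : {set X}) : rips_face s -> s != finset.set0.
Proof. by case/andP. Qed.

Lemma rips_face_sub (s s' : {set X}) :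
  rips_face s -> s' \subset s -> s' != finset.set0 -> rips_face s'.
Proof.
move=> /andP[_ s1] ss' s'0; rewrite /rips_face s'0 /=.
apply: le_lt_trans s1; apply: ge_sup.
  have /set0Pn[x xs'] := s'0.
  by exists (euclidean_dist (\val x) (\val x)), (\val x, \val x) => //; split; exists x.
move=> _ [[_ _] [[x xs' <-] [y ys' <-]] <-] /=.
apply: ub_le_sup; first exact: has_ubound_dist.
exists (\val x, \val y) => //.
by split; [exists x|exists y] => //; [exact: (fintype.subsetP ss' x xs')|exact: (fintype.subsetP ss' y ys')].
Qed.

Lemma rips_face_vertex (x : X) : rips_face (finset.set1 x).
Proof.
rewrite /rips_face; apply/andP; split.
  by apply/set0Pn; exists x; rewrite inE.
rewrite (_ : diameter _ = 0) ?ltr01// /diameter.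
rewrite (_ : [set _ | _ in _] = [set 0]) ?sup1//.
have dist0 (z : 'rV[R]_n) : euclidean_dist z z = 0.
  by rewrite /euclidean_dist big1 ?sqrtr0// => i _; rewrite subrr expr0n.
apply/seteqP; split=> [_ [[_ _] [[y + <-] [z + <-]] <-]|_ ->] /=.
  by move=> /finset.set1P -> /finset.set1P ->.
exists (\val x, \val x); last by rewrite dist0.
by split; exists x => //=; exact: finset.set11.
Qed.

Definition rips_complex : simplicial_complex X :=
  SimplicialComplex rips_face_neq0 rips_face_sub rips_face_vertex.

End Rips.

(* Main.v *)
From HB Require Import structures.
From mathcomp Require Import all_boot all_order all_algebra finmap.
From mathcomp Require Import generic_quotient ring lra zify.
From mathcomp Require Import all_classical all_reals all_analysis homotopy.
Require Import Defs.
Set Implicit Arguments.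
Unset Strict Implicit.
Unset Printing Implicit Defensive.
Import Order.TTheory GRing.Theory Num.Theory.
Import numFieldNormedType.Exports.

(** On points of (1/2)Z^4 the Rips complex is the clique complex of the graph
  joining points whose coordinates differ by at most one unit and which agree in
  at least one coordinate. In the slice w = 0 take the product of an interval
  (the z-direction) with a plane graph made of a row and one handle for each
  generator: its fundamental group is free. Each relator is represented by a
  closed curve in this slice, which climbs in z and crosses the handle of its
  j-th letter on the way; different relators use disjoint slabs of z. A copy of
  the curve in the slice w = 1 and a solid box in the slice w = 2 kill the curve.

  Label the edges by elements of the presented group G, multiplicatively on
  triangles. The label is universal: every such cocycle, with values in any group
  P, is gauge equivalent to the image of the label under a homomorphism from G
  to P. The holonomy of the label is a homomorphism from the fundamental group to
  G, surjective because each element of G is the holonomy of an edge loop; universality,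
  applied to the tautological cocycle with values in the fundamental group,
  recovers a loop from its holonomy, whence injectivity. *)

(** * The cocycle of a complex of lattice points *)

(** Two scaled points are at distance below 1 exactly when the squared differences of their integer
    coordinates sum to at most 3. Inside a slice all of x, y, z may change at once, so rows and
    boxes are filled; between neighbouring slices one of them must be kept, and the slices w = 0 and
    w = 2 are never adjacent. The copy of the curve in w = 1 thus keeps the box away from the rest
    of the slice w = 0. A relator may cross one handle many times, yet its curve must not touch
    itself; this is the purpose of z. A letter takes four heights. The three rows at [4 j],
    [4 j + 1], [4 j + 2] keep the foot where letter j - 1 ends, at [4 j], two units away from the
    foot where letter j starts, at [4 j + 2], even if it is the same foot. The missing row at
    [4 j + 3] forces the curve over the handle. Cocycles replace van Kampen's theorem:
    contractibility of a piece enters only as the statement that its cocycles are coboundaries,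
    proved by dismantling its graph, and gluing pieces amounts to comparing gauges. Simplicial
    approximation is likewise replaced by sampling paths in open stars of vertices. *)

Section Dismantling.
Variables (T : Type) (S : T -> Prop) (adj : T -> T -> Prop).
Variables (P : groupType) (e : T -> T -> P).
Local Open Scope group_scope.

Definition cocycle_on : Prop := forall u v w, S u -> S v -> S w ->
  adj u v -> adj v w -> adj u w -> e u v * e v w = e u w.

Hypothesis adj_refl : forall u, adj u u.
Hypothesis adj_sym : forall u v, adj u v -> adj v u.
Hypothesis ce : cocycle_on.

Lemma cocycle_on_refl u : S u -> e u u = 1.
Proof. by move=> Su; apply: (mulgI (e u u)); rewrite mulg1 ce. Qed.

Lemma cocycle_on_sym u v : S u -> S v -> adj u v -> e v u = (e u v)^-1.
Proof.
move=> Su Sv uv; apply: (mulgI (e u v)); rewrite mulgV ce//; last exact: adj_sym.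
exact: cocycle_on_refl.
Qed.

(* Every vertex is dominated by its parent, so that the graph can be dismantled in
   the order of decreasing rank; the roots are the vertices of rank 0. *)
Variables (rank : T -> nat) (par : T -> T).
Hypothesis parP : forall v, S v -> (0 < rank v)%N ->
  [/\ S (par v), adj (par v) v & rank (par v) = (rank v).-1].
Hypothesis adjP : forall u v, S u -> S v -> adj u v ->
  [\/ u = v, (0 < rank v)%N /\ adj u (par v) | (0 < rank u)%N /\ adj (par u) v].

Fixpoint iter_potential (m : nat) (v : T) : P :=
  if m is m'.+1 then iter_potential m' (par v) * e (par v) v else 1.

Definition potential (v : T) : P := iter_potential (rank v) v.

Lemma potential_par v : S v -> (0 < rank v)%N ->
  potential v = potential (par v) * e (par v) v.
Proof. by move=> Sv v0; have [_ _ pv] := parP Sv v0; rewrite /potential pv; case: rank v0. Qed.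

(** Induction on the sum of the ranks: one end of the edge is replaced by its parent, and the
    triangle with the parent accounts for the difference. There may be several roots; [adjP] makes
    adjacent roots equal, so the value 1 at every root is consistent. *)
Lemma dismantle u v : S u -> S v -> adj u v -> e u v = (potential u)^-1 * potential v.
Proof.
move En : (rank u + rank v)%N => N; elim/ltn_ind: N u v En => N IH u v EN Su Sv uv.
have [->|[v0 upv]|[u0 puv]] := adjP Su Sv uv.
- by rewrite cocycle_on_refl// mulVg.
- have [Sp pv rp] := parP Sv v0.
  have ltN : (rank u + rank (par v) < N)%N by rewrite -EN rp ltn_add2l ltn_predL.
  rewrite -(ce Su Sp Sv upv pv uv) (IH _ ltN u (par v) erefl Su Sp upv).
  by rewrite -mulgA -potential_par.
- have [Sp pu rp] := parP Su u0; have up := adj_sym pu.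
  have ltN : (rank (par u) + rank v < N)%N by rewrite -EN rp ltn_add2r ltn_predL.
  rewrite -(ce Su Sp Sv up puv uv) (IH _ ltN (par u) v erefl Sp Sv puv).
  rewrite (cocycle_on_sym Sp Su pu) (potential_par Su u0) invgM.
  by rewrite -mulgA.
Qed.

End Dismantling.

(** * Nearness of lattice points, slabs, and the labelled cells of the slice w = 0 *)

Definition nearn (a b : nat) : bool := (a <= b.+1)%N && (b <= a.+1)%N.

Notation point3 := (nat * nat * nat)%type.

Definition near3 (p q : point3) : bool :=
  [&& nearn p.1.1 q.1.1, nearn p.1.2 q.1.2 & nearn p.2 q.2].

Definition coord3 (p q : point3) : bool :=
  [|| p.1.1 == q.1.1, p.1.2 == q.1.2 | p.2 == q.2].

Lemma nearn_refl a : nearn a a. Proof. by rewrite /nearn !leqnSn. Qed.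
Lemma nearn_sym a b : nearn a b = nearn b a. Proof. by rewrite /nearn andbC. Qed.
Lemma near3_refl p : near3 p p. Proof. by rewrite /near3 !nearn_refl. Qed.
Lemma near3_sym p q : near3 p q = near3 q p.
Proof. by rewrite /near3 !(nearn_sym p.1.1) !(nearn_sym p.1.2) (nearn_sym p.2). Qed.
Lemma coord3_refl p : coord3 p p. Proof. by rewrite /coord3 eqxx. Qed.
Lemma coord3_sym p q : coord3 p q = coord3 q p.
Proof. by rewrite /coord3 !(eq_sym p.1.1) !(eq_sym p.1.2) (eq_sym p.2). Qed.

Section Slabs.
Variable (W : nat).

(** A unit step into the next slab would start at the last height of a slab, which the hypotheses
    exclude. *)
Lemma slab_near z z' : (0 < W)%N -> (z %% W < W.-1)%N -> (z' %% W < W.-1)%N -> nearn z z' ->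
  z %/ W = z' %/ W /\ nearn (z %% W) (z' %% W).
Proof.
move=> W0; wlog zz' : z z' / (z <= z')%N => [hw zW zW' nz|zW zW' nz].
  have [zz'|/ltnW zz'] := leqP z z'; first exact: hw.
  rewrite nearn_sym in nz; have [-> nl] := hw _ _ zz' zW' zW nz.
  by rewrite nearn_sym.
have [->|z'E] : z' = z \/ z' = z.+1 by move: nz; rewrite /nearn; lia.
  by rewrite nearn_refl.
have zE : z' = (z %/ W * W + (z %% W).+1)%N by rewrite z'E addnS -divn_eq.
have zS : ((z %% W).+1 < W)%N by lia.
rewrite [X in _ = (X %/ _)%N /\ _]zE divnMDl// (divn_small zS) addn0; split=> //.
by rewrite zE modnMDl (modn_small zS) /nearn; lia.
Qed.

End Slabs.

(* The cells of the slice w = 0: the row, and for each generator an arch formed by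
   a left foot ([true]), a top and a right foot ([false]). *)
Inductive cell (n : nat) : Type :=
| Base of nat & nat
| Foot of bool & 'I_n & nat
| Top of 'I_n & nat.
Arguments Base {n}.

(** The feet of a handle are two columns apart, as are neighbouring feet of consecutive handles, and
    a top is two units above the row: none of these pairs is near, so the loop over a handle is not
    filled. The columns 0 and 1 lie left of all handles and serve to close the curves. *)
Definition cell_pos n (c : cell n) : point3 :=
  match c with
  | Base x z => (x, 0, z)
  | Foot s a z => (4 * a + (if s then 4 else 6), 1, z)
  | Top a z => (4 * a + 5, 2, z)
  end%N.

Section CellLabels.
Variables (n : nat) (P : groupType) (gen : 'I_n -> P).
Local Open Scope group_scope.

(** The slice is cut between the tops and the right feet; only edges across the cut carry a
    generator. *)
Definition label (c d : cell n) : P :=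
  match c, d with
  | Top a _, Foot false _ _ => gen a
  | Foot false _ _, Top a _ => (gen a)^-1
  | _, _ => 1
  end.

Lemma label_sym c d : label d c = (label c d)^-1.
Proof. by case: c d => [?? | [] ?? | ? ?] [?? | [] ?? | ? ?] /=; rewrite ?invg1 ?invgK. Qed.

Lemma near_cell_gen (c d : cell n) : near3 (cell_pos c) (cell_pos d) ->
  match c, d with
  | Foot s a _, Foot s' b _ => s = s' /\ a = b
  | Foot _ a _, Top b _ | Top a _, Foot _ b _ | Top a _, Top b _ => a = b
  | Base _ _, Top _ _ | Top _ _, Base _ _ => False
  | _, _ => True
  end.
Proof.
case: c d => [x z|s a z|a z] [x' z'|s' b z'|b z'] //=; rewrite /near3 /nearn /=.
- by lia.
- by case: s; case: s' => cd; first [exfalso; lia | split=> //; apply: val_inj => /=; lia].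
- by case: s => cd; apply: val_inj => /=; lia.
- by lia.
- by case: s' => cd; apply: val_inj => /=; lia.
- by move=> cd; apply: val_inj => /=; lia.
Qed.

(** The third vertex of a triangle over a cut edge is again a top or a right foot of the same
    handle: left feet are not near right feet, and the row is not near tops. *)
Lemma label_cocycle c d e : near3 (cell_pos c) (cell_pos d) ->
  near3 (cell_pos d) (cell_pos e) -> near3 (cell_pos c) (cell_pos e) ->
  label c d * label d e = label c e.
Proof.
move=> /near_cell_gen + /near_cell_gen + /near_cell_gen.
case: c d e => [??|[]??|??] [??|[]??|??] [??|[]??|??] //= cd de ce;
  rewrite ?(mulg1, mul1g, mulgV, mulVg)//; try (by case: cd); try (by case: de); try (by case: ce).
all: try by rewrite cd.
all: try by rewrite ?cd ?de ?ce ?mulVg ?mulgV.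
Qed.

End CellLabels.

(** * Relator curves and their potentials *)

Section RelatorCurves.
Variables (n M : nat) (rel : nat -> word n).

(* The curve of a relator occupies the heights 0, ..., 4 M + 2 of its slab, where M
   bounds the length of the relators; the last height stays empty and keeps
   consecutive slabs apart. *)
Definition slab_width : nat := 4 * M + 4.
Local Notation W := slab_width.

Definition letter (i j : nat) : option ('I_n * bool) := onth (rel i) j.

(* At local height t the curve runs in the row for t = 4 j, 4 j + 1, 4 j + 2; the
   j-th letter is crossed at the heights 4 j + 2, 4 j + 3, 4 j + 4, or, beyond the
   end of the relator, replaced by the row at height 4 j + 3. The column x = 0
   closes the curve and is joined to the rows only at the bottom and at the top. *)
Definition on_curve (c : cell n) : Prop :=
  match c with
  | Base x z => z %% W <= 4 * M + 2 /\
      [\/ x = 0, x = 1 /\ (z %% W = 0 \/ z %% W = 4 * M + 2) |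
          2 <= x /\ (z %% W %% 4 <> 3 \/ letter (z %/ W) (z %% W %/ 4) = None)]
  | Foot s a z => exists j,
      letter (z %/ W) j = Some (a, s) /\ z %% W = 4 * j + 2 \/
      letter (z %/ W) j = Some (a, ~~ s) /\ z %% W = 4 * j + 4
  | Top a z => exists j s,
      letter (z %/ W) j = Some (a, s) /\ 4 * j + 2 <= z %% W <= 4 * j + 4
  end.

Hypothesis sizeM : forall i, size (rel i) <= M.

Lemma letter_lt i j l : letter i j = Some l -> j < M.
Proof.
move=> lj; apply: leq_trans (sizeM i); rewrite -onthTE.
by rewrite /letter in lj; rewrite lj.
Qed.

Lemma on_curve_loc c : on_curve c -> (cell_pos c).2 %% W <= 4 * M + 2.
Proof.
case: c => [x z|s a z|a z] /=; first by case.
  by case=> j [] [/letter_lt]; move: (z %% W) => t; clear; lia.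
by case=> j [s] [/letter_lt]; move: (z %% W) => t; clear; lia.
Qed.

Lemma on_curve_near c d : on_curve c -> on_curve d -> near3 (cell_pos c) (cell_pos d) ->
  (cell_pos c).2 %/ W = (cell_pos d).2 %/ W /\
  nearn ((cell_pos c).2 %% W) ((cell_pos d).2 %% W).
Proof.
move=> /on_curve_loc cK /on_curve_loc dK /and3P[_ _ cd].
by apply: slab_near => //; move: cK dK; rewrite /slab_width; clear; lia.
Qed.

Section Potential.
Variables (P : groupType) (gen : 'I_n -> P) (pre : nat -> nat -> P).
Local Open Scope group_scope.

Definition letter_value (l : 'I_n * bool) : P := if l.2 then gen l.1 else (gen l.1)^-1.

(** Here [pre i j] is the value of the first j letters of relator i, so the potential is the part of
    the relator read so far. The generator is read between the top and the right foot: after the top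
    for a letter with exponent 1, before it for an inverse letter. *)
Definition curve_potential (c : cell n) : P :=
  match c with
  | Base x z => if (x < 2)%N then 1 else pre (z %/ W)%N (z %% W %/ 4)%N
  | Foot _ _ z => pre (z %/ W)%N (z %% W %/ 4)%N
  | Top a z => let i := (z %/ W)%N in let j := ((z %% W - 2) %/ 4)%N in
      if letter i j is Some (_, false) then pre i j.+1 else pre i j
  end.

Hypothesis pre0 : forall i, pre i 0 = 1.
Hypothesis pre_letter : forall i j l, letter i j = Some l ->
  pre i j.+1 = pre i j * letter_value l.
Hypothesis pre_blank : forall i j, letter i j = None -> pre i j.+1 = pre i j.

(* The potential is continuous across the closing column only if the relator is trivial. *)
Definition closing (c : cell n) : bool := if c is Base x _ then (x < 2)%N else false.

Lemma letter_inj i j a s b r : letter i j = Some (a, s) ->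
  letter i j = Some (b, r) -> a = b /\ s = r.
Proof. by move=> -> [-> ->]. Qed.

(** The prefix index changes only just above a height [4 j + 3], where the row exists only if there
    is no letter j and the prefix does not grow. The closing columns meet the rows only at the ends
    of the slab, with the empty prefix and the full one. *)
Lemma base_potential x z x' z' : on_curve (Base x z) -> on_curve (Base x' z') ->
  nearn x x' -> (z %/ W = z' %/ W)%N -> nearn (z %% W) (z' %% W) -> x <= x' ->
  ((x < 2)%N -> pre (z' %/ W)%N M = 1) ->
  curve_potential (Base x z) = curve_potential (Base x' z').
Proof.
rewrite /= => + + xx' zz; rewrite zz; move: (z' %/ W)%N (z %% W)%N (z' %% W)%N => i t t'.
move=> [tM xt] [t'M xt'] tt' le_x preM; case: ltnP => [x2|x2]; case: ltnP => [x2'|x2'] //.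
- have t04 : t = 0 \/ t = (4 * M + 2)%N by case: xt; move: xx' x2 x2'; rewrite /nearn; clear; lia.
  case: t04 => tE.
    by rewrite (_ : t' %/ 4 = 0)%N ?pre0//; move: tt' tE; rewrite /nearn; clear; lia.
  by rewrite (_ : t' %/ 4 = M)%N ?preM// ?x2//; move: tt' tE t'M; rewrite /nearn; clear; lia.
- by move: le_x x2 x2'; clear; lia.
have blank_row s : s %% 4 <> 3 \/ letter i (s %/ 4) = None -> s %% 4 = 3 ->
    pre i (s.+1 %/ 4) = pre i (s %/ 4).
  move=> [//|lN] s3; rewrite (_ : (s.+1 %/ 4)%N = (s %/ 4).+1); first exact: pre_blank.
  by move: s3; clear; lia.
have {}xt : t %% 4 <> 3 \/ letter i (t %/ 4) = None.
  by case: xt => [|[]|[]//]; move: x2; clear; lia.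
have {}xt' : t' %% 4 <> 3 \/ letter i (t' %/ 4) = None.
  by case: xt' => [|[]|[]//]; move: x2'; clear; lia.
have [->//|[tE|tE]] : t = t' \/ t' = t.+1 \/ t = t'.+1 by move: tt'; rewrite /nearn; clear; lia.
  have [t3|t3] := eqVneq (t %% 4)%N 3; first by rewrite tE blank_row.
  by congr pre; move: tE t3; clear; lia.
have [t3|t3] := eqVneq (t' %% 4)%N 3; first by rewrite tE blank_row.
by congr pre; move: tE t3; clear; lia.
Qed.

(** Triviality of the relator is asked only for edges at the closing columns, so that the lemma also
    applies, through [coherent_step], while that triviality is being derived. *)
Lemma curve_potentialP c d : on_curve c -> on_curve d ->
  near3 (cell_pos c) (cell_pos d) ->
  (closing c || closing d -> pre ((cell_pos c).2 %/ W)%N M = 1) ->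
  label gen c d = (curve_potential c)^-1 * curve_potential d.
Proof.
(* Exchanging c and d inverts both sides, so one orientation of each kind of edge is enough. *)
suff half : forall c d, on_curve c -> on_curve d -> near3 (cell_pos c) (cell_pos d) ->
    (closing c || closing d -> pre ((cell_pos c).2 %/ W)%N M = 1) ->
    (match c, d with
     | Base x _, Base x' _ => x <= x'
     | Base _ _, Foot _ _ _ | Foot _ _ _, Foot _ _ _ | Top _ _, Foot _ _ _ | Top _ _, Top _ _ => true
     | _, _ => false end) -> label gen c d = (curve_potential c)^-1 * curve_potential d.
  move=> cK dK cd pM; have dc := cd; rewrite near3_sym in dc.
  have pM' : closing d || closing c -> pre ((cell_pos d).2 %/ W)%N M = 1.
    by rewrite orbC -(on_curve_near cK dK cd).1.
  have flip : label gen d c = (curve_potential d)^-1 * curve_potential c ->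
      label gen c d = (curve_potential c)^-1 * curve_potential d.
    by move=> dcE; rewrite label_sym dcE invgM invgK.
  have ab := near_cell_gen cd.
  case: c d cK dK cd pM dc pM' flip ab => [x z|s a z|a z] [x' z'|s' b z'|b z'] cK dK cd pM dc pM' flip ab //;
    try (by apply: half); try (by apply: flip; apply: half).
  by have [xx|/ltnW xx] := leqP x x'; [apply: half|apply: flip; apply: half].
move=> {}c {}d cK dK cd pM; have [zz tt] := on_curve_near cK dK cd; have ab := near_cell_gen cd.
case: c d cK dK cd pM zz tt ab => [x z|s a z|a z] [x' z'|s' b z'|b z'] //.
- move=> cK dK /and3P[xx _ _] pM zz tt _ le_x.
  rewrite (base_potential cK dK xx zz tt le_x) ?mulVg// => x2.
  by rewrite -[(z' %/ W)%N]zz; apply: pM; rewrite /= x2.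
- move=> [_ xt] dK /and3P[xx _ _] _ /= zz; rewrite zz in xt *.
  move: xt dK; rewrite /=; move: (z' %/ W)%N (z %% W)%N (z' %% W)%N => i t t'.
  move=> xt [j jP] tt _ _.
  have x2 : 2 <= x by move: xx; rewrite /nearn /=; clear; case: s'; lia.
  rewrite ltnNge x2 /=.
  have {}xt : t %% 4 <> 3 \/ letter i (t %/ 4) = None.
    by case: xt => [|[]|[]//]; move: x2; clear; lia.
  suff -> : (t %/ 4 = t' %/ 4)%N by rewrite mulVg.
  case: jP => [] [lj t'E].
    by move: t'E tt; rewrite /nearn; clear; lia.
  (* The upper foot of letter j, at [4 j + 4], would be near the row at [4 j + 3], which has the
     shorter prefix; that row is absent because letter j exists. *)
  have [tj|tj] := eqVneq t (4 * j + 3)%N.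
    case: xt; first by move: tj; clear; lia.
    by rewrite tj (_ : (4 * j + 3) %/ 4 = j)%N ?lj//; clear; lia.
  by move: t'E tt tj; rewrite /nearn; clear; lia.
- move=> + + _ _ zz tt [ss ab] _; move: zz tt; rewrite /on_curve /= => zz tt; rewrite zz.
  move: tt; move: (z' %/ W)%N (z %% W)%N (z' %% W)%N => i t t' tt [j jP] [k kP].
  suff -> : t = t' by case: s {ss jP kP} => /=; rewrite mulVg.
  by case: jP => [] [_ jP]; case: kP => [] [_ kP]; move: jP kP tt; rewrite /nearn; clear; lia.
- move=> + + _ _ zz tt ab _; move: zz tt; rewrite /on_curve /= => zz tt; rewrite zz -{}ab.
  move: tt; move: (z' %/ W)%N (z %% W)%N (z' %% W)%N => i t t' tt [j [r [lj tj]]] [k kP].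
  have jk : k = j by case: kP => [] [_ kP]; move: tj kP tt; rewrite /nearn; clear; lia.
  rewrite {k}jk in kP; rewrite (_ : (t - 2) %/ 4 = j)%N; last by move: tj; clear; lia.
  rewrite lj; case: kP => [] [lk t'E]; have [_ rs] := letter_inj lj lk.
    rewrite t'E (_ : (4 * j + 2) %/ 4 = j)%N; last by clear; lia.
    rewrite {r}rs in lj *; case: s' lk lj => lk lj; first by rewrite mulVg.
    by rewrite (pre_letter lj) invgM invgK -mulgA mulVg mulg1.
  rewrite t'E (_ : (4 * j + 4) %/ 4 = j.+1)%N; last by clear; lia.
  rewrite {r}rs in lj *; case: s' lk lj => lk lj /=; first by rewrite mulVg.
  by rewrite (pre_letter lj) mulKg.
- move=> + + _ _ zz tt ab _; move: zz tt; rewrite /on_curve /= => zz tt; rewrite zz -{}ab.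
  move: tt; move: (z' %/ W)%N (z %% W)%N (z' %% W)%N => i t t' tt [j [r [lj tj]]] [k [q [lk tk]]].
  have jk : k = j by move: tj tk tt; rewrite /nearn; clear; lia.
  have -> : ((t - 2) %/ 4 = j)%N by move: tj; clear; lia.
  have -> : ((t' - 2) %/ 4 = j)%N by rewrite jk in tk; move: tk; clear; lia.
  by rewrite mulVg.
Qed.

End Potential.
End RelatorCurves.

(* [Low false], [Low true] and [High] are the slices w = 0, 1 and 2. *)
Inductive vtx (n : nat) : Type :=
| Low of bool & cell n
| High of nat & nat & nat.
Arguments High {n}.

Definition vtx_pos n (v : vtx n) : point3 * nat :=
  match v with
  | Low b c => (cell_pos c, nat_of_bool b)
  | High x y z => ((x, y, z), 2)
  end.

Definition adj4 (p q : point3 * nat) : bool :=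
  [&& near3 p.1 q.1, nearn p.2 q.2 & coord3 p.1 q.1 || (p.2 == q.2)].

Lemma adj4_refl p : adj4 p p.
Proof. by rewrite /adj4 near3_refl nearn_refl eqxx orbT. Qed.

Lemma adj4_sym p q : adj4 p q = adj4 q p.
Proof. by rewrite /adj4 near3_sym nearn_sym coord3_sym eq_sym. Qed.

(** * The three slices, their label, and gauges on the slice w = 0 *)

Section Complex.
Variables (n k M : nat) (rel : nat -> word n).
Hypothesis sizeM : forall i, size (rel i) <= M.
Local Notation W := (slab_width M).
Local Notation onK := (on_curve M rel).

Definition adj (u v : vtx n) : bool := adj4 (vtx_pos u) (vtx_pos v).

Lemma adj_refl u : adj u u. Proof. exact: adj4_refl. Qed.
Lemma adj_sym u v : adj u v -> adj v u. Proof. by rewrite /adj adj4_sym. Qed.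

Definition cell_ok (c : cell n) : Prop :=
  (cell_pos c).1.1 <= 4 * n + 4 /\ (cell_pos c).2 < k * W.

Definition box_ok (p : point3) : Prop :=
  [/\ p.1.1 <= 4 * n + 4, p.1.2 <= 2, p.2 < k * W & p.2 %% W <= 4 * M + 2].

Definition vtx_ok (v : vtx n) : Prop :=
  match v with
  | Low b c => cell_ok c /\ (b -> onK c)
  | High x y z => box_ok (x, y, z)
  end.

Lemma slab_width_gt0 : 0 < W. Proof. by rewrite /slab_width addn4. Qed.

Lemma pos_slab z : 0 < z %% W -> z.-1 %% W = (z %% W).-1 /\ z.-1 %/ W = z %/ W.
Proof.
move=> z0; have zE : z.-1 = z %/ W * W + (z %% W).-1.
  by have := divn_eq z W; move: z0; move: (z %/ W * W) (z %% W) => q r; clear; lia.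
have zW : (z %% W).-1 < W by rewrite (leq_ltn_trans (leq_pred _)) ?ltn_pmod ?slab_width_gt0.
split; first by rewrite zE modnMDl modn_small.
by rewrite zE divnMDl ?slab_width_gt0// (divn_small zW) addn0.
Qed.

Section Labels.
Variables (P : groupType) (gen : 'I_n -> P) (pre : nat -> nat -> P).
Local Open Scope group_scope.
Local Notation F := (curve_potential M rel pre).

(** On the curve the label is the coboundary of [F]; the edges to the box undo [F], so the box can
    carry the trivial label. Slices w = 0 and w = 2 are not adjacent, and the value 1 between them
    is a placeholder. *)
Definition vtx_label (u v : vtx n) : P :=
  match u, v with
  | Low _ c, Low _ d => label gen c d
  | Low b c, High _ _ _ => if b then (F c)^-1 else 1
  | High _ _ _, Low b d => if b then F d else 1
  | High _ _ _, High _ _ _ => 1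
  end.

Hypothesis pre0 : forall i, pre i 0 = 1.
Hypothesis pre_letter : forall i j l, letter rel i j = Some l ->
  pre i j.+1 = pre i j * letter_value gen l.
Hypothesis pre_blank : forall i j, letter rel i j = None -> pre i j.+1 = pre i j.
Hypothesis preM : forall i, pre i M = 1.

Lemma vtx_label_cocycle : cocycle_on vtx_ok adj vtx_label.
Proof.
have pot c d : onK c -> onK d -> near3 (cell_pos c) (cell_pos d) ->
    label gen c d = (F c)^-1 * F d.
  by move=> cK dK cd; apply: curve_potentialP => // _; exact: preM.
move=> [b c|x y z] [b' d|x' y' z'] [b'' e|x'' y'' z''] /= uS vS wS
  /and3P[/= uv uvw _] /and3P[/= vw vww _] /and3P[/= uw uww _].
- exact: label_cocycle.
- case: b uS uvw uww => // -[_ /(_ isT) cK] _ _.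
  case: b' vS vww => // -[_ /(_ isT) dK] _.
  by rewrite pot// mulgK.
- case: b uS uvw uww => // -[_ /(_ isT) cK] _ _.
  case: b'' wS vww => // -[_ /(_ isT) dK] _.
  by rewrite pot.
- by case: b uS uvw uww => // *; rewrite mulg1.
- case: b' vS uvw vww => // -[_ /(_ isT) cK] _ _.
  case: b'' wS uww => // -[_ /(_ isT) dK] _.
  by rewrite pot// mulVKg.
- by case: b' vS uvw vww => // *; rewrite mulgV.
- by case: b'' wS uww vww => // *; rewrite mul1g.
- by rewrite mulg1.
Qed.

End Labels.

Section Universal.
Variables (P : groupType) (e : vtx n -> vtx n -> P).
Local Open Scope group_scope.
Hypothesis ce : cocycle_on vtx_ok adj e.

Definition spanning (c d : cell n) : bool :=
  match c, d with
  | Top _ _, Foot false _ _ | Foot false _ _, Top _ _ => false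
  | _, _ => true
  end.

Definition adj0 (c d : cell n) : bool := near3 (cell_pos c) (cell_pos d) && spanning c d.

Definition e0 (c d : cell n) : P := e (Low false c) (Low false d).

Definition foot_x (s : bool) (a : 'I_n) : nat := (4 * a + (if s then 4 else 6))%N.

Lemma foot_x_bound s a : (4 <= foot_x s a)%N /\ (foot_x s a <= 4 * n + 4)%N.
Proof. by rewrite /foot_x; move: (ltn_ord a); clear; case: s; lia. Qed.

Definition cell_rank (c : cell n) : nat :=
  match c with
  | Base x z => x + z
  | Foot s a z => (foot_x s a + z).+1
  | Top a z => (foot_x true a + z).+2
  end%N.

Definition cell_par (c : cell n) : cell n :=
  match c with
  | Base x z => if (0 < x)%N then Base x.-1 z else Base x z.-1
  | Foot s a z => Base (foot_x s a) z
  | Top a z => Foot true a z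
  end.

Lemma adj_low c d : near3 (cell_pos c) (cell_pos d) -> adj (Low false c) (Low false d).
Proof. by move=> cd; rewrite /adj /adj4 /= cd orbT. Qed.

Lemma e0_cocycle : cocycle_on cell_ok adj0 e0.
Proof.
move=> c d f cS dS fS /andP[cd _] /andP[df _] /andP[cf _].
by apply: ce => //; exact: adj_low.
Qed.

Lemma cell_parP c : cell_ok c -> (0 < cell_rank c)%N ->
  [/\ cell_ok (cell_par c), adj0 (cell_par c) c & cell_rank (cell_par c) = (cell_rank c).-1].
Proof.
case: c => [x z|s a z|a z]; rewrite /cell_ok /adj0 /near3 /nearn /=; move: (k * W)%N => Z [].
- by case: ifP => x0 /= xS zS r0; (do 2?split); move: x0 xS zS r0; clear; lia.
- have [f1 f2] := foot_x_bound s a; move: f1 f2; rewrite /foot_x => f1 f2 xS zS _.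
  by do 2?split; move: f1 f2 xS zS; clear; lia.
- move=> xS zS _; rewrite /foot_x; do 2?split; move: xS zS; clear; lia.
Qed.

Lemma cell_adjP c d : cell_ok c -> cell_ok d -> adj0 c d ->
  [\/ c = d, (0 < cell_rank d)%N /\ adj0 c (cell_par d) |
   (0 < cell_rank c)%N /\ adj0 (cell_par c) d].
Proof.
move=> _ _ /andP[cd sp]; have ab := near_cell_gen cd; move: cd sp.
case: c d ab => [x z|s a z|a z] [x' z'|s' b z'|b z'] //=;
  rewrite /adj0 /near3 /nearn /spanning /foot_x /=.
- move=> _ cd _; case: (ltngtP x x') => xx.
  + by constructor 2; rewrite (leq_ltn_trans _ xx)//= andbT; move: xx cd; clear; lia.
  + by constructor 3; rewrite (leq_ltn_trans _ xx)//= andbT; move: xx cd; clear; lia.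
  + case: (ltngtP z z') => zz; last by constructor 1; rewrite xx zz.
      constructor 2; case: ifP => x0 /=; rewrite ?andbT; move: xx cd zz x0; clear; lia.
    constructor 3; case: ifP => x0 /=; rewrite ?andbT; move: xx cd zz x0; clear; lia.
- by move=> _ cd _; constructor 2; rewrite ?andbT; move: cd; clear; lia.
- by move=> _ cd _; constructor 3; rewrite ?andbT; move: cd; clear; lia.
- by move=> [-> ->] cd _; constructor 2; rewrite ?andbT; move: cd; clear; case: s'; lia.
- by case: s => // <- cd _; constructor 2; rewrite ?andbT; move: cd; clear; lia.
- by case: s' => // <- cd _; constructor 3; rewrite ?andbT; move: cd; clear; lia.
- by move=> <- cd _; constructor 2; rewrite ?andbT; move: cd; clear; lia.
Qed.

(** Without the cut edges a handle falls into two branches growing out of the row, one made of the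
    left foot and the top, the other of the right foot. The slice then dismantles to the corner
    [Base 0 0]. *)
Lemma spanning_gauge : exists h : cell n -> P, forall c d, cell_ok c -> cell_ok d ->
  near3 (cell_pos c) (cell_pos d) -> spanning c d -> e0 c d = (h c)^-1 * h d.
Proof.
exists (potential e0 cell_rank cell_par) => c d cS dS cd sp.
apply: (@dismantle _ cell_ok adj0) => //.
- by move=> [??|[]??|??]; rewrite /adj0 near3_refl.
- by move=> [??|[]??|??] [??|[]??|??]; rewrite /adj0 near3_sym.
- exact: e0_cocycle.
- exact: cell_parP.
- exact: cell_adjP.
- by rewrite /adj0 cd.
Qed.

Section Crossing.
Variable h0 : cell n -> P.
Hypothesis e0_spanning : forall c d, cell_ok c -> cell_ok d ->
  near3 (cell_pos c) (cell_pos d) -> spanning c d -> e0 c d = (h0 c)^-1 * h0 d.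

(** The defect of the spanning gauge across a cut edge. Its constant value for fixed [a] becomes the
    image of the generator in [P]. *)
Definition crossing a z z' : P :=
  h0 (Top a z) * e0 (Top a z) (Foot false a z') * (h0 (Foot false a z'))^-1.

Lemma cell_ok_Top a z : (z < k * W)%N -> cell_ok (Top a z).
Proof. by move=> zZ; split=> //=; move: (ltn_ord a); clear; lia. Qed.

Lemma cell_ok_Foot s a z : (z < k * W)%N -> cell_ok (Foot s a z).
Proof. by move=> zZ; split=> //=; move: (ltn_ord a); clear; case: s; lia. Qed.

Lemma near3_Top_Foot s (a : 'I_n) z z' : nearn z z' -> near3 (cell_pos (Top a z)) (cell_pos (Foot s a z')).
Proof. by rewrite /near3 /nearn /=; clear; case: s; lia. Qed.

Lemma near3_Foot_Foot s (a : 'I_n) z z' : nearn z z' -> near3 (cell_pos (Foot s a z)) (cell_pos (Foot s a z')).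
Proof. by rewrite /near3 /= !nearn_refl. Qed.

Lemma near3_Top_Top (a : 'I_n) z z' : nearn z z' -> near3 (cell_pos (Top a z)) (cell_pos (Top a z')).
Proof. by rewrite /near3 /= !nearn_refl. Qed.

Lemma crossing_right a z z' z'' : (z < k * W)%N -> (z' < k * W)%N -> (z'' < k * W)%N ->
  nearn z z' -> nearn z z'' -> nearn z' z'' -> crossing a z z' = crossing a z z''.
Proof.
move=> zZ z'Z z''Z zz' zz'' z'z''; rewrite /crossing.
have <- : e0 (Top a z) (Foot false a z') * e0 (Foot false a z') (Foot false a z'') =
    e0 (Top a z) (Foot false a z'').
  apply: ce; rewrite /vtx_ok; try (by split=> //; first [exact: cell_ok_Top|exact: cell_ok_Foot]);
    apply: adj_low; first [exact: near3_Top_Foot|exact: near3_Foot_Foot].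
rewrite (@e0_spanning (Foot _ _ _) (Foot _ _ _)) //; try exact: cell_ok_Foot; last exact: near3_Foot_Foot.
by rewrite -!mulgA mulgV mulg1.
Qed.

Lemma crossing_left a z z' z'' : (z < k * W)%N -> (z' < k * W)%N -> (z'' < k * W)%N ->
  nearn z z' -> nearn z z'' -> nearn z' z'' -> crossing a z' z = crossing a z'' z.
Proof.
move=> zZ z'Z z''Z zz' zz'' z'z''; rewrite /crossing.
have <- : e0 (Top a z') (Top a z'') * e0 (Top a z'') (Foot false a z) =
    e0 (Top a z') (Foot false a z).
  apply: ce; rewrite /vtx_ok; try (by split=> //; first [exact: cell_ok_Top|exact: cell_ok_Foot]);
    apply: adj_low; first [exact: near3_Top_Top|apply: near3_Top_Foot; rewrite nearn_sym//].
rewrite (@e0_spanning (Top _ _) (Top _ _)) //; try exact: cell_ok_Top; last exact: near3_Top_Top.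
by rewrite !mulgA mulgV mul1g.
Qed.

(** Two cut edges with one common end and near other ends span a triangle whose third edge is not
    cut, so their defects agree; such moves lead down to height 0. *)
Lemma crossingE a z z' : (z < k * W)%N -> (z' < k * W)%N -> nearn z z' ->
  crossing a z z' = crossing a 0 0.
Proof.
move=> zZ z'Z zz'; rewrite -(@crossing_right a z z) ?nearn_refl//.
elim: z zZ {z' z'Z zz'} => [//|z IH] zZ; have zZ' := ltnW zZ.
have n1 : nearn z z.+1 by rewrite /nearn; clear; lia.
rewrite -IH// (@crossing_right a z z z.+1) ?nearn_refl//.
by apply: (@crossing_left a z.+1 z.+1 z); rewrite ?nearn_refl// nearn_sym.
Qed.

Lemma label_gauge : exists g : 'I_n -> P, forall c d, cell_ok c -> cell_ok d ->
  near3 (cell_pos c) (cell_pos d) -> e0 c d = (h0 c)^-1 * label g c d * h0 d.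
Proof.
have [g gE] : exists g : 'I_n -> P, forall a z z', (z < k * W)%N -> (z' < k * W)%N ->
    nearn z z' -> e0 (Top a z) (Foot false a z') = (h0 (Top a z))^-1 * g a * h0 (Foot false a z').
  exists (fun a => crossing a 0 0) => a z z' zZ z'Z zz'.
  by rewrite -(crossingE a zZ z'Z zz') /crossing !mulgA mulVg mul1g mulgVK.
exists g => c d cS dS cd; have [sp|nsp] := boolP (spanning c d).
  have -> : label g c d = 1 by move: sp; case: c d {cS dS cd} => [??|[]??|??] [??|[]??|??].
  by rewrite mulg1 e0_spanning.
have ab := near_cell_gen cd.
case: c d cS dS cd nsp ab => [??|[]a z|a z] [??|[]b z'|b z'] //= cS dS /and3P[_ _ zz] _ ab.
  rewrite /= nearn_sym in zz; rewrite ab in cS *; rewrite /e0.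
  rewrite (cocycle_on_sym adj_refl adj_sym ce (u := Low false (Top b z')))//.
    by rewrite -/(e0 _ _) gE ?cS.2 ?dS.2// !invgM invgK mulgA.
  by apply: adj_low; exact: near3_Top_Foot.
by rewrite ab in cS *; rewrite gE ?cS.2 ?dS.2.
Qed.

End Crossing.

End Universal.
End Complex.

(** * Gauges on the raised curves and on the boxes *)

Section Gauges.
Variables (n k M : nat) (rel : nat -> word n).
Hypothesis sizeM : forall i, size (rel i) <= M.
Local Notation W := (slab_width M).
Local Notation onK := (on_curve M rel).
Local Notation cell_ok := (cell_ok k M).
Local Notation box_ok := (box_ok n k M).
Local Notation vtx_ok := (vtx_ok k M rel).
Variables (P : groupType) (e : vtx n -> vtx n -> P).
Local Open Scope group_scope.
Hypothesis ce : cocycle_on vtx_ok (@adj n) e.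

Definition high (p : point3) : vtx n := High p.1.1 p.1.2 p.2.

(* Cells that differ in all three coordinates are not adjacent when they lie in
   different slices, so the square over such an edge has no diagonal. *)
Lemma curve_detour c d : onK c -> onK d -> cell_ok c -> cell_ok d ->
  near3 (cell_pos c) (cell_pos d) -> ~~ coord3 (cell_pos c) (cell_pos d) ->
  exists r, [/\ onK r, cell_ok r,
    near3 (cell_pos c) (cell_pos r) && coord3 (cell_pos c) (cell_pos r) &
    near3 (cell_pos r) (cell_pos d) && coord3 (cell_pos r) (cell_pos d)].
Proof.
have sym (c' d' : cell n) : (exists r, [/\ onK r, cell_ok r,
      near3 (cell_pos c') (cell_pos r) && coord3 (cell_pos c') (cell_pos r) &
      near3 (cell_pos r) (cell_pos d') && coord3 (cell_pos r) (cell_pos d')]) ->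
    exists r, [/\ onK r, cell_ok r,
      near3 (cell_pos d') (cell_pos r) && coord3 (cell_pos d') (cell_pos r) &
      near3 (cell_pos r) (cell_pos c') && coord3 (cell_pos r) (cell_pos c')].
  move=> [r [rK rS cr rd]]; exists r; split=> //.
    by rewrite near3_sym coord3_sym.
  by rewrite near3_sym coord3_sym.
have base_foot x z s a z' : onK (Base x z) -> onK (Foot s a z') -> cell_ok (Foot s a z') ->
    near3 (cell_pos (Base x z : cell n)) (cell_pos (Foot s a z')) ->
    exists r, [/\ onK r, cell_ok r,
      near3 (cell_pos (Base x z : cell n)) (cell_pos r) && coord3 (cell_pos (Base x z : cell n)) (cell_pos r) &
      near3 (cell_pos r) (cell_pos (Foot s a z')) && coord3 (cell_pos r) (cell_pos (Foot s a z'))].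
  move=> _ dK [dx dz] cd; exists (Base (foot_x s a) z'); split.
  - have := on_curve_loc sizeM dK => /= dM; split=> //; constructor 3.
    have [f4 _] := foot_x_bound s a; split; first by rewrite (leq_trans _ f4).
    left; move: dK => [j [] [_ ->]].
      by clear; lia.
    by clear; lia.
  - by split.
  - by move: cd; rewrite /near3 /coord3 /nearn /= /foot_x; clear; case: s; lia.
  - by rewrite /near3 /coord3 /nearn /= /foot_x; clear; case: s; lia.
have foot_top s a z z' : onK (Foot s a z) -> onK (Top a z') -> cell_ok (Foot s a z) ->
    near3 (cell_pos (Foot s a z)) (cell_pos (Top a z')) ->
    exists r, [/\ onK r, cell_ok r,
      near3 (cell_pos (Foot s a z)) (cell_pos r) && coord3 (cell_pos (Foot s a z)) (cell_pos r) &
      near3 (cell_pos r) (cell_pos (Top a z')) && coord3 (cell_pos r) (cell_pos (Top a z'))].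
  move=> cK dK [cx cz] cd; exists (Top a z); split.
  - case: cK => j [] [lj zE]; exists j.
      by exists s; split=> //; rewrite zE; clear; lia.
    by exists (~~ s); split=> //; rewrite zE; clear; lia.
  - exact: cell_ok_Top.
  - by rewrite /near3 /coord3 /nearn /=; clear; case: s; lia.
  - by move: cd; rewrite /near3 /coord3 /nearn /=; clear; case: s; lia.
move=> cK dK cS dS cd; have ab := near_cell_gen cd.
case: c d cK dK cS dS cd ab => [x z|s a z|a z] [x' z'|s' b z'|b z'] cK dK cS dS cd ab nc //.
- by move: nc; rewrite /coord3 /= !orbT.
- exact: base_foot.
- by apply: sym; apply: base_foot => //; rewrite near3_sym.
- by move: nc; rewrite /coord3 /= !orbT.
- by rewrite /= in ab; subst b; exact: foot_top.
- by rewrite /= in ab; subst b; apply: sym; apply: foot_top => //; rewrite near3_sym.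
- by move: nc; rewrite /coord3 /= !orbT.
Qed.

Section Curve.
Variables (h0 : cell n -> P) (g : 'I_n -> P).
Hypothesis h0E : forall c d, cell_ok c -> cell_ok d -> near3 (cell_pos c) (cell_pos d) ->
  e (Low false c) (Low false d) = (h0 c)^-1 * label g c d * h0 d.

(** The gauge [h1] is [h0] transported along vertical edges. If two cells share a coordinate, the
    square over their edge has a diagonal and splits into triangles; otherwise [curve_detour] gives
    a triangle in the slice w = 1 whose other two edges are of the first kind. *)
Lemma curve_gauge : exists h1 : cell n -> P,
  (forall c d, cell_ok c -> onK c -> cell_ok d -> near3 (cell_pos c) (cell_pos d) ->
     coord3 (cell_pos c) (cell_pos d) ->
     e (Low true c) (Low false d) = (h1 c)^-1 * label g c d * h0 d) /\
  (forall c d, cell_ok c -> onK c -> cell_ok d -> onK d -> near3 (cell_pos c) (cell_pos d) ->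
     e (Low true c) (Low true d) = (h1 c)^-1 * label g c d * h1 d).
Proof.
have [h1 h1E] : exists h1 : cell n -> P, forall c,
    e (Low false c) (Low true c) = (h0 c)^-1 * h1 c.
  by exists (fun c => h0 c * e (Low false c) (Low true c)) => c; rewrite mulKg.
have vert (b b' : bool) (c : cell n) : adj (Low b c) (Low b' c).
  by rewrite /adj /adj4 /= near3_refl coord3_refl andbT; case: b b' => [] [].
have down (c d : cell n) : cell_ok c -> onK c -> cell_ok d -> near3 (cell_pos c) (cell_pos d) ->
    coord3 (cell_pos c) (cell_pos d) ->
    e (Low true c) (Low false d) = (h1 c)^-1 * label g c d * h0 d.
  move=> cS cK dS cd cd'.
  have <- : e (Low true c) (Low false c) * e (Low false c) (Low false d) =
      e (Low true c) (Low false d).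
    by apply: ce => //; [exact: adj_low|rewrite /adj /adj4 /= cd cd'].
  have okf : vtx_ok (Low false c) by [].
  have okt : vtx_ok (Low true c) by [].
  rewrite (cocycle_on_sym (@adj_refl n) (@adj_sym n) ce okf okt (vert _ _ c)).
  by rewrite h1E h0E// invgM invgK -!mulgA mulVKg.
have side (c d : cell n) : cell_ok c -> onK c -> cell_ok d -> onK d -> near3 (cell_pos c) (cell_pos d) ->
    coord3 (cell_pos c) (cell_pos d) ->
    e (Low true c) (Low true d) = (h1 c)^-1 * label g c d * h1 d.
  move=> cS cK dS dK cd cd'.
  have <- : e (Low true c) (Low false d) * e (Low false d) (Low true d) =
      e (Low true c) (Low true d).
    by apply: ce => //; rewrite /adj /adj4 /= ?cd ?cd' ?near3_refl ?coord3_refl.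
  by rewrite down// h1E -!mulgA mulVKg.
exists h1; split=> // c d cS cK dS dK cd.
have [cd'|ncd] := boolP (coord3 (cell_pos c) (cell_pos d)); first exact: side.
have [r [rK rS /andP[cr cr'] /andP[rd rd']]] := curve_detour cK dK cS dS cd ncd.
have <- : e (Low true c) (Low true r) * e (Low true r) (Low true d) =
    e (Low true c) (Low true d).
  by apply: ce => //; rewrite /adj /adj4 /= ?cr ?rd ?cd orbT.
by rewrite !side// -(label_cocycle g cr rd cd) -!mulgA mulVKg.
Qed.

End Curve.

(** Coordinates are lowered in the order x, y, z. As [box_rank] counts the height within the slab,
    each slab has its own root, the lowest corner of its box. *)
Definition box_par (p : point3) : point3 :=
  if (0 < p.1.1)%N then (p.1.1.-1, p.1.2, p.2)
  else if (0 < p.1.2)%N then (p.1.1, p.1.2.-1, p.2) else (p.1.1, p.1.2, p.2.-1).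

Definition box_rank (p : point3) : nat := (p.1.1 + p.1.2 + p.2 %% W)%N.

Lemma box_slab_near p q : box_ok p -> box_ok q -> near3 p q ->
  (p.2 %/ W = q.2 %/ W)%N /\ nearn (p.2 %% W) (q.2 %% W).
Proof.
move=> [_ _ _ pM] [_ _ _ qM] /and3P[_ _ pq].
by apply: slab_near => //; move: pM qM; rewrite /slab_width; clear; lia.
Qed.

Lemma box_parP p : box_ok p -> (0 < box_rank p)%N ->
  [/\ box_ok (box_par p), near3 (box_par p) p & box_rank (box_par p) = (box_rank p).-1].
Proof.
move: p => [[x y] z]; rewrite /box_ok /box_par /box_rank /near3 /= => -[xB yB zB zM].
have nr a : nearn a a by exact: nearn_refl.
have np a : nearn a.-1 a by rewrite /nearn; lia.
case: ifP => x0 /=.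
  by rewrite !nr np => _; split=> //; [split=> //; move: xB; clear; lia|move: x0; clear; lia].
case: ifP => y0 /=.
  by rewrite !nr np => _; split=> //; [split=> //; move: yB; clear; lia|move: y0; clear; lia].
move=> r0; have z0 : (0 < z %% W)%N by move: x0 y0 r0; move: (z %% W)%N => t; clear; lia.
have [zm zd] := pos_slab z0; rewrite !nr np zm; split=> //.
  split=> //; first by rewrite (leq_ltn_trans (leq_pred _)).
  by rewrite (leq_trans (leq_pred _)).
by move: x0 y0 z0; move: (z %% W)%N => t; clear; lia.
Qed.

Lemma box_adjP p q : box_ok p -> box_ok q -> near3 p q ->
  [\/ p = q, (0 < box_rank q)%N /\ near3 p (box_par q) |
   (0 < box_rank p)%N /\ near3 (box_par p) q].
Proof.
move=> pB qB pq; have [zd zm] := box_slab_near pB qB pq.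
move: p q pq zd zm {pB qB} => [[x y] z] [[x' y'] z'].
rewrite /box_par /box_rank /near3 /= => /and3P[xx yy zz] zd zm.
have step a b : nearn a b -> (a < b)%N -> nearn a b.-1 by rewrite /nearn; clear; lia.
have zE := divn_eq z W; have z'E := divn_eq z' W; rewrite zd in zE.
move: xx yy zz zm zE z'E; rewrite /nearn; move: (z' %/ W * W)%N (z %% W)%N (z' %% W)%N.
move=> q t t' xx yy zz tt zE z'E; clear zd step.
have [xx'|xx'|xx'] := ltngtP x x'.
- by constructor 2; rewrite (leq_ltn_trans _ xx')//=; move: xx yy zz xx'; clear; lia.
- by constructor 3; rewrite (leq_ltn_trans _ xx')//=; move: xx yy zz xx'; clear; lia.
rewrite -{}xx' in xx *; have [x0|x0] := posnP x; last first.
  by constructor 2; rewrite ?x0 /=; move: xx yy zz x0; clear; lia.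
have [yy'|yy'|yy'] := ltngtP y y'.
- by constructor 2; rewrite ?x0 (leq_ltn_trans _ yy')//=; move: xx yy zz yy'; clear; lia.
- by constructor 3; rewrite ?x0 (leq_ltn_trans _ yy')//=; move: xx yy zz yy'; clear; lia.
rewrite -{}yy' in yy *; have [y0|y0] := posnP y; last first.
  by constructor 2; rewrite ?x0 ?y0 /=; move: xx yy zz y0; clear; lia.
have [tt'|tt'|tt'] := ltngtP t t'.
- by constructor 2; rewrite ?x0 ?y0 /=; move: xx yy zz tt tt' zE z'E; clear; lia.
- by constructor 3; rewrite ?x0 ?y0 /=; move: xx yy zz tt tt' zE z'E; clear; lia.
by constructor 1; rewrite zE z'E tt'.
Qed.

Lemma adj_high p q : near3 p q -> adj (high p) (high q).
Proof. by move: p q => [[? ?] ?] [[? ?] ?] pq; rewrite /adj /adj4 /= pq orbT. Qed.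

Lemma vtx_ok_high p : box_ok p -> vtx_ok (high p).
Proof. by move: p => [[? ?] ?]. Qed.

Lemma box_gauge : exists hB : point3 -> P, forall p q, box_ok p -> box_ok q -> near3 p q ->
  e (high p) (high q) = (hB p)^-1 * hB q.
Proof.
exists (potential (fun p q => e (high p) (high q)) box_rank box_par) => p q pB qB pq.
apply: (@dismantle _ box_ok near3) => //.
- exact: near3_refl.
- by move=> u v; rewrite near3_sym.
- move=> u v w uB vB wB uv vw uw; apply: ce; try exact: vtx_ok_high; exact: adj_high.
- exact: box_parP.
- exact: box_adjP.
Qed.

End Gauges.

(** * Trivial monodromy around a relator curve *)

Section Monodromy.
Variables (n k M : nat) (rel : nat -> word n).
Hypothesis sizeM : forall i, size (rel i) <= M.
Local Notation W := (slab_width M).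
Local Notation onK := (on_curve M rel).
Local Notation cell_ok := (cell_ok k M).
Variables (P : groupType) (g : 'I_n -> P) (pre : nat -> nat -> P) (kappa : cell n -> P).
Local Open Scope group_scope.
Local Notation F := (curve_potential M rel pre).
Hypothesis pre0 : forall i, pre i 0 = 1.
Hypothesis pre_letter : forall i j l, letter rel i j = Some l ->
  pre i j.+1 = pre i j * letter_value g l.
Hypothesis pre_blank : forall i j, letter rel i j = None -> pre i j.+1 = pre i j.
(* [kappa] compares a gauge on the curve with a gauge on the box above it; that it
   is parallel forces the holonomy around the curve to be trivial. *)
Hypothesis kappa_step : forall c d, cell_ok c -> cell_ok d -> onK c -> onK d ->
  near3 (cell_pos c) (cell_pos d) -> coord3 (cell_pos c) (cell_pos d) ->
  kappa c = label g c d * kappa d.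

Variable i : nat.
Hypothesis ik : (i < k)%N.
Local Notation B x t := (@Base n x (i * W + t)%N).
Local Notation Fo s a t := (Foot s a (i * W + t)%N).
Local Notation To a t := (Top a (i * W + t)%N).

Lemma slab_div t : (t <= 4 * M + 2)%N -> ((i * W + t) %/ W = i)%N.
Proof.
move=> tM; rewrite divnMDl ?slab_width_gt0// divn_small ?addn0//.
by move: tM; rewrite /slab_width; clear; lia.
Qed.

Lemma slab_mod t : (t <= 4 * M + 2)%N -> ((i * W + t) %% W = t)%N.
Proof. by move=> tM; rewrite modnMDl modn_small//; move: tM; rewrite /slab_width; clear; lia. Qed.

Lemma slab_lt t : (t <= 4 * M + 2)%N -> (i * W + t < k * W)%N.
Proof.
move=> tM; have : (i.+1 * W <= k * W)%N by rewrite leq_mul2r ik orbT.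
apply: leq_trans; rewrite mulSn addnC ltn_add2r.
by move: tM; rewrite /slab_width; clear; lia.
Qed.

Lemma cell_ok_base x t : (x <= 4 * n + 4)%N -> (t <= 4 * M + 2)%N -> cell_ok (B x t).
Proof. by move=> xn tM; split=> //=; exact: slab_lt. Qed.

Definition full_row (t : nat) : Prop := (t %% 4 <> 3)%N \/ letter rel i (t %/ 4) = None.

Lemma on_curve_base x t : (2 <= x)%N -> (t <= 4 * M + 2)%N -> full_row t -> onK (B x t).
Proof. by move=> x2 tM tr; rewrite /= slab_div// slab_mod//; split=> //; constructor 3. Qed.

Lemma on_curve_column t : (t <= 4 * M + 2)%N -> onK (B 0 t).
Proof. by move=> tM; rewrite /= slab_mod//; split=> //; constructor 1. Qed.

Lemma on_curve_end t : t = 0%N \/ t = (4 * M + 2)%N -> onK (B 1 t).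
Proof.
move=> tE; have tM : (t <= 4 * M + 2)%N by case: tE => ->.
by rewrite /= slab_mod//; split=> //; constructor 2.
Qed.

(** The value at [c] is the one that parallel transport from the bottom row of the slab predicts. *)
Definition coherent c : Prop := kappa c = (F c)^-1 * kappa (B 2 0).

Lemma coherent_step c d : cell_ok c -> cell_ok d -> onK c -> onK d ->
  near3 (cell_pos c) (cell_pos d) -> coord3 (cell_pos c) (cell_pos d) ->
  (closing c || closing d -> pre ((cell_pos c).2 %/ W)%N M = 1) ->
  coherent c -> coherent d.
Proof.
move=> cS dS cK dK cd cd' pM gc; rewrite /coherent.
rewrite (kappa_step dS cS dK cK) 1?near3_sym 1?coord3_sym// gc.
rewrite (curve_potentialP sizeM pre0 pre_letter pre_blank dK cK) 1?near3_sym//.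
  by rewrite -!mulgA mulVKg.
by rewrite orbC -(on_curve_near sizeM cK dK cd).1.
Qed.

Lemma closing_base x z : (2 <= x)%N -> closing (@Base n x z) = false.
Proof. by move=> x2; rewrite /closing ltnNge x2. Qed.

Lemma coherent_base_step x t x' t' : (2 <= x <= 4 * n + 4)%N -> (2 <= x' <= 4 * n + 4)%N ->
  (t <= 4 * M + 2)%N -> (t' <= 4 * M + 2)%N -> full_row t -> full_row t' -> nearn x x' -> nearn t t' ->
  coherent (B x t) -> coherent (B x' t').
Proof.
move=> /andP[x2 xn] /andP[x2' xn'] tM tM' tr tr' xx tt.
apply: coherent_step; try exact: cell_ok_base; try exact: on_curve_base.
- by move: xx tt; rewrite /near3 /nearn /=; move: (i * W)%N => q; clear; lia.
- by rewrite /coord3 /= ?eqxx ?orbT.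
- by rewrite !closing_base.
Qed.

Lemma coherent_row t x0 : (2 <= x0 <= 4 * n + 4)%N -> (t <= 4 * M + 2)%N -> full_row t ->
  coherent (B x0 t) -> forall x, (2 <= x <= 4 * n + 4)%N -> coherent (B x t).
Proof.
move=> x0n tM tr; have tt : nearn t t by exact: nearn_refl.
have step x : (2 <= x < 4 * n + 4)%N -> coherent (B x t) <-> coherent (B x.+1 t).
  move=> xn; have xx : nearn x x.+1 by rewrite /nearn; clear; lia.
  split; first by apply: (coherent_base_step _ _ tM tM tr tr xx tt); move: xn; clear; lia.
  by rewrite nearn_sym in xx; apply: (coherent_base_step _ _ tM tM tr tr xx tt); move: xn; clear; lia.
have two x : (2 <= x <= 4 * n + 4)%N -> coherent (B x t) <-> coherent (B 2 t).
  elim: x => [//|x IH] xn; have [x1|x1] := eqVneq x 1%N; first by rewrite x1.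
  have xn' : (2 <= x < 4 * n + 4)%N by move: xn x1; clear; lia.
  rewrite -step// IH//; by move: xn'; clear; lia.
by move=> /(two _ x0n) g2 x xn; apply/two.
Qed.

Lemma on_curve_letter j a s : letter rel i j = Some (a, s) ->
  [/\ (j < M)%N, onK (Fo s a (4 * j + 2)), onK (Fo (~~ s) a (4 * j + 4)) &
   forall t, (4 * j + 2 <= t <= 4 * j + 4)%N -> onK (To a t)].
Proof.
move=> lj; have jM := letter_lt sizeM lj; split=> //.
- have tM : (4 * j + 2 <= 4 * M + 2)%N by move: jM; clear; lia.
  by exists j; left; rewrite slab_div// slab_mod.
- have tM : (4 * j + 4 <= 4 * M + 2)%N by move: jM; clear; lia.
  by exists j; right; rewrite slab_div// slab_mod// negbK.
move=> t tj; have tM : (t <= 4 * M + 2)%N by move: jM tj; clear; lia.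
by exists j, s; rewrite slab_div// slab_mod.
Qed.

Lemma coherent_letter j a s : letter rel i j = Some (a, s) ->
  coherent (B (foot_x s a) (4 * j + 2)) ->
  [/\ coherent (Fo s a (4 * j + 2)), coherent (To a (4 * j + 2)), coherent (To a (4 * j + 3)),
      coherent (To a (4 * j + 4)) & coherent (Fo (~~ s) a (4 * j + 4))] /\
  coherent (B (foot_x (~~ s) a) (4 * j + 4)).
Proof.
move=> lj gB; have [jM fK fK' tK] := on_curve_letter lj.
have t2 : (4 * j + 2 <= 4 * M + 2)%N by move: jM; clear; lia.
have t3 : (4 * j + 3 <= 4 * M + 2)%N by move: jM; clear; lia.
have t4 : (4 * j + 4 <= 4 * M + 2)%N by move: jM; clear; lia.
have r2 : full_row (4 * j + 2) by left; clear; lia.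
have r4 : full_row (4 * j + 4) by left; clear; lia.
have [f4 fn] := foot_x_bound s a; have [f4' fn'] := foot_x_bound (~~ s) a.
have f2 := leq_trans (isT : 2 <= 4)%N f4; have f2' := leq_trans (isT : 2 <= 4)%N f4'.
have okF s' t : (t <= 4 * M + 2)%N -> cell_ok (Fo s' a t).
  by move=> tM; apply: cell_ok_Foot; exact: slab_lt.
have okT t : (t <= 4 * M + 2)%N -> cell_ok (To a t).
  by move=> tM; apply: cell_ok_Top; exact: slab_lt.
have g1 : coherent (Fo s a (4 * j + 2)).
  apply: coherent_step gB => //; [exact: cell_ok_base|exact: okF|exact: on_curve_base| | |].
  - by rewrite /near3 /nearn /= /foot_x; clear; lia.
  - by rewrite /coord3 /= ?eqxx ?orbT.
  - by rewrite closing_base ?orbF.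
have g2 : coherent (To a (4 * j + 2)).
  apply: coherent_step g1 => //; [exact: okF|exact: okT|apply: tK| |]; first by clear; lia.
    by rewrite near3_sym; apply: near3_Top_Foot; exact: nearn_refl.
  by rewrite /coord3 /= ?eqxx ?orbT.
have g3 : coherent (To a (4 * j + 3)).
  apply: coherent_step g2 => //; [exact: okT|exact: okT|apply: tK|apply: tK| |]; try (by clear; lia).
    by apply: near3_Top_Top; rewrite /nearn; clear; lia.
  by rewrite /coord3 /= ?eqxx ?orbT.
have g4 : coherent (To a (4 * j + 4)).
  apply: coherent_step g3 => //; [exact: okT|exact: okT|apply: tK|apply: tK| |]; try (by clear; lia).
    by apply: near3_Top_Top; rewrite /nearn; clear; lia.
  by rewrite /coord3 /= ?eqxx ?orbT.
have g5 : coherent (Fo (~~ s) a (4 * j + 4)).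
  apply: coherent_step g4 => //; [exact: okT|exact: okF|apply: tK| |]; first by clear; lia.
    by apply: near3_Top_Foot; exact: nearn_refl.
  by rewrite /coord3 /= ?eqxx ?orbT.
split=> //; apply: coherent_step g5 => //; [exact: okF|exact: cell_ok_base|exact: on_curve_base| | |].
- by rewrite /near3 /nearn /= /foot_x; clear; lia.
- by rewrite /coord3 /= ?eqxx ?orbT.
- by rewrite closing_base ?orbF.
Qed.

Lemma coherent_rows t : (t <= 4 * M + 2)%N -> full_row t ->
  forall x, (2 <= x <= 4 * n + 4)%N -> coherent (B x t).
Proof.
have two : (2 <= 2 <= 4 * n + 4)%N by clear; lia.
elim/ltn_ind: t => -[|t] IH tM tr.
  apply: (coherent_row two tM tr); rewrite /coherent /= slab_div// slab_mod//.
  by rewrite div0n pre0 invg1 mul1g.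
have tM' : (t <= 4 * M + 2)%N by exact: ltnW.
have [rt|nrt] := pselect (full_row t).
  move=> x xn; apply: (coherent_base_step xn xn tM' tM rt tr (nearn_refl x)) (IH t _ _ _ _ _) => //.
  by rewrite /nearn; clear; lia.
(* The row below is missing only at the gap of a letter j. Coherence then passes from the row at
   [4 j + 2] over the handle to the row at [4 j + 4]. *)
have [t3 lN] : (t %% 4 = 3)%N /\ letter rel i (t %/ 4) <> None.
  by split; [apply: contrapT => t3; apply: nrt; left|move=> lN; apply: nrt; right].
case lj : (letter rel i (t %/ 4)) lN => [[a s]|//] _.
have tE : t = (4 * (t %/ 4) + 3)%N by move: t3; clear; lia.
move: (t %/ 4)%N lj tE => j lj tE.
have [f4 fn] := foot_x_bound s a; have [f4' fn'] := foot_x_bound (~~ s) a.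
have gB : coherent (B (foot_x s a) (4 * j + 2)).
  apply: IH; [|  |by left; clear; lia|]; rewrite ?(leq_trans _ f4)//.
    by rewrite tE; clear; lia.
  by move: tM; rewrite tE; clear; lia.
have [_ gB'] := coherent_letter lj gB.
apply: (@coherent_row t.+1 (foot_x (~~ s) a)) => //; first by rewrite (leq_trans _ f4').
by rewrite (_ : t.+1 = 4 * j + 4)%N// tE; clear; lia.
Qed.

Lemma kappa_column t : (t <= 4 * M + 2)%N -> kappa (B 0 t) = kappa (B 0 0).
Proof.
elim: t => // t IH tM; rewrite -IH ?(ltnW tM)//.
rewrite (kappa_step _ _ _ _ (c := B 0 t.+1) (d := B 0 t)) ?mul1g//.
- exact: cell_ok_base.
- by apply: cell_ok_base => //; exact: ltnW.
- exact: on_curve_column.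
- by apply: on_curve_column; exact: ltnW.
- by rewrite /near3 /nearn /=; move: (i * W)%N => q; clear; lia.
Qed.

Lemma kappa_ends t : t = 0%N \/ t = (4 * M + 2)%N ->
  kappa (B 1 t) = kappa (B 0 0) /\ kappa (B 2 t) = kappa (B 0 0).
Proof.
move=> tE; have tM : (t <= 4 * M + 2)%N by case: tE => ->.
have rt : full_row t by left; case: tE => ->; clear; lia.
have K1 : kappa (B 1 t) = kappa (B 0 0).
  rewrite -(kappa_column tM) (kappa_step _ _ _ _ (c := B 1 t) (d := B 0 t)) ?mul1g//.
  - by apply: cell_ok_base => //; clear; lia.
  - exact: cell_ok_base.
  - exact: on_curve_end.
  - exact: on_curve_column.
  - by rewrite /near3 /nearn /=; move: (i * W)%N => q; clear; lia.
split=> //; rewrite -K1 (kappa_step _ _ _ _ (c := B 2 t) (d := B 1 t)) ?mul1g//.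
- by apply: cell_ok_base => //; clear; lia.
- by apply: cell_ok_base => //; clear; lia.
- exact: on_curve_base.
- exact: on_curve_end.
- by rewrite /near3 /nearn /=; move: (i * W)%N => q; clear; lia.
Qed.

(** Two ways lead from the bottom of the slab to its top: over the handles [kappa] is multiplied by
    the inverse of the whole relator, while along the column x = 0, where all labels are 1, it does
    not change. *)
Lemma monodromy_trivial : pre i M = 1.
Proof.
have MM : (4 * M + 2 <= 4 * M + 2)%N by [].
have rM : full_row (4 * M + 2) by left; clear; lia.
have two : (2 <= 2 <= 4 * n + 4)%N by clear; lia.
have := coherent_rows MM rM two; rewrite /coherent /= slab_div// slab_mod//.
rewrite (_ : (4 * M + 2) %/ 4 = M)%N; last by clear; lia.
have [_ ->] := kappa_ends (or_introl erefl); have [_ ->] := kappa_ends (or_intror erefl).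
move=> kE; have pM : (pre i M)^-1 = 1 by apply: (mulIg (kappa (B 0 0))); rewrite mul1g -kE.
by rewrite -[pre i M]invgK pM invg1.
Qed.

(** Up to a constant on each slab, [kappa] is therefore the inverse of the potential; the gauge of
    the box absorbs that constant. *)
Lemma coherent_curve c : cell_ok c -> onK c -> ((cell_pos c).2 %/ W)%N = i -> coherent c.
Proof.
move=> cS cK ci; have cM := on_curve_loc sizeM cK.
have k20 := (kappa_ends (or_introl erefl)).2.
have zE : (cell_pos c).2 = (i * W + (cell_pos c).2 %% W)%N by rewrite -{1}ci -divn_eq.
case: c cS cK ci cM zE => [x z|s a z|a z] /= cS cK ci cM zE; rewrite {}zE in cS cK *;
  move: (z %% W)%N cS cK cM => {ci z} t cS cK tM.
- move: (cK); rewrite /= slab_div// slab_mod// => -[_ xt].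
  rewrite /coherent /= k20; case: xt => [x0|[x1 tE]|[x2 tr]].
  + by rewrite x0 /= invg1 mul1g kappa_column.
  + by rewrite x1 /= invg1 mul1g (kappa_ends tE).1.
  + have xn : (2 <= x <= 4 * n + 4)%N by rewrite x2; exact: cS.1.
    by rewrite -k20; exact: (coherent_rows tM tr xn).
- have rt : full_row t.
    by left; move: cK => [j]; rewrite slab_mod// => -[] [_ ->]; clear; lia.
  have [f4 fn] := foot_x_bound s a; have f2 := leq_trans (isT : 2 <= 4)%N f4.
  have xn : (2 <= foot_x s a <= 4 * n + 4)%N by rewrite f2.
  apply: coherent_step (coherent_rows tM rt xn) => //; try exact: cell_ok_base; try exact: on_curve_base.
  + by rewrite /near3 /nearn /= /foot_x; move: (i * W)%N => q; clear; lia.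
  + by rewrite /coord3 /= ?eqxx ?orbT.
  + by rewrite closing_base ?orbF.
- move: cK => [j [s]]; rewrite slab_div// slab_mod// => -[lj tj].
  have jM := letter_lt sizeM lj.
  have t2 : (4 * j + 2 <= 4 * M + 2)%N by move: jM; clear; lia.
  have rt : full_row (4 * j + 2) by left; clear; lia.
  have [f4 fn] := foot_x_bound s a; have f2 := leq_trans (isT : 2 <= 4)%N f4.
  have xn : (2 <= foot_x s a <= 4 * n + 4)%N by rewrite f2.
  have [[_ T2 T3 T4 _] _] := coherent_letter lj (coherent_rows t2 rt xn).
  have : t = (4 * j + 2)%N \/ t = (4 * j + 3)%N \/ t = (4 * j + 4)%N by move: tj; clear; lia.
  by case=> [->|[->|->]].
Qed.

End Monodromy.

(** * Evaluation of words in a group *)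

Section WordEval.
Variables (n : nat) (P : groupType) (g : 'I_n -> P).
Local Open Scope group_scope.

Fixpoint word_eval (w : word n) : P :=
  if w is l :: w' then letter_value g l * word_eval w' else 1.

Lemma word_eval_cat v w : word_eval (v ++ w) = word_eval v * word_eval w.
Proof. by elim: v => [|l v IH] /=; rewrite ?mul1g// IH mulgA. Qed.

Lemma letter_value_inv l : letter_value g (inv_letter l) = (letter_value g l)^-1.
Proof. by case: l => a [] //=; rewrite /letter_value /= invgK. Qed.

Lemma word_eval_cong rels v w : (forall r, r \in rels -> word_eval r = 1) ->
  word_cong rels v w -> word_eval v = word_eval w.
Proof.
move=> rel1; elim=> {v w} [//|v w _ ->//|u v w _ -> _ ->//|v w v' w' _ vv' _ ww'|l|r rr].
- by rewrite !word_eval_cat vv' ww'.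
- by rewrite /= letter_value_inv mulg1 mulgV.
- exact: rel1.
Qed.

Lemma word_eval_take (w : word n) j l : onth w j = Some l ->
  word_eval (take j.+1 w) = word_eval (take j w) * letter_value g l.
Proof.
elim: w j => [|a w IH] [|j] //=; first by move=> [->]; rewrite take0 /= mulg1 mul1g.
by move=> /IH ->; rewrite mulgA.
Qed.

End WordEval.

(** * Gluing the gauges of the three slices *)

Section VertexGauge.
Variables (n k M : nat) (rel : nat -> word n).
Hypothesis sizeM : forall i, size (rel i) <= M.
Hypothesis rel_default : forall i, k <= i -> rel i = [::].
Local Notation W := (slab_width M).
Local Notation onK := (on_curve M rel).
Local Notation cell_ok := (cell_ok k M).
Local Notation box_ok := (box_ok n k M).
Local Notation vtx_ok := (vtx_ok k M rel).
Variables (P : groupType) (e : vtx n -> vtx n -> P).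
Local Open Scope group_scope.
Hypothesis ce : cocycle_on vtx_ok (@adj n) e.

Lemma box_ok_cell c : cell_ok c -> onK c -> box_ok (cell_pos c).
Proof.
move=> [cx cz] cK; split=> //; last exact: on_curve_loc cK.
by case: c {cx cz cK}.
Qed.

Lemma vtx_gauge : exists (g : 'I_n -> P) (h : vtx n -> P),
  (forall i, word_eval g (take M (rel i)) = 1) /\
  forall u v, vtx_ok u -> vtx_ok v -> adj u v ->
    e u v = (h u)^-1 *
            vtx_label M rel g (fun i j => word_eval g (take j (rel i))) u v * h v.
Proof.
have [hs hsE] := spanning_gauge ce.
have [g h0E] := label_gauge ce hsE; move: hs {hsE} h0E => h0 h0E.
have [h1 [h1E h11E]] := curve_gauge sizeM ce h0E.
have [hB hBE] := box_gauge ce.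
have [kappa kappaE] : exists kappa : cell n -> P, forall c,
    e (Low true c) (high n (cell_pos c)) = (h1 c)^-1 * kappa c * hB (cell_pos c).
  exists (fun c => h1 c * e (Low true c) (high n (cell_pos c)) * (hB (cell_pos c))^-1) => c.
  by rewrite !mulgA mulVg mul1g mulgVK.
have up c p : cell_ok c -> onK c -> box_ok p -> near3 (cell_pos c) p -> coord3 (cell_pos c) p ->
    e (Low true c) (high n p) = (h1 c)^-1 * kappa c * hB p.
  move=> cS cK pB cp cp'; have cB := box_ok_cell cS cK.
  have <- : e (Low true c) (high n (cell_pos c)) * e (high n (cell_pos c)) (high n p) =
      e (Low true c) (high n p).
    apply: ce; [by []|exact: vtx_ok_high|exact: vtx_ok_high| |exact: adj_high|].
      by rewrite /adj /adj4 /=; case: (cell_pos c) => -[? ?] ? /=; rewrite near3_refl coord3_refl.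
    by rewrite /adj /adj4 /=; move: p cp cp' {pB} => [[? ?] ?] /= -> ->.
  by rewrite kappaE (hBE _ _ cB pB cp) -!mulgA mulVKg.
have kappa_step c d : cell_ok c -> cell_ok d -> onK c -> onK d ->
    near3 (cell_pos c) (cell_pos d) -> coord3 (cell_pos c) (cell_pos d) ->
    kappa c = label g c d * kappa d.
  move=> cS dS cK dK cd cd'; have dB := box_ok_cell dS dK.
  have : e (Low true c) (Low true d) * e (Low true d) (high n (cell_pos d)) =
      e (Low true c) (high n (cell_pos d)).
    apply: ce; [by []|by []|exact: vtx_ok_high| | |]; rewrite /adj /adj4 /= ?cd ?orbT//;
      move: (cell_pos d) cd cd' => [[? ?] ?] cd cd' /=; by rewrite ?near3_refl ?coord3_refl ?cd ?cd'.
  rewrite h11E// kappaE up// -!mulgA mulVKg => /mulgI; rewrite !mulgA => /mulIg.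
  by move=> ->.
pose pre i j := word_eval g (take j (rel i)).
have pre0 i : pre i 0%N = 1 by rewrite /pre take0.
have pre_letter i j l : letter rel i j = Some l -> pre i j.+1 = pre i j * letter_value g l.
  exact: word_eval_take.
have pre_blank i j : letter rel i j = None -> pre i j.+1 = pre i j.
  rewrite /letter /pre => lN; have sz : (size (rel i) <= j)%N by rewrite -onthNE lN.
  by rewrite !take_oversize// ltnW.
have preM i : pre i M = 1.
  have [ik|ki] := ltnP i k; last by rewrite /pre rel_default.
  exact: (monodromy_trivial sizeM pre0 pre_letter pre_blank kappa_step ik).
have kappaF c : cell_ok c -> onK c -> kappa c =
    (curve_potential M rel pre c)^-1 * kappa (Base 2 ((cell_pos c).2 %/ W * W)).
  move=> cS cK; have ik : ((cell_pos c).2 %/ W < k)%N by rewrite ltn_divLR ?slab_width_gt0 ?cS.2.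
  have := coherent_curve sizeM pre0 pre_letter pre_blank kappa_step ik cS cK erefl.
  by rewrite /coherent addn0.
(* The correction of [hB] is constant on each slab, so it cancels on edges inside a box. *)
pose h (v : vtx n) : P := match v with
  | Low false c => h0 c
  | Low true c => h1 c
  | High x y z => kappa (Base 2 (z %/ W * W)) * hB (x, y, z)
  end.
exists g, h; split=> //.
have flip u v : vtx_ok u -> vtx_ok v -> adj u v ->
    e u v = (h u)^-1 * vtx_label M rel g pre u v * h v ->
    vtx_label M rel g pre v u = (vtx_label M rel g pre u v)^-1 ->
    e v u = (h v)^-1 * vtx_label M rel g pre v u * h u.
  move=> uS vS uv uvE ->.
  by rewrite (cocycle_on_sym (@adj_refl n) (@adj_sym n) ce uS vS uv) uvE !invgM invgK mulgA.
have lowhigh b c x y z : vtx_ok (Low b c) -> vtx_ok (High x y z) -> adj (Low b c) (High x y z) ->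
    e (Low b c) (High x y z) =
    (h (Low b c))^-1 * vtx_label M rel g pre (Low b c) (High x y z) * h (High x y z).
  case: b => -[cS cK] vS /and3P[/= cp // _ cp']; rewrite orbF in cp'.
  rewrite (up c (x, y, z))//; last exact: cK.
  rewrite kappaF//; last exact: cK.
  have [-> _] := box_slab_near (box_ok_cell cS (cK isT)) vS cp.
  by rewrite /= !mulgA.
move=> [b c|x y z] [b' d|x' y' z'] uS vS uv.
- case: b b' uS vS uv => [] [] [cS cK] [dS dK] uv; have /and3P[/= cd _ cd'] := uv.
  + by rewrite h11E//; [exact: cK|exact: dK].
  + by rewrite h1E//; [exact: cK|move: cd'; rewrite orbF].
  + apply: flip; [by split|by split|exact: adj_sym| |exact: label_sym].
    rewrite h1E//; [exact: dK|by rewrite near3_sym|].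
    by rewrite coord3_sym; move: cd'; rewrite orbF.
  + by rewrite -h0E.
- exact: lowhigh.
- apply: flip => //; [exact: adj_sym|by apply: lowhigh => //; exact: adj_sym|].
  by rewrite /=; case: b' {vS uv}; rewrite ?invgK ?invg1.
- have /and3P[/= pq _ _] := uv.
  have [zz _] := box_slab_near uS vS pq.
  rewrite mulg1 zz invgM -mulgA mulKg; exact: (hBE (x, y, z) (x', y', z')).
Qed.

End VertexGauge.

(** * The label with values in the presented group *)

Section PresentedGroupComplex.
Variables (n : nat) (rels : seq (word n)).
Local Open Scope group_scope.
Local Notation G := (presented_group rels).

Definition relator (i : nat) : word n := nth [::] rels i.
Definition relator_bound : nat := \max_(r <- rels) size r.
(** One slab more than there are relators, carrying the empty word, so that the complex has vertices
    even when [rels] is empty. *)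
Definition slab_number : nat := (size rels).+1.
Local Notation M := relator_bound.
Local Notation k := slab_number.
Local Notation W := (slab_width M).

Definition gen_class (a : 'I_n) : G := word_class rels [:: (a, true)].

Lemma size_relator i : (size (relator i) <= M)%N.
Proof.
rewrite /relator; have [ik|ki] := ltnP i (size rels); last by rewrite nth_default.
by apply: leq_bigmax_seq => //; exact: mem_nth.
Qed.

Lemma relator_default i : (k <= i)%N -> relator i = [::].
Proof. by move=> ki; rewrite /relator nth_default// ltnW. Qed.

Lemma take_relator i : take M (relator i) = relator i.
Proof. by rewrite take_oversize ?size_relator. Qed.

Lemma word_eval_class w : word_eval gen_class w = word_class rels w.
Proof.
elim: w => //= -[a b] w ->.
rewrite (_ : letter_value gen_class (a, b) = word_class rels [:: (a, b)]).
  by rewrite [_ * _]pres_mulE.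
by case: b; rewrite /letter_value //= [_^-1]pres_invE.
Qed.

Lemma relator_trivial i : word_eval gen_class (relator i) = 1.
Proof.
rewrite word_eval_class; apply/word_classP; rewrite /relator.
have [ik|ki] := ltnP i (size rels); last by rewrite nth_default//; exact: word_cong_refl.
exact/word_cong_rel/mem_nth.
Qed.

Definition prefix_value (i j : nat) : G := word_eval gen_class (take j (relator i)).

Lemma prefix_value0 i : prefix_value i 0 = 1.
Proof. by rewrite /prefix_value take0. Qed.

Lemma prefix_value_letter i j l : letter relator i j = Some l ->
  prefix_value i j.+1 = prefix_value i j * letter_value gen_class l.
Proof. exact: word_eval_take. Qed.

Lemma prefix_value_blank i j : letter relator i j = None ->
  prefix_value i j.+1 = prefix_value i j.
Proof.
rewrite /letter /prefix_value => lN; have sz : (size (relator i) <= j)%N by rewrite -onthNE lN.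
by rewrite !take_oversize// ltnW.
Qed.

Lemma prefix_valueM i : prefix_value i M = 1.
Proof. by rewrite /prefix_value take_relator relator_trivial. Qed.

Local Notation ok := (vtx_ok k M relator).
Local Notation cell_ok := (cell_ok k M).
Definition complex_label : vtx n -> vtx n -> G :=
  vtx_label M relator gen_class prefix_value.
Local Notation c := complex_label.

Lemma complex_label_cocycle : cocycle_on ok (@adj n) c.
Proof.
exact: (vtx_label_cocycle size_relator prefix_value0 prefix_value_letter
          prefix_value_blank prefix_valueM).
Qed.

Lemma complex_label_universal (P : groupType) (e : vtx n -> vtx n -> P) :
  cocycle_on ok (@adj n) e ->
  exists (psi : G -> P) (h : vtx n -> P), {morph psi : x y / x * y} /\
    forall u v, ok u -> ok v -> adj u v -> e u v = (h u)^-1 * psi (c u v) * h v.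
Proof.
move=> ce; have [g [h [gM eE]]] := vtx_gauge size_relator relator_default ce.
have g1 r : r \in rels -> word_eval g r = 1.
  by move=> /(nthP [::])[i _ <-]; rewrite -[nth _ _ _]/(relator i) -take_relator.
(* The choice of the representing word does not matter because every relator evaluates to 1 by
   [g1]. *)
pose psi (x : G) : P := word_eval g (repr x).
have psiE w : psi (word_class rels w) = word_eval g w.
  exact: (word_eval_cong g1 (repr_word_class rels w)).
have psiM : {morph psi : x y / x * y}.
  elim/word_class_ind => v; elim/word_class_ind => w.
  by rewrite [_ * _]pres_mulE !psiE word_eval_cat.
have psi1 : psi 1 = 1 by rewrite [1](erefl (word_class rels [::])) psiE.
have psiV x : psi x^-1 = (psi x)^-1.
  by apply/esym/mulg1_eq; rewrite -psiM mulgV psi1.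
have psi_gen a : psi (gen_class a) = g a by rewrite psiE /= mulg1.
have psi_pre i j : psi (prefix_value i j) = word_eval g (take j (relator i)).
  by rewrite /prefix_value word_eval_class psiE.
have psi_label c d : psi (label gen_class c d) = label g c d.
  by case: c d => [??|[]??|??] [??|[]??|??] //=; rewrite ?psiV psi_gen.
have psi_pot c : psi (curve_potential M relator prefix_value c) =
    curve_potential M relator (fun i j => word_eval g (take j (relator i))) c.
  case: c => [x z|s a z|a z] /=; [by case: ifP|by []|].
  by case: (letter _ _ _) => [[a' []]|].
exists psi, h; split=> // u v uS vS uv; rewrite eE//; congr (_ * _ * _).
case: u v {uS vS uv} => [b x|x y z] [b' d|x' y' z'] /=.
- by rewrite psi_label.
- by case: b; rewrite ?psiV ?psi_pot.
- by case: b'; rewrite ?psi_pot.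
- by rewrite psi1.
Qed.

Inductive walk (u : vtx n) : vtx n -> G -> Prop :=
| walk_refl : walk u u 1
| walk_step v w a : walk u v a -> ok v -> ok w -> adj v w -> walk u w (a * c v w).

Lemma walk_trans u v w a b : walk u v a -> walk v w b -> walk u w (a * b).
Proof.
move=> uv; elim=> [|v' w' b' _ IH vS wS vw]; first by rewrite mulg1.
by rewrite mulgA; exact: walk_step.
Qed.

Lemma walk_edge u v : ok u -> ok v -> adj u v -> walk u v (c u v).
Proof. by move=> uS vS uv; rewrite -[c u v]mul1g; apply: walk_step => //; exact: walk_refl. Qed.

Lemma walk_sym u v a : walk u v a -> walk v u a^-1.
Proof.
elim=> [|v' w a' _ IH vS wS vw]; first by rewrite invg1; exact: walk_refl.
rewrite invgM; apply: walk_trans IH.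
rewrite -(cocycle_on_sym (@adj_refl n) (@adj_sym n) complex_label_cocycle vS wS vw).
by apply: walk_edge => //; exact: adj_sym.
Qed.

Local Notation b0 := (Low false (@Base n 0 0)).

Lemma cell_step x y : cell_ok x -> cell_ok y -> near3 (cell_pos x) (cell_pos y) ->
  spanning x y -> walk b0 (Low false x) 1 -> walk b0 (Low false y) 1.
Proof.
move=> xS yS xy sp bx; rewrite -[1]mulg1.
have {2}-> : 1 = c (Low false x) (Low false y).
  by rewrite /= /complex_label /=; case: x y sp {xS yS xy bx} => [??|[]??|??] [??|[]??|??].
by apply: walk_step => //; exact: adj_low.
Qed.

(** A cell is joined to its parent by an edge that is not cut, hence has label 1. *)
Lemma walk_cell x : cell_ok x -> walk b0 (Low false x) 1.
Proof.
move En : (cell_rank x) => N; elim: N x En => [|N IH] x En xS.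
  have -> : x = Base 0 0 by case: x En {xS} => // [[|?] [|?]].
  exact: walk_refl.
have r0 : (0 < cell_rank x)%N by rewrite En.
have [pS /andP[px sp] pr] := cell_parP xS r0.
by apply: cell_step px sp (IH _ _ pS) => //; rewrite pr En.
Qed.

Lemma walk_generators w : walk b0 b0 (word_eval gen_class w).
Proof.
have gen a : walk b0 b0 (gen_class a).
  have Z0 : (0 < k * W)%N by rewrite muln_gt0 slab_width_gt0.
  have TS : cell_ok (Top a 0) by exact: cell_ok_Top.
  have FS : cell_ok (Foot false a 0) by exact: cell_ok_Foot.
  rewrite -[gen_class a]mul1g -[_ * _]mulg1 -[X in _ * X]invg1.
  apply: walk_trans (walk_sym (walk_cell FS)).
  apply: walk_trans (walk_cell TS) _.
  by apply: (walk_edge (u := Low false (Top a 0))) => //; apply: adj_low; exact: near3_Top_Foot.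
elim: w => [|[a b] w IH] /=; first exact: walk_refl.
apply: walk_trans IH; case: b => /=; first exact: gen.
by apply: walk_sym; exact: gen.
Qed.

Lemma walk_reach u : ok u -> exists a, walk b0 u a.
Proof.
have low x : cell_ok x -> on_curve M relator x -> exists a, walk b0 (Low true x) a.
  move=> xS xK; exists (1 * c (Low false x) (Low true x)).
  apply: walk_step (walk_cell xS) _ _ _ => //.
  by rewrite /adj /adj4 /= near3_refl coord3_refl.
have box_step p q a : box_ok n k M p -> box_ok n k M q -> near3 p q ->
    walk b0 (high n p) a -> exists a', walk b0 (high n q) a'.
  move=> pB qB pq pa; exists (a * c (high n p) (high n q)).
  by apply: walk_step pa _ _ _; [exact: vtx_ok_high|exact: vtx_ok_high|exact: adj_high].
have box p : box_ok n k M p -> exists a, walk b0 (high n p) a.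
  move En : (box_rank M p) => N; elim: N p En => [|N IH] p En pB; last first.
    have r0 : (0 < box_rank M p)%N by rewrite En.
    have [qB qp qr] := box_parP pB r0.
    have [a qa] : exists a, walk b0 (high n (box_par p)) a by apply: IH; rewrite // qr En.
    exact: box_step qp qa.
  move: p En pB => [[x y] z] /eqP; rewrite /box_rank /= !addn_eq0 => /andP[/andP[/eqP-> /eqP->] /eqP z0] pB.
  have [_ _ /= zZ _] := pB.
  (* The root of a box lies over the column x = 0, which is on the curve, so the box is entered from
     the slice w = 1. *)
  have xS : cell_ok (@Base n 0 z) by split.
  have xK : on_curve M relator (@Base n 0 z) by split; [rewrite z0|constructor 1].
  have [a xa] := low _ xS xK; exists (a * c (Low true (Base 0 z)) (High 0 0 z)).
  by apply: walk_step xa _ _ _ => //; rewrite /adj /adj4 /= near3_refl.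
case: u => [[] x|x y z] /=; first by move=> [xS xK]; apply: low => //; exact: xK.
  by move=> [xS _]; exists 1; exact: walk_cell.
by move=> zB; exact: (box (x, y, z)).
Qed.

Lemma walk_transitive u v a : ok u -> ok v -> walk u v a.
Proof.
move=> /walk_reach[b ub] /walk_reach[d vd].
(* A closed walk at [b0] supplies the missing factor [b * a * d^-1]. *)
have -> : a = b^-1 * ((b * a * d^-1) * d) by rewrite mulgVK mulKg.
apply: walk_trans (walk_sym ub) _; apply: walk_trans vd.
elim/word_class_ind: (b * a * d^-1) => w; rewrite -word_eval_class.
exact: walk_generators.
Qed.

End PresentedGroupComplex.

Local Open Scope classical_set_scope.
Local Open Scope ring_scope.

(** * Paths in a geometric realization *)

Section Square.
Variables (R : realType) (T : topologicalType).
Local Notation I := (unit_itv R).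
Local Notation "x ~~> y" := ({path I from x to y in T}) (at level 70).

Lemma path_homotopic_square (F : I * I -> T) (x y m m' : T)
    (p : x ~~> m) (q : m ~~> y) (p' : x ~~> m') (q' : m' ~~> y) :
  continuous F ->
  (forall t, p t = F (t, zero)) -> (forall t, q t = F (one, t)) ->
  (forall t, p' t = F (zero, t)) -> (forall t, q' t = F (t, one)) ->
  path_homotopic (concat p q) (concat p' q').
Proof.
move=> cF Fp Fq Fp' Fq'.
(* Clamped to the unit interval, [(a, b)] runs along two sides of the square and [(b, a)] along the
   other two. Interpolating before clamping keeps both ends at the corners. *)
pose a (z : I * I) := 2 * itv_val z.2; pose b (z : I * I) := 2 * itv_val z.2 - 1.
have ca : continuous a by apply: scale_continuous; exact: snd_val_continuous.
have cb : continuous b by apply: affine_continuous; exact: snd_val_continuous.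
exists (fun z => F
  (itv_proj ((1 - itv_val z.1) * a z + itv_val z.1 * b z),
   itv_proj ((1 - itv_val z.1) * b z + itv_val z.1 * a z))).
split=> [|t|t|s|s]; rewrite /a /b /=.
- apply: continuous_comp_pair => //; apply: itv_proj_comp_continuous.
    by apply: (mix_continuous ca cb); exact: fst_val_continuous.
  by apply: (mix_continuous cb ca); exact: fst_val_continuous.
- rewrite itv_val0 subr0 !mul1r !mul0r !addr0 concatE; case: ifP => t1.
    by rewrite (itv_proj_le0 (t := _ - 1)); [rewrite Fp|lra].
  by rewrite (itv_proj_ge1 (t := 2 * _)); [rewrite Fq|lra].
- rewrite itv_val1 subrr !mul1r !mul0r !add0r concatE; case: ifP => t1.
    by rewrite (itv_proj_le0 (t := _ - 1)); [rewrite Fp'|lra].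
  by rewrite (itv_proj_ge1 (t := 2 * _)); [rewrite Fq'|lra].
- have s0 := itv_val_ge0 s; have s1 := itv_val_le1 s.
  rewrite itv_val0 !itv_proj_le0; [|lra|lra].
  by rewrite -[LHS]Fp path_zero.
- have s0 := itv_val_ge0 s; have s1 := itv_val_le1 s.
  rewrite itv_val1 !itv_proj_ge1; [|lra|lra].
  by rewrite -[LHS]Fq path_one.
Qed.

End Square.

(** * Barycentric coordinates and straight segments *)

Section Realization.
Variables (R : realType) (V : finType) (K : simplicial_complex V).
Local Notation I := (unit_itv R).
Local Notation X := (realization R K).
Implicit Types (x y z : X) (u v w : V).

Definition bary x v : R := (\val x : V -> R) v.

Definition carrier x : {set V} := finset (fun v => bary x v != 0).

Lemma bary_coordinates x : barycentric_coordinates K (bary x : {ptws V -> R}).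
Proof. by case: x => g gK; exact: set_mem. Qed.

Lemma bary_ge0 x v : 0 <= bary x v.
Proof. by have [] := bary_coordinates x. Qed.

Lemma sum_bary x : \sum_v bary x v = 1.
Proof. by have [] := bary_coordinates x. Qed.

Lemma face_carrier x : face K (carrier x).
Proof. by have [] := bary_coordinates x. Qed.

Lemma in_carrier x v : (v \in carrier x) = (0 < bary x v).
Proof. by rewrite inE lt0r bary_ge0 andbT. Qed.

Lemma bary_inj x y : bary x =1 bary y -> x = y.
Proof. by move=> /funext xy; exact: val_inj. Qed.

Lemma carrier_neq0 x : exists v, v \in carrier x.
Proof. by have /face_neq0/set0Pn[v vx] := face_carrier x; exists v. Qed.

Lemma continuous_to_realization (Z : topologicalType) (f : Z -> X) :
  (forall v, continuous (fun a => bary (f a) v)) -> continuous f.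
Proof.
move=> cf; apply: continuous_comp_initial => a.
apply/cvg_sup => v U [W [[B oB <-] Bz] BU].
exact: filterS BU (cf v a _ (open_nbhs_nbhs (conj oB Bz))).
Qed.

Lemma bary_continuous v : continuous (bary^~ v).
Proof.
move=> x; apply: (@continuous_comp _ {ptws V -> R} _ (\val : X -> {ptws V -> R}) (fun g => g v)).
  exact: initial_continuous.
exact: (@function_spaces.proj_continuous V (fun=> R) v).
Qed.

Definition mix_coord x y (t : I) v : R :=
  (1 - itv_val t) * bary x v + itv_val t * bary y v.

Definition joinable x y : Prop := face K (carrier x :|: carrier y).

Lemma joinable_sym x y : joinable x y -> joinable y x.
Proof. by rewrite /joinable finset.setUC. Qed.

Lemma joinable_refl x : joinable x x.
Proof. by rewrite /joinable finset.setUid; exact: face_carrier. Qed.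

Lemma mix_coord_bary x y t : joinable x y ->
  barycentric_coordinates K (mix_coord x y t : {ptws V -> R}).
Proof.
move=> xy; have t0 := itv_val_ge0 t; have t1 := itv_val_le1 t.
have sum1 : \sum_v mix_coord x y t v = 1.
  by rewrite big_split/= -!mulr_sumr !sum_bary !mulr1 subrK.
have ge0 v : 0 <= mix_coord x y t v.
  by rewrite addr_ge0// mulr_ge0 ?bary_ge0// subr_ge0.
split=> //; apply: face_sub xy _ _.
  apply/fintype.subsetP => v; rewrite !inE; apply: contraR.
  by rewrite negb_or !negbK /mix_coord => /andP[/eqP-> /eqP->]; rewrite !mulr0 addr0.
apply/negP => /eqP s0; move: sum1; rewrite big1 => [/eqP|v _].
  by rewrite eq_sym oner_eq0.
apply/eqP/negPn/negP => gv.
by have := finset.in_set0 v; rewrite -s0 inE gv.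
Qed.

(* Equal to [x] when the two points do not lie in a common face. *)
Definition mix x y t : X :=
  if pselect (joinable x y) is left xy
  then exist _ (mix_coord x y t : {ptws V -> R}) (mem_set (mix_coord_bary t xy))
  else x.

Lemma bary_mix x y t v : joinable x y -> bary (mix x y t) v = mix_coord x y t v.
Proof. by move=> xy; rewrite /mix; case: pselect. Qed.

Lemma mix_zero x y : joinable x y -> mix x y zero = x.
Proof.
move=> xy; apply: bary_inj => v; rewrite bary_mix// /mix_coord itv_val0.
by rewrite subr0 mul1r mul0r addr0.
Qed.

Lemma mix_one x y : joinable x y -> mix x y one = y.
Proof.
move=> xy; apply: bary_inj => v; rewrite bary_mix// /mix_coord itv_val1.
by rewrite subrr mul1r mul0r add0r.
Qed.

Lemma carrier_mix x y t : carrier (mix x y t) \subset carrier x :|: carrier y.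
Proof.
case: (pselect (joinable x y)) => [xy|xy]; last first.
  by rewrite /mix; case: pselect => // _; exact: finset.subsetUl.
apply/fintype.subsetP => v; rewrite !inE bary_mix// /mix_coord; apply: contraR.
by rewrite negb_or !negbK => /andP[/eqP-> /eqP->]; rewrite !mulr0 addr0.
Qed.

Lemma mix_realization_continuous (Z : topologicalType) (f g : Z -> X) (h : Z -> I) :
  continuous f -> continuous g -> continuous h ->
  (forall a, joinable (f a) (g a)) -> continuous (fun a => mix (f a) (g a) (h a)).
Proof.
move=> cf cg ch fg; apply: continuous_to_realization => v.
rewrite (_ : (fun a => _) = fun a => mix_coord (f a) (g a) (h a) v); last first.
  by apply/funext => a; rewrite bary_mix.
have cb (k : Z -> X) : continuous k -> continuous (fun a => bary (k a) v).
  move=> ck a; apply: (@continuous_comp _ _ _ k (bary^~ v)); first exact: ck.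
  exact: bary_continuous.
have cw : continuous (fun a => itv_val (h a)).
  move=> a.
  apply: (@continuous_comp _ _ _ h (@itv_val R)); first exact: ch.
  exact: itv_val_continuous.
exact: (mix_continuous (cb _ cf) (cb _ cg) cw).
Qed.

Lemma segment_continuous x y : joinable x y -> continuous (mix x y).
Proof.
move=> xy; apply: (@mix_realization_continuous I (fun=> x) (fun=> y) id) => //.
- exact: cst_continuous.
- exact: cst_continuous.
- by move=> t; exact: cvg_id.
Qed.

Definition segment x y (xy : joinable x y) : {path I from x to y in X} :=
  mk_path (segment_continuous xy) (mix_zero xy) (mix_one xy).

Lemma vertex_coordinates v :
  barycentric_coordinates K ((fun w => (w == v)%:R) : {ptws V -> R}).
Proof.
split=> [w||]; first by rewrite ler0n.
  by rewrite (bigD1 v)//= eqxx big1 ?addr0// => w /negPf ->.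
rewrite (_ : finset _ = finset.set1 v); first exact: face_vertex.
by apply/setP => w; rewrite !inE pnatr_eq0 eqb0 negbK.
Qed.

Definition vertex v : X :=
  exist _ ((fun w => (w == v)%:R) : {ptws V -> R}) (mem_set (vertex_coordinates v)).

Lemma bary_vertex v w : bary (vertex v) w = (w == v)%:R.
Proof. by []. Qed.

Lemma carrier_vertex v : carrier (vertex v) = finset.set1 v.
Proof. by apply/setP => w; rewrite !inE bary_vertex pnatr_eq0 eqb0 negbK. Qed.

Lemma sub_joinable x y (s : {set V}) : face K s ->
  carrier x \subset s -> carrier y \subset s -> joinable x y.
Proof.
move=> Ks xs ys; apply: face_sub Ks _ _; first by rewrite finset.subUset xs.
have [v vx] := carrier_neq0 x.
by apply/set0Pn; exists v; rewrite finset.in_setU vx.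
Qed.

Lemma vertex_joinable x v : v \in carrier x -> joinable x (vertex v).
Proof.
move=> vx; apply: (sub_joinable (face_carrier x)) => //.
by rewrite carrier_vertex finset.sub1set.
Qed.

(** The straight-line homotopy: corresponding points lie in a common simplex. *)
Lemma joinable_homotopic x y (p q : {path I from x to y in X}) :
  (forall t, joinable (p t) (q t)) -> path_homotopic p q.
Proof.
move=> pq; exists (fun a => mix (p a.2) (q a.2) a.1); split=> [|t|t|s|s] /=.
- apply: mix_realization_continuous => //.
  + by move=> a; apply: continuous_comp; [exact: cvg_snd|exact: cts_fun].
  + by move=> a; apply: continuous_comp; [exact: cvg_snd|exact: cts_fun].
  + by move=> a; exact: cvg_fst.
- by rewrite mix_zero.
- by rewrite mix_one.
- apply: bary_inj => v; rewrite bary_mix// /mix_coord !path_zero.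
  by rewrite -mulrDl subrK mul1r.
- apply: bary_inj => v; rewrite bary_mix// /mix_coord !path_one.
  by rewrite -mulrDl subrK mul1r.
Qed.

Lemma segment_carrier x y (xy : joinable x y) t :
  carrier (segment xy t) \subset carrier x :|: carrier y.
Proof. exact: carrier_mix. Qed.

Lemma segment_concat x y z (xy : joinable x y) (yz : joinable y z)
    (xz : joinable x z) : face K (carrier x :|: carrier y :|: carrier z) ->
  path_homotopic (concat (segment xy) (segment yz)) (segment xz).
Proof.
move=> Kxyz; apply: joinable_homotopic => t; apply: (sub_joinable Kxyz).
  rewrite concatE; case: ifP => _; apply: fintype.subset_trans (segment_carrier _ _) _.
    exact: finset.subsetUl.
  by apply: finset.setSU; exact: finset.subsetUr.
apply: fintype.subset_trans (segment_carrier _ _) _.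
by apply: finset.setSU; exact: finset.subsetUl.
Qed.

(* The homotopy is the cone from [v] over the path. *)
Lemma star_path_homotopic x y v (p : {path I from x to y in X})
    (xv : joinable x (vertex v)) (yv : joinable y (vertex v)) :
  (forall t, v \in carrier (p t)) ->
  path_homotopic (concat p (segment yv)) (concat (segment xv) (const_path R (vertex v))).
Proof.
move=> pv; have pjv t := vertex_joinable (pv t).
apply: (@path_homotopic_square _ _ (fun a => mix (p a.1) (vertex v) a.2)).
- apply: mix_realization_continuous => //.
  + by move=> a; apply: continuous_comp; [exact: cvg_fst|exact: cts_fun].
  + exact: cst_continuous.
  + by move=> a; exact: cvg_snd.
- by move=> t; rewrite mix_zero.
- by move=> t /=; rewrite path_one.
- by move=> t /=; rewrite path_zero.
- by move=> t; rewrite mix_one.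
Qed.

End Realization.

(** * Subpaths, and passing from paths to loops *)

Section Subpath.
Variables (R : realType) (T : topologicalType).
Local Notation I := (unit_itv R).
Local Notation "x ~~> y" := ({path I from x to y in T}) (at level 70).
Variables (x y : T) (p : x ~~> y).

Definition subpath_fun (a b : R) (t : I) : T :=
  p (itv_proj ((b - a) * itv_val t + a)).

Lemma subpath_continuous a b : continuous (subpath_fun a b).
Proof.
apply: Defs.proj_continuous; first exact: cts_fun.
by apply: affine_continuous; exact: itv_val_continuous.
Qed.

Lemma subpath_zero a b : subpath_fun a b zero = p (itv_proj a).
Proof. by rewrite /subpath_fun itv_val0 mulr0 add0r. Qed.

Lemma subpath_one a b : subpath_fun a b one = p (itv_proj b).
Proof. by rewrite /subpath_fun itv_val1 mulr1 subrK. Qed.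

Definition subpath a b : p (itv_proj a) ~~> p (itv_proj b) :=
  mk_path (subpath_continuous (a := a) (b := b)) (subpath_zero a b) (subpath_one a b).

Lemma subpathE a b t : subpath a b t = p (itv_proj ((b - a) * itv_val t + a)).
Proof. by []. Qed.

Lemma subpath_concat a b c :
  path_homotopic (concat (subpath a b) (subpath b c)) (subpath a c).
Proof.
apply: (@path_homotopic_reparam _ _ _ _ _ _ p
  (fun t => if id t <= 2^-1 then 2 * (b - a) * t + a else 2 * (c - b) * t + (b - (c - b)))
  (fun t => (c - a) * t + a)).
- exact: cts_fun.
- apply: (@continuous_glue R).
  + by move=> t; exact: cvg_id.
  + by apply: affine_continuous => t; exact: cvg_id.
  + by apply: affine_continuous => t; exact: cvg_id.
  + by move=> t ->; lra.
- by apply: affine_continuous => t; exact: cvg_id.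
- by rewrite ifT /=; lra.
- by rewrite ifF /=; lra.
- move=> t; rewrite concatE; have t0 := itv_val_ge0 t; have t1 := itv_val_le1 t.
  rewrite /=; case: ifP => t2; rewrite subpathE itv_projK; [|lra| |lra].
    by congr (p (itv_proj _)); lra.
  by congr (p (itv_proj _)); lra.
- by [].
Qed.

End Subpath.

Section Transport.
Variables (R : realType) (T : topologicalType) (x0 : T).
Local Notation I := (unit_itv R).
Local Notation "x ~~> y" := ({path I from x to y in T}) (at level 70).
Variable tau : forall x : T, x0 ~~> x.
Local Open Scope group_scope.

(* Joining all points to the base point turns the fundamental groupoid into the
   fundamental group, so that no endpoints have to be tracked. *)
Definition loop_of (x y : T) (p : x ~~> y) : pi1 R x0 :=
  loop_class (concat (concat (tau x) p) (reverse (tau y))).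

Lemma loop_of_homotopic x y (p q : x ~~> y) :
  path_homotopic p q -> loop_of p = loop_of q.
Proof.
move=> pq; apply/loop_classP/path_homotopic_concat; last exact: path_homotopic_refl.
by apply: path_homotopic_concat => //; exact: path_homotopic_refl.
Qed.

(** Needed where endpoints agree only propositionally, as for a path and its subpath over the whole
    interval. *)
Lemma loop_of_ext x y x' y' (p : x ~~> y) (q : x' ~~> y') :
  (forall t, p t = q t) -> loop_of p = loop_of q.
Proof.
move=> pq; have xx : x = x' by have := pq zero; rewrite !path_zero.
have yy : y = y' by have := pq one; rewrite !path_one.
by subst x' y'; congr loop_of; apply/path_eqP.
Qed.

Lemma loop_of_concat x y z (p : x ~~> y) (q : y ~~> z) :
  loop_of (concat p q) = loop_of p * loop_of q.
Proof.
rewrite [RHS]pi1_mulE; apply/loop_classP.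
apply: path_homotopic_trans.
  apply: path_homotopic_concat (path_homotopic_refl _).
  apply: path_homotopic_sym; exact: concatA.
apply: path_homotopic_sym; apply: path_homotopic_trans; first exact: concatA.
apply: path_homotopic_trans; last first.
  apply: path_homotopic_sym; exact: concatA.
apply: path_homotopic_concat; first exact: path_homotopic_refl.
apply: path_homotopic_trans; first by apply: path_homotopic_sym; exact: concatA.
apply: path_homotopic_concat (path_homotopic_refl _).
apply: path_homotopic_trans; first by apply: path_homotopic_sym; exact: concatA.
apply: path_homotopic_trans; last exact: concat_constl.
by apply: path_homotopic_concat (path_homotopic_refl _); exact: concat_reversel.
Qed.

Lemma loop_of_const x : loop_of (const_path R x) = 1.
Proof.
apply: (mulgI (loop_of (const_path R x))); rewrite mulg1 -loop_of_concat.
apply: loop_of_homotopic; exact: concat_constl.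
Qed.

Lemma loop_of_loop (p : x0 ~~> x0) :
  loop_class p = (loop_class (tau x0))^-1 * loop_of p * loop_class (tau x0).
Proof.
have -> : loop_of p = loop_class (tau x0) * loop_class p * (loop_class (tau x0))^-1.
  by rewrite /loop_of -!pi1_mulE -pi1_invE.
by rewrite -!mulgA mulVg mulg1 mulKg.
Qed.

End Transport.

(** * Holonomy of vertex sequences, and fine subdivisions *)

Section Holonomy.
Variables (V : Type) (G : groupType) (c : V -> V -> G).
Local Open Scope group_scope.

Fixpoint holonomy (v : nat -> V) (n : nat) : G :=
  if n is m.+1 then holonomy v m * c (v m) (v m.+1) else 1.

Lemma eq_holonomy v w n : (forall k, (k <= n)%N -> v k = w k) ->
  holonomy v n = holonomy w n.
Proof. by elim: n => //= n IH vw; rewrite IH ?vw// => k kn; rewrite vw// ltnW. Qed.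

Lemma holonomy_add v n m :
  holonomy v (n + m) = holonomy v n * holonomy (fun k => v (n + k)%N) m.
Proof.
elim: m => [|m IH]; first by rewrite addn0 mulg1.
by rewrite addnS /= IH addnS mulgA.
Qed.

End Holonomy.

Section Lebesgue.
Variables (R : realType) (V : finType) (K : simplicial_complex V).
Local Notation I := (unit_itv R).
Local Notation X := (realization R K).

(** Open stars of vertices cover the realization, because no carrier is empty; compactness of the
    square makes the radius uniform. *)
Lemma lebesgue_number (g : R * R -> X) : continuous g ->
  exists2 N : nat, (0 < N)%N & forall a : R * R, 0 <= a.1 <= 1 -> 0 <= a.2 <= 1 ->
    exists v, forall b : R * R, `|b.1 - a.1| <= N%:R^-1 -> `|b.2 - a.2| <= N%:R^-1 ->
      v \in carrier (g b).
Proof.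
move=> cg; pose S : set (R * R) := [set` `[0 : R, 1]] `*` [set` `[0 : R, 1]].
have cS : compact S by apply: compact_setX; exact: segment_compact.
pose P (n : nat) (a : R * R) := exists v, forall b : R * R,
  `|b.1 - a.1| <= n.+1%:R^-1 -> `|b.2 - a.2| <= n.+1%:R^-1 -> v \in carrier (g b).
have [|n _ nP] := (compact_near_coveringP S).1 cS nat \oo P _ _.
  move=> a _; have [v va] := carrier_neq0 (g a).
  have cv : continuous (fun b => bary (g b) v).
    by move=> b; exact (continuous_comp (cg b) (@bary_continuous R V K v (g b))).
  have : nbhs a [set b | 0 < bary (g b) v].
    rewrite in_carrier in va.
    exact: (cv a [set r | 0 < r] (open_nbhs_nbhs (conj (@open_gt _ 0) va))).
  move=> /nbhs_ballP[e /= e0 ae].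
  exists (ball a (e / 2), [set n : nat | n.+1%:R^-1 < e / 2]) => /=.
    split; first by apply: nbhsx_ballx; rewrite divr_gt0.
    by apply: near_infty_natSinv_lt (PosNum (divr_gt0 e0 (ltr0n _ 2))).
  move=> [b n] [/= [ab1 ab2] ne]; exists v => d bd1 bd2.
  rewrite in_carrier; apply: (ae d); split; rewrite /= /ball /=.
    rewrite (splitr e) -(subrKA b.1); apply: le_lt_trans (ler_normD _ _) _.
    by apply: ltrD => //; rewrite distrC (le_lt_trans bd1).
  rewrite (splitr e) -(subrKA b.2); apply: le_lt_trans (ler_normD _ _) _.
  by apply: ltrD => //; rewrite distrC (le_lt_trans bd2).
exists n.+1 => // a a1 a2.
have Sa : S a by split; rewrite /= in_itv.
exact: (nP n (leqnn n) a Sa).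
Qed.

Lemma simplicial_grid (F : I * I -> X) : continuous F ->
  exists (N : nat) (v : nat -> nat -> V), (0 < N)%N /\
    forall i j s t, (i < N)%N -> (j < N)%N ->
      i%:R / N%:R <= s <= i.+1%:R / N%:R -> j%:R / N%:R <= t <= j.+1%:R / N%:R ->
      v i j \in carrier (F (itv_proj s, itv_proj t)).
Proof.
move=> cF; pose g (a : R * R) := F (itv_proj a.1, itv_proj a.2).
have cg : continuous g.
  by apply: continuous_comp_pair => // a; apply: (@itv_proj_comp_continuous R (R * R)%type) => b;
    [exact: cvg_fst|exact: cvg_snd].
have [N N0 NP] := lebesgue_number cg.
have Np : (0 : R) < N%:R by rewrite ltr0n.
have Nb i : (i < N)%N -> 0 <= (i%:R / N%:R : R) <= 1.
  move=> iN; rewrite divr_ge0 ?ler0n//= ler_pdivrMr// mul1r ler_nat ltnW//.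
have near_corner i s : i%:R / N%:R <= s <= i.+1%:R / N%:R ->
    `|s - i%:R / N%:R| <= N%:R^-1.
  move=> /andP[si sS]; rewrite ger0_norm ?subr_ge0// lerBlDr.
  by rewrite (le_trans sS)// -natr1 mulrDl mul1r addrC.
have ex (ij : nat * nat) : exists v, (ij.1 < N)%N -> (ij.2 < N)%N -> forall s t,
    ij.1%:R / N%:R <= s <= ij.1.+1%:R / N%:R -> ij.2%:R / N%:R <= t <= ij.2.+1%:R / N%:R ->
    v \in carrier (F (itv_proj s, itv_proj t)).
  have [/andP[iN jN]|] := boolP ((ij.1 < N) && (ij.2 < N))%N; last first.
    have [v _] := carrier_neq0 (F (zero, zero)); rewrite negb_and => nij.
    by exists v => i j; rewrite i j in nij.
  have [v vP] := NP (ij.1%:R / N%:R, ij.2%:R / N%:R) (Nb _ iN) (Nb _ jN).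
  exists v => _ _ s t sP tP; apply: (vP (s, t)); exact: near_corner.
have [v vP] := choice ex.
by exists N, (fun i j => v (i, j)); split=> // i j s t iN jN; exact: (vP (i, j)).
Qed.

End Lebesgue.

(** * Holonomy of a simplicial cocycle *)

Section Sampling.
Variables (R : realType) (V : finType) (K : simplicial_complex V).
Local Notation I := (unit_itv R).
Local Notation X := (realization R K).
Local Notation "x ~~> y" := ({path I from x to y in X}) (at level 70).

(** A substitute for simplicial approximation: the j-th of N equal pieces of the path stays in the
    open star of [v j]. *)
Definition sampled (p : I -> X) (N : nat) (v : nat -> V) : Prop :=
  (0 < N)%N /\ forall j t, (j < N)%N -> j%:R / N%:R <= t <= j.+1%:R / N%:R ->
    v j \in carrier (p (itv_proj t)).

Lemma sampled_exists (p : I -> X) : continuous p ->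
  exists Nv : nat * (nat -> V), sampled p Nv.1 Nv.2.
Proof.
move=> cp; have [|N [v [N0 vP]]] := @simplicial_grid R V K (fun a => p a.2).
  by move=> a; apply: continuous_comp; [exact: cvg_snd|exact: cp].
exists (N, v 0%N); split=> // j t jN tP; apply: (vP 0%N j 0 t) => //.
by rewrite mul0r lexx divr_ge0 ?ler0n.
Qed.

Lemma sampled_refine (p : I -> X) N v M : sampled p N v -> (0 < M)%N ->
  sampled p (N * M) (fun j => v (j %/ M)%N).
Proof.
move=> [N0 vP] M0; split; first by rewrite muln_gt0 N0.
move=> j t jNM /andP[jt tj]; apply: vP; first by rewrite ltn_divLR.
have NM0 : (0 : R) < (N * M)%:R by rewrite ltr0n muln_gt0 N0.
have NR0 : (0 : R) < N%:R by rewrite ltr0n.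
have scale k : (k%:R / N%:R : R) = (k * M)%:R / (N * M)%:R.
  by rewrite !natrM invfM mulrACA divff ?mulr1// pnatr_eq0 -lt0n.
rewrite !scale; apply/andP; split.
  by apply: le_trans jt; rewrite ler_pM2r ?invr_gt0// ler_nat leq_trunc_div.
apply: le_trans tj _; rewrite ler_pM2r ?invr_gt0// ler_nat; exact: ltn_ceil.
Qed.

Lemma sampled_first (p : I -> X) N v : sampled p N v -> v 0%N \in carrier (p zero).
Proof. by move=> [N0 vP]; apply: vP => //; rewrite mul0r lexx divr_ge0 ?ler0n. Qed.

Lemma sampled_last (p : I -> X) N v : sampled p N v -> v N.-1 \in carrier (p one).
Proof.
move=> [N0 vP]; have NR0 : (0 : R) < N%:R by rewrite ltr0n.
apply: vP; rewrite ?ltn_predL// prednK// divff ?gt_eqF// lexx andbT.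
by rewrite ler_pdivrMr// mul1r ler_nat leq_pred.
Qed.

Lemma sampled_next (p : I -> X) N v k : sampled p N v -> (k < N.-1)%N ->
  (v k \in carrier (p (itv_proj (k.+1%:R / N%:R)))) /\
  (v k.+1 \in carrier (p (itv_proj (k.+1%:R / N%:R)))).
Proof.
move=> [N0 vP] kN; have NR0 : (0 : R) < N%:R by rewrite ltr0n.
by split; apply: vP; rewrite ?lexx ?andbT//= ?ler_pM2r ?invr_gt0// ?ler_nat//; lia.
Qed.

Lemma sampled_concat x y z (p : x ~~> y) (q : y ~~> z) N v w :
  sampled p N v -> sampled q N w ->
  sampled (concat p q) (N + N) (fun k => if (k < N)%N then v k else w (k - N)%N).
Proof.
move=> [N0 vP] [_ wP]; split; first by rewrite addn_gt0 N0.
move=> j t jN; have NR0 : (0 : R) < N%:R by rewrite ltr0n.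
have double k : (k%:R / N%:R : R) = 2 * (k%:R / (N + N)%:R).
  by rewrite natrD; field; rewrite ?gt_eqF//= ?addr_gt0//.
move=> /andP[jt tj]; case: ifP => jN'.
  rewrite concat_projE ifT; last first.
    apply: le_trans tj _; rewrite -(ler_pM2l (x := 2))// -double divff// .
    by rewrite ler_pdivrMr// mul1r ler_nat.
  by apply: vP => //; rewrite !double !ler_pM2l// jt.
have t2 : 1 <= 2 * t.
  rewrite (le_trans _ (_ : 2 * (j%:R / (N + N)%:R) <= 2 * t)) ?ler_pM2l//.
  by rewrite -double ler_pdivlMr// mul1r ler_nat leqNgt jN'.
(* At t = 1/2 the concatenation still takes the branch of [p], but there both branches give [y]. *)
have -> : concat p q (itv_proj t) = q (itv_proj (2 * t - 1)).
  rewrite concat_projE; case: ifP => // t1.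
  by rewrite path_ge1// path_le0//; lra.
have Nj : (N <= j)%N by rewrite leqNgt jN'.
apply: wP; first lia.
have shift k : (N <= k)%N -> ((k - N)%:R / N%:R : R) = 2 * (k%:R / (N + N)%:R) - 1.
  by move=> Nk; rewrite -double natrB// mulrBl divff// gt_eqF.
rewrite shift// -subSn// shift ?(leq_trans Nj)//.
by rewrite !lerD2r !ler_pM2l// jt.
Qed.

End Sampling.

Section CocycleHolonomy.
Variables (R : realType) (V : finType) (K : simplicial_complex V).
Variables (G : groupType) (c : V -> V -> G).
Local Notation I := (unit_itv R).
Local Notation X := (realization R K).
Local Notation "x ~~> y" := ({path I from x to y in X}) (at level 70).
Local Open Scope group_scope.

Definition simplicial_cocycle : Prop :=
  forall u v w, face K (finset.setU (finset.setU [set u] [set v]) [set w])%SET -> c u v * c v w = c u w.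

Hypothesis cc : simplicial_cocycle.

Lemma carrier_cocycle (x : X) u v w : u \in carrier x -> v \in carrier x ->
  w \in carrier x -> c u v * c v w = c u w.
Proof.
move=> ux vx wx; apply: cc; apply: face_sub (face_carrier x) _ _.
  by rewrite !finset.subUset !finset.sub1set ux vx wx.
by apply/set0Pn; exists u; rewrite !inE eqxx.
Qed.

Lemma cocycle_refl v : c v v = 1.
Proof.
by apply: (mulgI (c v v)); rewrite mulg1 cc// !finset.setUid face_vertex.
Qed.

(** The endpoints of a path need not be vertices, so [u] and [u'] are vertices chosen in their
    carriers and joined to the first and last sample. *)
Definition end_holonomy u u' (v : nat -> V) N :=
  c u (v 0%N) * holonomy c v N.-1 * c (v N.-1) u'.

(** The two sequences are the sides of a ladder; each of its squares has its corners in one simplex,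
    so the cocycle identity moves the holonomy across. *)
Lemma end_holonomy_eq u u' (v w : nat -> V) N :
  (exists x : X, [/\ u \in carrier x, v 0%N \in carrier x & w 0%N \in carrier x]) ->
  (exists x : X, [/\ u' \in carrier x, v N.-1 \in carrier x & w N.-1 \in carrier x]) ->
  (forall k, (k < N.-1)%N -> exists x : X,
     [/\ v k \in carrier x, v k.+1 \in carrier x,
         w k \in carrier x & w k.+1 \in carrier x]) ->
  end_holonomy u u' v N = end_holonomy u u' w N.
Proof.
move=> [x [ux vx wx]] [y [uy vy wy]] vw; rewrite /end_holonomy.
rewrite -(carrier_cocycle vy wy uy) mulgA; congr (_ * _).
rewrite -(carrier_cocycle ux vx wx) -!mulgA; congr (_ * _).
elim: N.-1 vw => [|n IH] vw /=; first by rewrite mul1g mulg1.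
have [z [vz vz' wz wz']] := vw n (leqnn _).
rewrite mulgA -IH; last by move=> k kn; apply: vw; exact: ltnW.
by rewrite -!mulgA (carrier_cocycle vz wz wz') (carrier_cocycle vz vz' wz').
Qed.

Lemma holonomy_repeat (v : nat -> V) M n : (0 < M)%N ->
  holonomy c (fun j => v (j %/ M)%N) n = holonomy c v (n %/ M).
Proof.
move=> M0; elim: n => [|n IH]; first by rewrite div0n.
rewrite /= IH divnS//; case: (_ %| _)%N; first by rewrite add1n.
by rewrite add0n cocycle_refl mulg1.
Qed.

Lemma end_holonomy_refine u u' (v : nat -> V) N M : (0 < N)%N -> (0 < M)%N ->
  end_holonomy u u' (fun j => v (j %/ M)%N) (N * M) = end_holonomy u u' v N.
Proof.
move=> N0 M0; rewrite /end_holonomy holonomy_repeat// div0n.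
suff -> : ((N * M).-1 %/ M = N.-1)%N by [].
by rewrite -{1}(prednK N0) mulSn addnC -subn1 -addnBA// divnMDl// divn_small ?addn0//; lia.
Qed.

(** Repeating vertices brings both samples to the same number of pieces; at each division point the
    neighbouring vertices of both lie in the carrier of the path. *)
Lemma sampled_unique x y (p : x ~~> y) u u' N v M w :
  u \in carrier x -> u' \in carrier y -> sampled p N v -> sampled p M w ->
  end_holonomy u u' v N = end_holonomy u u' w M.
Proof.
move=> ux uy sv sw; have [N0 M0] := (sv.1, sw.1).
rewrite -(end_holonomy_refine _ _ v N0 M0) -(end_holonomy_refine _ _ w M0 N0) mulnC.
have := sampled_refine sv M0; rewrite mulnC => {}sv.
have {}sw := sampled_refine sw N0.
apply: end_holonomy_eq => [||k kNM].
- exists x; split=> //; rewrite -(path_zero (s := p)).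
    exact: (sampled_first sv).
  exact: (sampled_first sw).
- exists y; split=> //; rewrite -(path_one (s := p)).
    exact: (sampled_last sv).
  exact: (sampled_last sw).
- have [v1 v2] := sampled_next sv kNM; have [w1 w2] := sampled_next sw kNM.
  by exists (p (itv_proj (k.+1%:R / (M * N)%:R))).
Qed.

Definition path_holonomy u u' (p : I -> X) : G :=
  if pselect (exists Nv : nat * (nat -> V), sampled p Nv.1 Nv.2) is left h
  then end_holonomy u u' (projT1 (cid h)).2 (projT1 (cid h)).1 else 1.

Lemma path_holonomyE x y (p : x ~~> y) u u' N v :
  u \in carrier x -> u' \in carrier y -> sampled p N v ->
  path_holonomy u u' p = end_holonomy u u' v N.
Proof.
move=> ux uy sv; rewrite /path_holonomy; case: pselect => [h|[]]; last by exists (N, v).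
by apply: (sampled_unique ux uy _ sv); exact: (projT2 (cid h)).
Qed.

(** Each row of a fine grid samples every path in its strip of the homotopy. The first row samples
    [p], the last [q], and adjacent rows both sample the path on the line between their strips. *)
Lemma path_holonomy_homotopic x y (p q : x ~~> y) u u' :
  u \in carrier x -> u' \in carrier y -> path_homotopic p q ->
  path_holonomy u u' p = path_holonomy u u' q.
Proof.
move=> ux uy [H [cH Hp Hq Hx Hy]].
have [N [v [N0 vP]]] := simplicial_grid cH.
have NR0 : (0 < (N%:R : R))%R by rewrite ltr0n.
have first0 : (0%:R / N%:R <= (0 : R) <= 1%:R / N%:R)%R.
  by rewrite mul0r lexx divr_ge0 ?ler0n.
have last1 : (N.-1%:R / N%:R <= (1 : R) <= N.-1.+1%:R / N%:R)%R.
  rewrite prednK// divff ?gt_eqF// lexx andbT.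
  by rewrite ler_pdivrMr// mul1r ler_nat leq_pred.
have next k : (k%:R / N%:R <= (k.+1%:R / N%:R : R) <= k.+1%:R / N%:R)%R /\
    (k.+1%:R / N%:R <= (k.+1%:R / N%:R : R) <= k.+2%:R / N%:R)%R.
  by rewrite !lexx /= andbT !ler_pM2r ?invr_gt0// !ler_nat !leqnSn.
have NN : (N.-1 < N)%N by rewrite ltn_predL.
rewrite (@path_holonomyE _ _ p _ _ N (v 0%N) ux uy); last first.
  by split=> // j t jN tP; rewrite -Hp; exact: vP.
rewrite (@path_holonomyE _ _ q _ _ N (v N.-1) ux uy); last first.
  by split=> // j t jN tP; rewrite -Hq; exact: vP.
have : (N.-1 <= N.-1)%N by [].
elim: {1 3}N.-1 => // i IH iN; rewrite IH 1?ltnW//; have [i1 i2] := next i.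
have iN1 : (i.+1 < N)%N by rewrite -(prednK N0).
have iN0 := ltnW iN1.
apply: end_holonomy_eq => [||k kN].
- exists x; split=> //; rewrite -(Hx (itv_proj (i.+1%:R / N%:R))).
    exact: vP first0.
  exact: vP first0.
- exists y; split=> //; rewrite -(Hy (itv_proj (i.+1%:R / N%:R))).
    exact: vP last1.
  exact: vP last1.
- have kN1 : (k.+1 < N)%N by rewrite -(prednK N0).
  have kN0 := ltnW kN1; have [k1 k2] := next k; exists (H (itv_proj (i.+1%:R / N%:R), itv_proj (k.+1%:R / N%:R))).
  by split; apply: vP.
Qed.

Lemma path_holonomy_concat x y z (p : x ~~> y) (q : y ~~> z) u u' u'' :
  u \in carrier x -> u' \in carrier y -> u'' \in carrier z ->
  path_holonomy u u'' (concat p q) = path_holonomy u u' p * path_holonomy u' u'' q.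
Proof.
move=> ux uy uz.
have [N [v [w [sv sw]]]] : exists N v w, sampled p N v /\ sampled q N w.
  have [[N v] /= sv] := sampled_exists (@cts_fun _ _ p).
  have [[M w] /= sw] := sampled_exists (@cts_fun _ _ q).
  exists (N * M)%N, (fun j => v (j %/ M)%N), (fun j => w (j %/ N)%N); split.
    exact: sampled_refine sv sw.1.
  by rewrite mulnC; exact: sampled_refine sw sv.1.
rewrite (path_holonomyE ux uy sv) (path_holonomyE uy uz sw).
rewrite (path_holonomyE ux uz (sampled_concat sv sw)) /end_holonomy.
have N0 := sv.1; rewrite N0.
have -> : ((N + N).-1 = N.-1.+1 + N.-1)%N by move: N0; clear; lia.
rewrite holonomy_add /= ltn_predL N0 ifF; last by move: N0; clear; lia.
rewrite ifF; last by move: N0; clear; lia.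
rewrite (_ : (N.-1.+1 - N = 0)%N); last by move: N0; clear; lia.
rewrite (_ : (N.-1.+1 + N.-1 - N = N.-1)%N); last by move: N0; clear; lia.
rewrite (@eq_holonomy _ _ _ _ v N.-1); last by move=> k kN; rewrite ifT//; move: N0 kN; clear; lia.
rewrite [X in _ * (_ * _ * X) * _ = _](@eq_holonomy _ _ _ _ w N.-1); last first.
  by move=> k kN; rewrite ifF; [congr w|]; move: N0 kN; clear; lia.
have vy := sampled_last sv; rewrite path_one in vy.
have wy := sampled_first sw; rewrite path_zero in wy.
by rewrite -(carrier_cocycle vy uy wy) !mulgA.
Qed.

Lemma path_holonomy_star x y (p : x ~~> y) u :
  (forall t, u \in carrier (p t)) -> path_holonomy u u p = 1.
Proof.
move=> pu; have ux : u \in carrier x by rewrite -(path_zero (s := p)).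
have uy : u \in carrier y by rewrite -(path_one (s := p)).
rewrite (@path_holonomyE _ _ p _ _ 1 (fun=> u) ux uy)//.
by rewrite /end_holonomy /= cocycle_refl !mulg1.
Qed.

Lemma path_holonomy_edge u w (uw : joinable (vertex R K u) (vertex R K w)) :
  path_holonomy u w (segment uw) = c u w.
Proof.
(* The first half of the segment lies in the open star of [u], the second half in that of [w]. *)
rewrite (@path_holonomyE _ _ _ _ _ 2 (fun k => if k is 0%N then u else w)).
- by rewrite /end_holonomy /= !cocycle_refl mul1g mulg1 mul1g.
- by rewrite carrier_vertex finset.set11.
- by rewrite carrier_vertex finset.set11.
split=> // j t j2 /andP[t1 t2]; rewrite in_carrier bary_mix// /mix_coord.
have tP : (0 <= t <= 1)%R.
  apply/andP; split; first by rewrite (le_trans _ t1) ?divr_ge0 ?ler0n.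
  by rewrite (le_trans t2)// ler_pdivrMr// mul1r ler_nat.
rewrite itv_projK// !bary_vertex; have /andP[t0 t3] := tP.
case: j j2 t1 t2 => [|[|//]] _ t1 t2; rewrite eqxx ?mulr1.
  apply: ltr_wpDr; first by rewrite mulr_ge0 ?ler0n.
  by rewrite subr_gt0 (le_lt_trans t2)// mul1r invf_lt1 ?ltr1n.
apply: ltr_wpDl; first by rewrite mulr_ge0 ?subr_ge0 ?ler0n.
by apply: lt_le_trans t1; rewrite mul1r invr_gt0.
Qed.

End CocycleHolonomy.

Section SegmentStar.
Variables (R : realType) (V : finType) (K : simplicial_complex V).

Lemma segment_star (x y : realization R K) (xy : joinable x y) u t :
  u \in carrier x -> u \in carrier y -> u \in carrier (segment xy t).
Proof.
rewrite !in_carrier bary_mix// /mix_coord => ux uy.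
have t0 := itv_val_ge0 t; have [->|t1] := eqVneq (itv_val t) 0.
  by rewrite subr0 mul1r mul0r addr0.
rewrite ltr_wpDl ?mulr_ge0 ?subr_ge0 ?itv_val_le1 ?bary_ge0// mulr_gt0//.
by rewrite lt0r t1.
Qed.

End SegmentStar.

(** * Loops as products of edges *)

Section EdgeLoops.
Variables (R : realType) (V : finType) (K : simplicial_complex V).
Local Notation I := (unit_itv R).
Local Notation X := (realization R K).
Local Notation "x ~~> y" := ({path I from x to y in X}) (at level 70).
Local Notation pt := (vertex R K).
Variable (x0 : X) (tau : forall x : X, x0 ~~> x).
Local Open Scope group_scope.

Definition segment_loop (x y : X) : pi1 R x0 :=
  if pselect (joinable x y) is left xy then loop_of tau (segment xy) else 1.

Lemma segment_loopE x y (xy : joinable x y) :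
  segment_loop x y = loop_of tau (segment xy).
Proof.
rewrite /segment_loop; case: pselect => // xy'.
by rewrite (Prop_irrelevance xy xy').
Qed.

Lemma segment_loop_concat x y z : face K (carrier x :|: carrier y :|: carrier z)%SET ->
  segment_loop x y * segment_loop y z = segment_loop x z.
Proof.
move=> Kxyz; have sub (a b : X) : (carrier a \subset carrier x :|: carrier y :|: carrier z)%SET ->
    (carrier b \subset carrier x :|: carrier y :|: carrier z)%SET -> joinable a b.
  exact: sub_joinable Kxyz.
have sx : (carrier x \subset carrier x :|: carrier y :|: carrier z)%SET.
  by rewrite -finset.setUA finset.subsetUl.
have sy : (carrier y \subset carrier x :|: carrier y :|: carrier z)%SET.
  by rewrite finset.setUAC finset.subsetUr.
have sz : (carrier z \subset carrier x :|: carrier y :|: carrier z)%SET.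
  by rewrite finset.subsetUr.
rewrite (segment_loopE (sub _ _ sx sy)) (segment_loopE (sub _ _ sy sz)).
rewrite (segment_loopE (sub _ _ sx sz)) -loop_of_concat.
by apply: loop_of_homotopic; exact: segment_concat.
Qed.

Lemma segment_loop_refl x : segment_loop x x = 1.
Proof.
apply: (mulgI (segment_loop x x)); rewrite mulg1 segment_loop_concat//.
by rewrite !finset.setUid; exact: face_carrier.
Qed.

Lemma star_loop x y v (p : x ~~> y) : (forall t, v \in carrier (p t)) ->
  loop_of tau p = segment_loop x (pt v) * segment_loop (pt v) y.
Proof.
move=> pv; have vx : v \in carrier x by rewrite -(path_zero (s := p)).
have vy : v \in carrier y by rewrite -(path_one (s := p)).
have xv := vertex_joinable vx; have yv := vertex_joinable vy.
have /(loop_of_homotopic tau) := star_path_homotopic xv yv pv.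
rewrite !loop_of_concat loop_of_const mulg1 -!segment_loopE => <-.
rewrite -mulgA segment_loop_concat ?segment_loop_refl ?mulg1//.
by rewrite finset.setUAC finset.setUid; exact: yv.
Qed.

Definition edge_loop u v := segment_loop (pt u) (pt v).

Lemma edge_loop_cocycle : simplicial_cocycle K edge_loop.
Proof. by move=> u v w uvw; apply: segment_loop_concat; rewrite !carrier_vertex. Qed.

Lemma carrier_segment_loop (x y : X) u v : u \in carrier x -> v \in carrier x ->
  carrier y \subset carrier x ->
  segment_loop (pt u) y * segment_loop y (pt v) = edge_loop u v.
Proof.
move=> ux vx yx; apply: segment_loop_concat; rewrite !carrier_vertex.
apply: face_sub (face_carrier x) _ _.
  by rewrite !finset.subUset !finset.sub1set ux vx yx.
by apply/set0Pn; exists u; rewrite !inE eqxx.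
Qed.

(** Each piece lies in an open star and is pulled to its vertex by [star_loop]. The two segments
    meeting at a division point stay in the carrier of that point and combine into an edge. *)
Lemma sampled_loop x y (p : x ~~> y) N v : sampled p N v ->
  loop_of tau p =
  segment_loop x (pt (v 0%N)) * holonomy edge_loop v N.-1 * segment_loop (pt (v N.-1)) y.
Proof.
move=> sv; have N0 := sv.1; have NR0 : (0 < (N%:R : R))%R by rewrite ltr0n.
pose d j : X := p (itv_proj (j%:R / N%:R)).
have piece j : (j < N)%N -> loop_of tau (subpath p (j%:R / N%:R) (j.+1%:R / N%:R)) =
    segment_loop (d j) (pt (v j)) * segment_loop (pt (v j)) (d j.+1).
  move=> jN; apply: star_loop => t; apply: sv.2 => //.
  have t0 := itv_val_ge0 t; have t1 := itv_val_le1 t.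
  have jj : (j%:R / N%:R <= (j.+1%:R / N%:R : R))%R by rewrite ler_pM2r ?invr_gt0// ler_nat.
  rewrite lerDr mulr_ge0 ?subr_ge0//= -lerBrDr.
  by rewrite ler_piMr// subr_ge0.
have dv j : (j < N.-1)%N -> segment_loop (pt (v j)) (d j.+1) * segment_loop (d j.+1) (pt (v j.+1)) =
    edge_loop (v j) (v j.+1).
  move=> jN; have [v1 v2] := sampled_next sv jN.
  exact: carrier_segment_loop v1 v2 (subxx _).
have main j : (j < N)%N -> loop_of tau (subpath p (0%:R / N%:R) (j.+1%:R / N%:R)) =
    segment_loop (d 0%N) (pt (v 0%N)) * holonomy edge_loop v j * segment_loop (pt (v j)) (d j.+1).
  elim: j => [|j IH] jN; first by rewrite piece// mulg1.
  rewrite -(loop_of_homotopic tau (subpath_concat p _ (j.+1%:R / N%:R) _)).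
  rewrite loop_of_concat IH ?(ltnW jN)// piece//= -dv ?mulgA//.
  by rewrite -ltnS (prednK N0).
have := main N.-1; rewrite ltn_predL => /(_ N0).
have d0 : d 0%N = x by rewrite /d mul0r path_zero.
have dN : d N.-1.+1 = y by rewrite /d prednK// divff ?gt_eqF// path_one.
rewrite d0 dN => <-; apply: loop_of_ext => t; rewrite subpathE.
by rewrite prednK// mul0r divff ?gt_eqF// subr0 mul1r addr0 itv_valK.
Qed.

End EdgeLoops.

(** * The fundamental group from a universal cocycle *)

Section FundamentalGroupOfCocycle.
Variables (R : realType) (V : finType) (K : simplicial_complex V).
Variables (G : groupType) (c : V -> V -> G).
Local Notation I := (unit_itv R).
Local Notation X := (realization R K).
Local Notation "x ~~> y" := ({path I from x to y in X}) (at level 70).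
Local Notation pt := (vertex R K).
Local Open Scope group_scope.

Definition universal_cocycle : Prop :=
  forall (P : groupType) (e : V -> V -> P), simplicial_cocycle K e ->
  exists (psi : G -> P) (h : V -> P), {morph psi : a b / a * b} /\
    forall u v, face K ([set u] :|: [set v])%SET -> e u v = (h u)^-1 * psi (c u v) * h v.

Definition edge_path (v : nat -> V) n :=
  forall k, (k < n)%N -> face K ([set v k] :|: [set v k.+1])%SET.

Definition holonomy_transitive : Prop :=
  forall u w g, exists n v,
    [/\ v 0%N = u, v n = w, edge_path v n & holonomy c v n = g].

Hypothesis cc : simplicial_cocycle K c.
Hypothesis cu : universal_cocycle.
Hypothesis ct : holonomy_transitive.

Lemma realize_edge_path v n : edge_path v n ->
  exists p : pt (v 0%N) ~~> pt (v n), path_holonomy c (v 0%N) (v n) p = holonomy c v n.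
Proof.
elim: n => [|n IH] vn.
  exists (segment (joinable_refl _)).
  by rewrite path_holonomy_edge// (cocycle_refl cc).
have [k kn|p pn] := IH; first by apply: vn; exact: ltnW.
have vv : joinable (pt (v n)) (pt (v n.+1)).
  by rewrite /joinable !carrier_vertex; exact: vn.
exists (concat p (segment vv)).
rewrite (@path_holonomy_concat R V K G c cc _ _ _ _ _ _ (v n)) ?carrier_vertex ?finset.set11//.
by rewrite pn path_holonomy_edge.
Qed.

Lemma realization_path_connected : path_connected R X.
Proof.
move=> x y; have [u ux] := carrier_neq0 x; have [w wy] := carrier_neq0 y.
have [n [v [v0 vn ve _]]] := ct u w 1; have [p _] := realize_edge_path ve.
rewrite v0 vn in p; constructor.
apply: (concat (segment (vertex_joinable ux))); apply: (concat p).
exact: segment (joinable_sym (vertex_joinable wy)).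
Qed.

Lemma pi1_cocycle_group (x0 : X) : group_iso (pi1 R x0) G.
Proof.
have tauP x : exists p : x0 ~~> x, True.
  by have [p] := realization_path_connected x0 x; exists p.
pose tau x := projT1 (cid (tauP x)).
have [u0 ux0] := carrier_neq0 x0.
pose hol (p : x0 ~~> x0) : G := path_holonomy c u0 u0 p.
have hol_hom p q : hol (concat p q) = hol p * hol q by exact: path_holonomy_concat.
have hol_homotopic p q : path_homotopic p q -> hol p = hol q.
  exact: path_holonomy_homotopic.
have [psi [h [psiM eh]]] := cu (edge_loop_cocycle tau).
have psi1 : psi 1 = 1 by apply: (mulgI (psi 1)); rewrite mulg1 -psiM mulg1.
pose t := loop_class (tau x0); pose A := segment_loop tau x0 (pt u0).
have A1 : segment_loop tau (pt u0) x0 = A^-1.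
  apply/esym/mulg1_eq; rewrite /A segment_loop_concat ?segment_loop_refl//.
  by rewrite finset.setUAC finset.setUid; exact: vertex_joinable.
(* The outer factors collect the gauge [h] and the paths [tau]; they are the same for all loops. *)
have loopE p : loop_class p = (t^-1 * A * (h u0)^-1) * psi (hol p) * (h u0 * A^-1 * t).
  have [[N v] /= sv] := sampled_exists (@cts_fun _ _ p).
  have v0x := sampled_first sv; rewrite path_zero in v0x.
  have vNx := sampled_last sv; rewrite path_one in vNx.
  have edgeE u w (x : X) : u \in carrier x -> w \in carrier x ->
      edge_loop tau u w = (h u)^-1 * psi (c u w) * h w.
    move=> ux wx; apply: eh; apply: face_sub (face_carrier x) _ _.
      by rewrite finset.subUset !finset.sub1set ux wx.
    by apply/set0Pn; exists u; rewrite !inE eqxx.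
  have holE j : (j <= N.-1)%N ->
      holonomy (edge_loop tau) v j = (h (v 0%N))^-1 * psi (holonomy c v j) * h (v j).
    elim: j => [|j IH] jN; first by rewrite /= psi1 mulg1 mulVg.
    have [v1 v2] := sampled_next sv jN.
    by rewrite /= IH 1?ltnW// (edgeE _ _ _ v1 v2) psiM -!mulgA mulVKg.
  rewrite (loop_of_loop tau) (sampled_loop tau sv) (holE _ (leqnn _)).
  have -> : segment_loop tau x0 (pt (v 0%N)) = A * ((h u0)^-1 * psi (c u0 (v 0%N)) * h (v 0%N)).
    rewrite -(edgeE _ _ _ ux0 v0x) segment_loop_concat// !carrier_vertex.
    apply: face_sub (face_carrier x0) _ _.
      by rewrite !finset.subUset !finset.sub1set ux0 v0x subxx.
    by apply/set0Pn; exists u0; rewrite !inE eqxx ?orbT.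
  have -> : segment_loop tau (pt (v N.-1)) x0 =
      ((h (v N.-1))^-1 * psi (c (v N.-1) u0) * h u0) * A^-1.
    rewrite -A1 -(edgeE _ _ _ vNx ux0) segment_loop_concat// !carrier_vertex.
    apply: face_sub (face_carrier x0) _ _.
      by rewrite !finset.subUset !finset.sub1set ux0 vNx subxx.
    by apply/set0Pn; exists u0; rewrite !inE eqxx ?orbT.
  rewrite /hol (path_holonomyE cc ux0 ux0 sv) /end_holonomy !psiM -/t.
  by rewrite -!mulgA !mulVKg.
pose f (a : pi1 R x0) : G := hol (repr a).
have fE p : f (loop_class p) = hol p.
  by apply: hol_homotopic; exact: repr_loop_class.
have fM : {morph f : a b / a * b}.
  elim/loop_class_ind => p; elim/loop_class_ind => q.
  by rewrite [_ * _]pi1_mulE !fE hol_hom.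
have f_inj : injective f.
  elim/loop_class_ind => p; elim/loop_class_ind => q; rewrite !fE => pq.
  by rewrite (loopE p) (loopE q) pq.
have f_surj g : exists a, f a = g.
  have [n [v [v0 vn ve vg]]] := ct u0 u0 g; have [] := realize_edge_path ve.
  rewrite v0 vn vg => p pg.
  (* The edge loop at [pt u0] is moved to [x0] along segments in the open star of [u0], which have
     trivial holonomy. *)
  pose s := segment (vertex_joinable ux0).
  pose s' := segment (joinable_sym (vertex_joinable ux0)).
  have in_s t' : u0 \in carrier (s t').
    by apply: segment_star; rewrite ?carrier_vertex ?finset.set11.
  have in_s' t' : u0 \in carrier (s' t').
    by apply: segment_star; rewrite ?carrier_vertex ?finset.set11.
  exists (loop_class (concat s (concat p s'))); rewrite fE /hol.
  have uu : u0 \in carrier (pt u0) by rewrite carrier_vertex finset.set11.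
  rewrite !(@path_holonomy_concat R V K G c cc _ _ _ _ _ _ u0)// pg.
  by rewrite !(path_holonomy_star cc)// mul1g mulg1.
have [f' ff'] := choice f_surj.
exists (HB.pack_for {multiplicative pi1 R x0 -> G} f (isMultiplicative.Build _ _ f fM)).
by exists f' => //= a; apply: f_inj.
Qed.

End FundamentalGroupOfCocycle.

(** * Lattice points as a Rips complex *)

Section Lattice.
Variable R : realType.

Definition lattice_coord (p : point3 * nat) (i : 'I_4) : nat :=
  nth 0%N [:: p.1.1.1; p.1.1.2; p.1.2; p.2] i.

(* Scaled by 1/2, so that distance less than 1 allows at most three unit steps. *)
Definition lattice_point (p : point3 * nat) : 'rV[R]_4 :=
  \row_i ((lattice_coord p i)%:R / 2).

Definition natdist (a b : nat) : nat := (a - b + (b - a))%N.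

Lemma natdist_sqr a b : (a%:R / 2 - b%:R / 2) ^+ 2 = (natdist a b ^ 2)%:R / 4 :> R.
Proof.
wlog ab : a b / (a <= b)%N => [hw|].
  have [/hw//|/ltnW/hw] := leqP a b.
  by rewrite /natdist addnC => <-; rewrite -opprB sqrrN.
have -> : natdist a b = (b - a)%N by rewrite /natdist; lia.
by rewrite natrX natrB//; field.
Qed.

(** The sum reaches 4 as soon as one term is at least 2, or when all four are 1. *)
Lemma sum_squares_lt4 a b c d :
  (a ^ 2 + b ^ 2 + c ^ 2 + d ^ 2 < 4)%N =
  [&& (a <= 1)%N, (b <= 1)%N, (c <= 1)%N, (d <= 1)%N & [|| a == 0%N, b == 0%N, c == 0%N | d == 0%N]].
Proof.
have big x : (1 < x)%N -> (4 <= x ^ 2)%N by move=> x1; rewrite -mulnn; exact: (leq_mul x1 x1).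
have [/big a4|a1] := ltnP 1 a.
  by apply/negbTE; rewrite -leqNgt; apply: leq_trans a4 _; rewrite -!addnA leq_addr.
have [/big b4|b1] := ltnP 1 b.
  apply/negbTE; rewrite -leqNgt; apply: leq_trans b4 _; move: (b ^ 2)%N => b'; clear; lia.
have [/big c4|c1] := ltnP 1 c.
  apply/negbTE; rewrite -leqNgt; apply: leq_trans c4 _; move: (c ^ 2)%N => c'; clear; lia.
have [/big d4|d1] := ltnP 1 d.
  apply/negbTE; rewrite -leqNgt; apply: leq_trans d4 _; move: (d ^ 2)%N => d'; clear; lia.
by case: a a1 => [|[|//]] _; case: b b1 => [|[|//]] _; case: c c1 => [|[|//]] _; case: d d1 => [|[|//]] _.
Qed.

Lemma lattice_dist_lt1 p q :
  (euclidean_dist (lattice_point p) (lattice_point q) < 1) = adj4 p q.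
Proof.
rewrite /euclidean_dist -[X in _ < X]sqrtr1 ltr_sqrt ?ltr01//.
under eq_bigr do rewrite !mxE natdist_sqr.
rewrite -mulr_suml -natr_sum ltr_pdivrMr// mul1r ltr_nat.
rewrite !big_ord_recl big_ord0 addn0 !addnA sum_squares_lt4 /lattice_coord /=.
move: p q => [[[x y] z] w] [[[x' y'] z'] w'].
rewrite /adj4 /near3 /coord3 /nearn /natdist /=.
have nE a b : (a - b + (b - a) <= 1)%N = ((a <= b.+1) && (b <= a.+1))%N by lia.
have eE a b : (a - b + (b - a) == 0)%N = (a == b) by lia.
rewrite !nE !eE.
by case: (_ <= _)%N; case: (_ <= _)%N => //=; rewrite ?andbF ?andbA -?orbA ?andbT.
Qed.

Lemma lattice_point_inj : injective lattice_point.
Proof.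
move=> p q /rowP pq.
have pqi i : lattice_coord p i = lattice_coord q i.
  have := pq i; rewrite !mxE => /mulIf h; apply/eqP; rewrite -(eqr_nat R).
  by apply/eqP/h; rewrite invr_eq0 pnatr_eq0.
have := pqi ord0; have := pqi (inord 1); have := pqi (inord 2); have := pqi (inord 3).
rewrite /lattice_coord !inordK//=.
by move: p q {pq pqi} => [[[x y] z] w] [[[x' y'] z'] w'] /= -> -> -> ->.
Qed.

End Lattice.

(** * Faces of a Rips complex as cliques *)

Section RipsFace.
Variables (R : realType) (n : nat) (X : {fset 'rV[R]_n}).

Lemma rips_faceP (s : {set X}) : s != finset.set0 ->
  (rips_face s <-> forall x y, x \in s -> y \in s -> euclidean_dist (val x) (val y) < 1).
Proof.
move=> s0; rewrite /rips_face s0 /=; split=> [s1 x y xs ys|s1].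
  apply: le_lt_trans s1; apply: ub_le_sup; first exact: has_ubound_dist.
  by exists (val x, val y) => //; split; [exists x|exists y].
(* A supremum of numbers below 1 might equal 1; finiteness of [X] bounds it by a maximum, which
   stays below 1. *)
pose B := \big[Order.max/0]_(xy : X * X | (xy.1 \in s) && (xy.2 \in s))
  euclidean_dist (val xy.1) (val xy.2).
have B1 : B < 1.
  by apply: bigmax_lt => // -[x y] /= /andP[xs ys]; exact: s1.
apply: le_lt_trans B1; apply: ge_sup.
  have /set0Pn[x xs] := s0.
  by exists (euclidean_dist (val x) (val x)), (val x, val x) => //; split; exists x.
move=> _ [[_ _] [[x xs <-] [y ys <-]] <-] /=.
apply: (@le_bigmax_cond _ _ _ _ (x, y)) => /=.
by rewrite (xs : x \in s) (ys : y \in s).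
Qed.

End RipsFace.

Lemma vtx_pos_inj n : injective (@vtx_pos n).
Proof.
have cell_inj : injective (@cell_pos n).
  move=> [x z|s a z|a z] [x' z'|s' b z'|b z'] //=.
  - by move=> [-> ->].
  - move=> [ab ->]; have [ss aa] : s = s' /\ a = b.
      by move: ab; case: s; case: s' => ab; first [exfalso; lia | split=> //; apply: val_inj => /=; lia].
    by rewrite ss aa.
  - by move=> [ab ->]; congr Top; apply: val_inj => /=; lia.
move=> [[] c|x y z] [[] d|x' y' z'] //= [].
- by move=> /cell_inj ->.
- by move=> /cell_inj ->.
- by move=> -> -> ->.
Qed.

(** * Transfer of the label to the Rips complex *)

Section RipsRealization.
Variables (R : realType) (n : nat) (rels : seq (word n)).
Local Notation G := (presented_group rels).
Local Notation M := (relator_bound rels).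
Local Notation k := (slab_number rels).
Local Notation W := (slab_width M).
Local Notation ok := (vtx_ok k M (relator rels)).
Local Open Scope group_scope.

(** The type [vtx] is infinite; admissible vertices have positions in this finite list, from which
    the vertex set is filtered. *)
Definition bounding_box : seq (point3 * nat) :=
  [seq (p, w) | p <- [seq (q, z) | q <- [seq (x, y) | x <- iota 0 (4 * n + 5), y <- iota 0 3],
                                   z <- iota 0 (k * W)], w <- iota 0 3].

Definition rips_vertices : {fset 'rV[R]_4} :=
  seq_fset tt [seq lattice_point R p | p <- bounding_box & `[< exists v, ok v /\ vtx_pos v = p >]].
Local Notation X := rips_vertices.

Lemma vtx_pos_bounded v : ok v -> vtx_pos v \in bounding_box.
Proof.
move=> vS; suff : [&& (vtx_pos v).1.1.1 < 4 * n + 5, (vtx_pos v).1.1.2 < 3,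
    (vtx_pos v).1.2 < k * W & (vtx_pos v).2 < 3]%N.
  move: (vtx_pos v) => [[[x y] z] w] /= /and4P[xB yB zB wB].
  by rewrite !allpairs_f// ?mem_iota.
case: v vS => [b c [[cx cz] _]|x y z [/= xB yB zB _]] /=.
  rewrite cz addnS ltnS cx /=; case: b; case: c {cx cz} => //.
by rewrite zB addnS !ltnS xB yB.
Qed.

Lemma rips_vertexP (x : 'rV[R]_4) :
  x \in X <-> exists v, ok v /\ x = lattice_point R (vtx_pos v).
Proof.
rewrite seq_fsetE; split=> [/mapP[p]|[v [vS ->]]].
  by rewrite mem_filter => /andP[/asboolP[v [vS <-]] _] ->; exists v.
apply/mapP; exists (vtx_pos v) => //; rewrite mem_filter vtx_pos_bounded// andbT.
by apply/asboolP; exists v.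
Qed.

Lemma decodeP (x : X) : exists v, ok v /\ val x = lattice_point R (vtx_pos v).
Proof. exact/rips_vertexP/valP. Qed.

Definition decode (x : X) : vtx n := projT1 (cid (decodeP x)).

Lemma decode_ok x : ok (decode x).
Proof. by have [] := projT2 (cid (decodeP x)). Qed.

Lemma val_decode x : val x = lattice_point R (vtx_pos (decode x)).
Proof. by have [] := projT2 (cid (decodeP x)). Qed.

Lemma origin_ok : ok (Low false (Base 0 0)).
Proof. by split=> //; split=> //=; rewrite muln_gt0 slab_width_gt0. Qed.

Definition origin : X :=
  [` (rips_vertexP _).2 (ex_intro _ _ (conj origin_ok erefl))]%fset.

(** Made total by the default [origin], so that a cocycle on the Rips complex pulls back to a
    function on all of [vtx], as [complex_label_universal] expects. *)
Definition encode (v : vtx n) : X := odflt origin (insub (lattice_point R (vtx_pos v))).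

Lemma val_encode v : ok v -> val (encode v) = lattice_point R (vtx_pos v).
Proof.
move=> vS; have vX : lattice_point R (vtx_pos v) \in X by apply/rips_vertexP; exists v.
by rewrite /encode insubT.
Qed.

Lemma encodeK v : ok v -> decode (encode v) = v.
Proof.
move=> vS; apply/vtx_pos_inj/(@lattice_point_inj R).
by rewrite -val_decode val_encode.
Qed.

Lemma decodeK x : encode (decode x) = x.
Proof. by apply: val_inj; rewrite val_encode ?val_decode//; exact: decode_ok. Qed.

Local Notation K := (rips_complex X).

Lemma rips_faceE (s : {set X}) : s != finset.set0 ->
  (face K s <-> forall x y, x \in s -> y \in s -> adj (decode x) (decode y)).
Proof.
move=> s0; apply: iff_trans (rips_faceP s0) _.
split=> sadj x y xs ys; have := sadj x y xs ys; by rewrite !val_decode lattice_dist_lt1.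
Qed.

Lemma rips_face2 (x y : X) : face K ([set x] :|: [set y])%SET <-> adj (decode x) (decode y).
Proof.
have s0 : ([set x] :|: [set y])%SET != finset.set0 :> {set X}.
  by apply/set0Pn; exists x; rewrite !inE eqxx.
apply: iff_trans (rips_faceE s0) _; split=> [|xy a b].
  by apply; rewrite !inE eqxx ?orbT.
by rewrite !inE => /orP[] /eqP-> /orP[] /eqP-> //; [exact: adj_refl|exact: adj_sym|exact: adj_refl].
Qed.

Lemma rips_face3 (x y z : X) : face K ([set x] :|: [set y] :|: [set z])%SET <->
  [/\ adj (decode x) (decode y), adj (decode y) (decode z) & adj (decode x) (decode z)].
Proof.
have s0 : ([set x] :|: [set y] :|: [set z])%SET != finset.set0 :> {set X}.
  by apply/set0Pn; exists x; rewrite !inE eqxx.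
apply: iff_trans (rips_faceE s0) _; split=> [xyz|[xy yz xz] a b].
  by split; apply: xyz; rewrite !inE eqxx ?orbT.
by rewrite !inE => /orP[/orP[]|] /eqP-> /orP[/orP[]|] /eqP-> //;
  first [exact: adj_refl | exact: adj_sym].
Qed.

Definition rips_label (x y : X) : G := complex_label rels (decode x) (decode y).

Lemma rips_label_cocycle : simplicial_cocycle K rips_label.
Proof.
move=> x y z /rips_face3[xy yz xz].
by apply: complex_label_cocycle => //; exact: decode_ok.
Qed.

Lemma rips_label_universal : universal_cocycle K rips_label.
Proof.
move=> P e ce.
have [|psi [h [psiM hE]]] := @complex_label_universal n rels P (fun u v => e (encode u) (encode v)).
  move=> u v w uS vS wS uv vw uw; apply: ce; apply/rips_face3.
  by rewrite !encodeK.
exists psi, (fun x => h (decode x)); split=> // x y /rips_face2 xy.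
by rewrite -hE ?decodeK//; exact: decode_ok.
Qed.

Lemma walk_edge_path u v (a : G) : ok u -> walk u v a ->
  exists m (p : nat -> X), [/\ p 0%N = encode u, p m = encode v, edge_path K p m &
    holonomy rips_label p m = a].
Proof.
move=> uS; elim=> [|v' w a' _ [m [p [p0 pm pe ph]]] vS wS vw].
  by exists 0%N, (fun=> encode u).
exists m.+1, (fun j => if (j <= m)%N then p j else encode w); split=> //.
- by rewrite ltnn.
- move=> j; rewrite ltnS => jm; rewrite jm; case: ltnP => [|mj]; first exact: pe.
  have -> : j = m by apply/eqP; rewrite eqn_leq jm.
  by apply/rips_face2; rewrite pm !encodeK.
rewrite /= leqnn ltnn pm /rips_label !encodeK// -ph; congr (_ * _).
by apply: eq_holonomy => j ->.
Qed.

Lemma rips_holonomy_transitive : holonomy_transitive K rips_label.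
Proof.
move=> x y a; have := walk_transitive a (decode_ok x) (decode_ok y).
by move=> /(walk_edge_path (decode_ok x)); rewrite !decodeK.
Qed.

End RipsRealization.

Section GroupIso.
Local Open Scope group_scope.

Lemma morph_group_iso (G H : groupType) (f : G -> H) :
  {morph f : x y / x * y} -> bijective f -> group_iso G H.
Proof.
move=> fM f_bij.
by exists (HB.pack_for {multiplicative G -> H} f (isMultiplicative.Build _ _ f fM)).
Qed.

Lemma group_iso_sym (G H : groupType) : group_iso G H -> group_iso H G.
Proof.
case=> f [g fK gK]; apply: (@morph_group_iso _ _ g); last by exists f.
by move=> x y; rewrite -{1}(gK x) -{1}(gK y) -gmulfM fK.
Qed.

Lemma group_iso_trans (G H J : groupType) :
  group_iso G H -> group_iso H J -> group_iso G J.
Proof.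
case=> f f_bij [g g_bij]; apply: (@morph_group_iso _ _ (g \o f)); last exact: bij_comp.
by move=> x y; rewrite /= !gmulfM.
Qed.

End GroupIso.

Theorem mainTheorem3 (R : realType) (G : groupType)
    (fpG : finitely_presented G) :
  exists X : {fset 'rV[R]_4},
    [/\ inhabited (realization R (rips_complex X)),
        path_connected R (realization R (rips_complex X)) &
        forall x0 : realization R (rips_complex X),
          group_iso (pi1 R x0) G].
Proof.
have [n [rels Giso]] := fpG; exists (rips_vertices R rels).
have cc := @rips_label_cocycle R n rels.
have cu := @rips_label_universal R n rels.
have ct := @rips_holonomy_transitive R n rels.
split.
- by constructor; exact: (vertex R _ (origin R rels)).
- exact: realization_path_connected cc ct.
- move=> x0; apply: group_iso_trans (group_iso_sym Giso).
  exact: pi1_cocycle_group cc cu ct x0.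
Qed.
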